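(* Let $\pi(x) = \#\{ p \leq x : p \text{ is prime} \}$. For large real numbers $x \geq 1$, $$\pi(x) = \frac{x}{\log x} + O\left( \frac{x}{\log^2 x} \right).$$ *)

(* Defs.v *)
From mathcomp Require Import all_boot all_order all_algebra.
From mathcomp Require Import finmap.
From mathcomp Require Import all_classical all_reals all_analysis.

Set Implicit Arguments.
Unset Strict Implicit.
Unset Printing Implicit Defensive.

Import Order.TTheory GRing.Theory Num.Theory.
Import numFieldNormedType.Exports.

Local Open Scope classical_set_scope.
Local Open Scope ring_scope.

Definition primes_le (R : realType) (x : R) : set nat :=
  [set p : nat | prime p /\ p%:R <= x].

(* [fset_set] sends an infinite set to the empty one; this rules that out. *)
Lemma finite_primes_le (R : realType) (x : R) : finite_set (primes_le x).
Proof.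
apply: (sub_finite_set _ (finite_II (Num.truncn x).+1)) => p /= [_ px].
by rewrite ltnS truncn_ge_nat // (le_trans _ px).
Qed.

Definition prime_pi (R : realType) (x : R) : nat :=
  #|` fset_set (primes_le x)|%fset.

(* The library gives [pinfty_nbhs] no canonical [filter_on] structure, without
   which the notation [f = g +O_ F h] does not typecheck at [+oo]. *)
Canonical pinfty_nbhs_filter_on (R : numFieldType) : filter_on R :=
  FilterType (pinfty_nbhs R) (_).

(* Main.v *)
(* For Re s > 1 let D(s) be the Dirichlet series with coefficients (Lambda(n) - 1) log^2 n. Euler
   summation bounds zeta and its derivatives by powers of log t, the inequality
   3 + 4 cos a + cos 2a >= 0 bounds 1 / zeta in the same way, and the poles at s = 1 cancel, so that
   D(s) = O(sqrt (|t| + 2)) uniformly as Re s tends to 1. The function |u| is a constant multiple of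
   the integral over t > 0 of (1 - cos (u t)) / t^2, and a trapezoid with edges of length h is a
   combination of four translates of |u|. Hence, without contour integration, the sum of
   (Lambda(n) - 1) (log^2 n / n) g(log n) is O(log N + 1 / h) when g is such a trapezoid, equal to 1 on
   [0, log N]. As Lambda >= 0, the choice h = 1 / log N allows g to be replaced by the indicator of
   n <= N, and Abel summation gives pi(N) = N / log N + O(N / log^2 N).

   This is an estimate in one model of the reals. It passes to any other one as a statement about
   natural numbers: in every model log n lies between k and k + 2, where k is the largest integer
   with ((k + 1) / k)^(k (k + 1)) <= n. *)
From HB Require Import structures.
From mathcomp Require Import all_boot.
From Stdlib Require Reals ZArith Lra Lia Psatz.
From Coquelicot Require Coquelicot.

(** The weight log^2 n is dictated by the target. A bound O(log n) for the sums of (Lambda(n) - 1)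
    log^2 n / n, summed by parts against n / log^3 n whose increments are O(1 / log^3 n), leaves an
    error equal to the sum of 1 / log^2 n, of order N / log^2 N; the weight log n would only give N
    / log N.

    The square root comes from the kernel: it decays like 1 / t^2, so any growth of D(s) below a
    power t^a with a < 1 is harmless. Hence log t can be traded for a tiny power [ell] of t + 2, and
    only exponents have to be counted.

    Nothing is evaluated on the line Re s = 1 except a finite sum. The trapezoid has bounded
    support, so the smoothed sum is finite and passes to x = 1 by continuity. Uniformity comes from
    Euler summation, whose error N^(-1/2) does not degenerate as Re s tends to 1, while the rate of
    absolute convergence does.

    Convergence always carries an explicit power rate. This replaces theorems on interchange of
    limits: products of series, termwise derivatives and limits of inequalities all reduce to finite
    estimates. *)

Module RealPNT.

Import Reals ZArith Lra Lia Psatz.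
Import all_boot.
Import Coquelicot.Coquelicot.
Set Implicit Arguments.
Unset Strict Implicit.
Unset Printing Implicit Defensive.
Local Open Scope R_scope.

HB.instance Definition _ := Monoid.isComLaw.Build R 0 Rplus
  (fun a b c => esym (Rplus_assoc a b c)) Rplus_comm Rplus_0_l.
HB.instance Definition _ := Monoid.isMulLaw.Build R 0 Rmult Rmult_0_l Rmult_0_r.
HB.instance Definition _ := Monoid.isAddLaw.Build R Rmult Rplus
  Rmult_plus_distr_r Rmult_plus_distr_l.
HB.instance Definition _ := Monoid.isComLaw.Build C (RtoC 0) Cplus
  Cplus_assoc Cplus_comm Cplus_0_l.
HB.instance Definition _ := Monoid.isMulLaw.Build C (RtoC 0) Cmult Cmult_0_l Cmult_0_r.
HB.instance Definition _ := Monoid.isAddLaw.Build C Cmult Cplus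
  Cmult_plus_distr_r Cmult_plus_distr_l.

(** * Dominated complex series *)

Definition rsum (u : nat -> R) (N : nat) : R := \big[Rplus/0]_(1 <= n < N.+1) u n.
Definition csum (u : nat -> C) (N : nat) : C :=
  \big[Cplus/RtoC 0]_(1 <= n < N.+1) u n.

Lemma rsum0 u : rsum u 0 = 0.
Proof. by rewrite /rsum big_geq. Qed.

Lemma rsumS u N : rsum u N.+1 = rsum u N + u N.+1.
Proof. by rewrite /rsum big_nat_recr. Qed.

Lemma csum0 u : csum u 0 = 0.
Proof. by rewrite /csum big_geq. Qed.

Lemma csumS u N : csum u N.+1 = (csum u N + u N.+1)%C.
Proof. by rewrite /csum big_nat_recr. Qed.

Lemma rsum_le u v N :
  (forall n, (0 < n <= N)%N -> u n <= v n) -> rsum u N <= rsum v N.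
Proof.
elim: N => [|N IH] uv; first by rewrite !rsum0; lra.
rewrite !rsumS; apply: Rplus_le_compat; last by apply: uv; rewrite ltn0Sn leqnn.
by apply: IH => n /andP[n0 nN]; apply: uv; rewrite n0 leqW.
Qed.

Lemma rsum_eq u v N :
  (forall n, (0 < n <= N)%N -> u n = v n) -> rsum u N = rsum v N.
Proof. by move=> uv; apply: eq_big_nat => n; rewrite ltnS; exact: uv. Qed.

Lemma csum_eq u v N :
  (forall n, (0 < n <= N)%N -> u n = v n) -> csum u N = csum v N.
Proof. by move=> uv; apply: eq_big_nat => n; rewrite ltnS; exact: uv. Qed.

Lemma rsum_scal a u N : rsum (fun n => a * u n) N = a * rsum u N.
Proof. by rewrite /rsum big_distrr. Qed.

Lemma rsum_minus u v N : rsum (fun n => u n - v n) N = rsum u N - rsum v N.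
Proof. by elim: N => [|N IH]; rewrite ?rsum0 ?rsumS; [lra | rewrite IH; lra]. Qed.

Lemma csum_plus u v N : csum (fun n => (u n + v n)%C) N = (csum u N + csum v N)%C.
Proof. exact: big_split. Qed.

Lemma csum_scal a u N : csum (fun n => (a * u n)%C) N = (a * csum u N)%C.
Proof. by rewrite /csum big_distrr. Qed.

Lemma rsum_ge0 u N : (forall n, (0 < n <= N)%N -> 0 <= u n) -> 0 <= rsum u N.
Proof.
move=> u0; rewrite -[X in X <= _](_ : rsum (fun=> 0) N = 0); first exact: rsum_le.
by elim: N {u0} => [|N IH]; rewrite ?rsum0 // rsumS IH; lra.
Qed.

Lemma rsum_abs u N : Rabs (rsum u N) <= rsum (fun n => Rabs (u n)) N.
Proof.
elim: N => [|N IH]; first by rewrite !rsum0 Rabs_R0; lra.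
by rewrite !rsumS; apply: Rle_trans (Rabs_triang _ _) _; lra.
Qed.

Lemma csum_abs u N : Cmod (csum u N) <= rsum (fun n => Cmod (u n)) N.
Proof.
elim: N => [|N IH]; first by rewrite csum0 rsum0 Cmod_0; lra.
by rewrite csumS rsumS; apply: Rle_trans (Cmod_triangle _ _) _; lra.
Qed.

Lemma Re_csum u N : Re (csum u N) = rsum (fun n => Re (u n)) N.
Proof. by elim: N => [|N IH]; rewrite ?csum0 ?rsum0 // csumS rsumS -IH. Qed.

Lemma INR_gt0 n : (0 < n)%N -> 0 < INR n.
Proof. by move=> n0; apply: lt_0_INR; apply/ltP. Qed.

Lemma INR_ge1 n : (0 < n)%N -> 1 <= INR n.
Proof. by move=> n0; apply: (le_INR 1); apply/leP. Qed.

Lemma INR_leq m n : (m <= n)%N -> INR m <= INR n.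
Proof. by move=> mn; apply: le_INR; apply/leP. Qed.

Lemma ln_INR_ge0 n : 0 <= ln (INR n).
Proof.
case: n => [|n]; first by rewrite /= /ln; case: Rlt_dec => [h|_] /=; [case: (Rlt_irrefl _ h) | lra].
by rewrite -ln_1; apply: ln_le; [lra | apply: INR_ge1].
Qed.

Lemma ln_le_sub1 x : 0 < x -> ln x <= x - 1.
Proof. by move=> x0; have := exp_ineq1_le (ln x); rewrite exp_ln //; lra. Qed.

Lemma Rpower_gt0 x y : 0 < Rpower x y.
Proof. exact: exp_pos. Qed.

Lemma exp_le x y : x <= y -> exp x <= exp y.
Proof. by case=> [h|->]; [left; apply: exp_increasing | right]. Qed.

Lemma inv_le_diff_ln n : (0 < n)%N -> / INR n.+1 <= ln (INR n.+1) - ln (INR n).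
Proof.
move=> n0; have n1 := INR_ge1 n0; have n1' : 0 < INR n.+1 by apply: INR_gt0.
have := ln_le_sub1 (x := INR n / INR n.+1).
rewrite ln_div; [|lra..].
have -> : INR n / INR n.+1 - 1 = - / INR n.+1 by rewrite S_INR; field; rewrite -S_INR; lra.
by move=> h; have := h (Rdiv_lt_0_compat _ _ (Rlt_le_trans _ _ _ Rlt_0_1 n1) n1'); lra.
Qed.

(** A discrete form of integrating [a * x ^ (-1 - a)] over [[n, n + 1]]: write the ratio of the two
    powers as [exp (a * d)] with [d >= / (n + 1)] and use [exp y >= 1 + y]. The right side
    telescopes, which bounds the tails of all dominated series. *)
Lemma Rpower_tail a n : 0 < a -> (0 < n)%N ->
  a * Rpower (INR n.+1) (-1 - a) <= Rpower (INR n) (- a) - Rpower (INR n.+1) (- a).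
Proof.
move=> a0 n0; have n1 := INR_ge1 n0; have n1' : 0 < INR n.+1 by apply: INR_gt0.
have -> : Rpower (INR n.+1) (-1 - a) = Rpower (INR n.+1) (- a) * / INR n.+1.
  by rewrite -(Rpower_1 (INR n.+1)) // -Rpower_Ropp Rpower_1 // -Rpower_plus; congr Rpower; ring.
have -> : Rpower (INR n) (- a) =
    Rpower (INR n.+1) (- a) * exp (a * (ln (INR n.+1) - ln (INR n))).
  by rewrite /Rpower -exp_plus; congr exp; ring.
have h1 := inv_le_diff_ln n0.
have h2 := exp_ineq1_le (a * (ln (INR n.+1) - ln (INR n))).
have h3 := Rpower_gt0 (INR n.+1) (- a).
set X := exp _ in h2 *; set d := ln _ - _ in h1 h2 *; set P := Rpower _ _ in h3 *.
have : P * (a * / INR n.+1) <= P * (a * d).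
  by apply: Rmult_le_compat_l; [lra | apply: Rmult_le_compat_l; lra].
have : P * (1 + a * d) <= P * X by apply: Rmult_le_compat_l; lra.
lra.
Qed.

Lemma Rpower_cvg0 a e : 0 < a -> 0 < e ->
  exists N, forall n, (N < n)%N -> Rpower (INR n) (- a) < e.
Proof.
move=> a0 e0; have [N [HN N0]] := archimed_cor1 _ (exp_pos (ln e / a)).
exists N => n Nn; have n0 : 0 < INR n by apply: INR_gt0; apply: leq_ltn_trans Nn.
rewrite -[e in _ < e](exp_ln e) // /Rpower; apply: exp_increasing.
have -> : ln e = a * (ln e / a) by field; lra.
suff : - ln (INR n) < ln e / a by move=> h; nra.
have N0' : 0 < INR N by apply: lt_0_INR.
rewrite -ln_Rinv // -[X in _ < X]ln_exp; apply: ln_increasing; first exact: Rinv_0_lt_compat.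
apply: Rle_lt_trans HN; apply: Rinv_le_contravar => //.
by apply: INR_leq; apply: ltnW.
Qed.

(* [Lim_seq] is total: this is the sum of the series only when the partial sums converge. *)
Definition cinf (u : nat -> C) : C :=
  (real (Lim_seq (fun N => Re (csum u N))), real (Lim_seq (fun N => Im (csum u N)))).

Lemma im_le_Cmod c : Rabs (Im c) <= Cmod c.
Proof.
have := re_le_Cmod (c * Ci)%C; rewrite Cmod_mult Cmod_Ci Rmult_1_r.
by rewrite /Re /= (_ : c.1 * 0 - c.2 * 1 = - Im c) ?Rabs_Ropp //; rewrite /Im; ring.
Qed.

Lemma Cmod_le_ReIm c : Cmod c <= Rabs (Re c) + Rabs (Im c).
Proof.
rewrite {1}(_ : c = (RtoC (Re c) + Ci * RtoC (Im c))%C); last first.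
  by case: c => x y; rewrite /Re /Im /Cplus /Cmult /=; congr (_, _); ring.
by apply: Rle_trans (Cmod_triangle _ _) _; rewrite Cmod_mult Cmod_Ci !Cmod_R; lra.
Qed.

(** The rate forces both coordinates of the partial sums to converge, so the totalised limit in
    [cinf] is a true sum. [K] has no assumed sign, hence the [Rabs K + 1] in the proof. *)
Lemma cinf_unique u l K b : 0 < b ->
  (forall N, (0 < N)%N -> Cmod (l - csum u N)%C <= K * Rpower (INR N) (- b)) ->
  cinf u = l.
Proof.
move=> b0 H.
have cv (f : C -> R) (fl : forall x y, f (x - y)%C = f x - f y)
    (fle : forall x, Rabs (f x) <= Cmod x) :
    is_lim_seq (fun N => f (csum u N)) (f l).
  apply/is_lim_seq_spec => e; have e0 := cond_pos e.
  have [N HN] := @Rpower_cvg0 b (e / (Rabs K + 1)) b0 (Rdiv_lt_0_compat _ _ e0 (Rle_lt_0_plus_1 _ (Rabs_pos K))).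
  exists N.+1 => n /leP Nn; have n0 : (0 < n)%N by apply: leq_ltn_trans Nn.
  rewrite -fl -Rabs_Ropp.
  have -> : - f (csum u n - l)%C = f (l - csum u n)%C by rewrite !fl; ring.
  apply: Rle_lt_trans (fle _) _; apply: Rle_lt_trans (H _ n0) _.
  have h := HN _ Nn; have h1 := Rpower_gt0 (INR n) (- b); have h2 := Rle_abs K.
  have h3 := Rabs_pos K.
  apply: Rle_lt_trans (_ : (Rabs K + 1) * Rpower (INR n) (- b) < e); first nra.
  rewrite (_ : e = (Rabs K + 1) * (e / (Rabs K + 1)) :> R); last by field; lra.
  by apply: Rmult_lt_compat_l; lra.
rewrite /cinf.
have -> := is_lim_seq_unique _ _ (cv Re (fun x y => erefl) re_le_Cmod).
have -> := is_lim_seq_unique _ _ (cv Im (fun x y => erefl) im_le_Cmod).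
by rewrite /= -surjective_pairing.
Qed.

(** The exponent is written [-1 - a] so that [a] is also the rate of convergence: the tail after [N]
    is at most [M / a * N ^ (- a)]. *)
Definition dominated (u : nat -> C) (M a : R) : Prop :=
  forall n, (0 < n)%N -> Cmod (u n) <= M * Rpower (INR n) (-1 - a).

Lemma dominated_M_ge0 u M a : dominated u M a -> 0 <= M.
Proof.
move=> du; have := Cmod_ge_0 (u 1%N); have := du 1%N isT.
by have := Rpower_gt0 (INR 1) (-1 - a); nra.
Qed.

Lemma dominated_sub u M a N N' : 0 < a -> dominated u M a -> (0 < N <= N')%N ->
  Cmod (csum u N' - csum u N)%C <=
    M / a * (Rpower (INR N) (- a) - Rpower (INR N') (- a)).
Proof.
move=> a0 du /andP[N0 NN']; rewrite -(subnKC NN'); elim: (N' - N)%N => [|k IH].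
  rewrite addn0 (_ : _ - _ = 0)%C; last by ring.
  by rewrite Cmod_0 Rminus_diag Rmult_0_r; lra.
rewrite addnS csumS.
have -> : (csum u (N + k) + u (N + k).+1 - csum u N =
   (csum u (N + k) - csum u N) + u (N + k).+1)%C by ring.
apply: Rle_trans (Cmod_triangle _ _) _.
have h1 := du (N + k).+1 isT.
have Nk0 : (0 < N + k)%N by rewrite addn_gt0 N0.
have h2 := Rpower_tail a0 Nk0.
have M0 := dominated_M_ge0 du.
set A := Rpower _ (-1 - a) in h1 h2; set B := Rpower (INR (N + k)) _ in h2 IH *.
set D := Rpower (INR (N + k).+1) (- a) in h2 *.
apply: Rle_trans (Rplus_le_compat _ _ _ _ IH h1) _.
have : M / a * (a * A) <= M / a * (B - D).
  by apply: Rmult_le_compat_l => //; apply: Rdiv_le_0_compat.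
have -> : M / a * (a * A) = M * A by field; lra.
by lra.
Qed.

Lemma real_cauchy_rate (x : nat -> R) (K b : R) : 0 < b -> 0 <= K ->
  (forall N N', (0 < N <= N')%N -> Rabs (x N' - x N) <= K * Rpower (INR N) (- b)) ->
  exists l : R, is_lim_seq x l.
Proof.
move=> b0 K0 H.
suff /ex_lim_seq_cauchy_corr [l hl] : ex_lim_seq_cauchy x by exists l.
move=> e; have e0 := cond_pos e.
have K2 : 0 < 2 * (K + 1) by lra.
have [N HN] := @Rpower_cvg0 b (e / (2 * (K + 1))) b0 (Rdiv_lt_0_compat _ _ e0 K2).
have hN : K * Rpower (INR N.+1) (- b) < e / 2.
  have := HN _ (leqnn N.+1); have := Rpower_gt0 (INR N.+1) (- b) => h1 h2.
  apply: Rle_lt_trans (_ : (K + 1) * Rpower (INR N.+1) (- b) < _); first nra.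
  rewrite (_ : e / 2 = (K + 1) * (e / (2 * (K + 1)))); last by field; lra.
  by apply: Rmult_lt_compat_l; lra.
exists N.+1 => n m /leP hn /leP hm.
have := H N.+1 n; rewrite hn => /(_ isT) h1.
have := H N.+1 m; rewrite hm => /(_ isT) h2.
have -> : x n - x m = (x n - x N.+1) - (x m - x N.+1) by ring.
by move: h1 h2; split_Rabs; lra.
Qed.

Lemma dominated_cinf u M a N : 0 < a -> dominated u M a -> (0 < N)%N ->
  Cmod (cinf u - csum u N)%C <= M / a * Rpower (INR N) (- a).
Proof.
move=> a0 du.
have M0 := dominated_M_ge0 du.
have Ma : 0 <= M / a by apply: Rdiv_le_0_compat.
have D n n' : (0 < n <= n')%N -> Cmod (csum u n' - csum u n)%C <= M / a * Rpower (INR n) (- a).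
  move=> h; apply: Rle_trans (dominated_sub a0 du h) _.
  by apply: Rmult_le_compat_l => //; have := Rpower_gt0 (INR n') (- a); lra.
have [|lr hr] := @real_cauchy_rate (fun N => Re (csum u N)) (M / a) a a0 Ma.
  by move=> n n' h; apply: Rle_trans (D _ _ h); exact: (re_le_Cmod (_ - _)%C).
have [|li hi] := @real_cauchy_rate (fun N => Im (csum u N)) (M / a) a a0 Ma.
  by move=> n n' h; apply: Rle_trans (D _ _ h); exact: (im_le_Cmod (_ - _)%C).
have -> : cinf u = (lr, li).
  by rewrite /cinf (is_lim_seq_unique _ _ hr) (is_lim_seq_unique _ _ hi).
move=> N0; apply: le_epsilon => e e0.
have e4 : 0 < e / 2 by lra.
have /is_lim_seq_spec/(_ (mkposreal _ e4)) [n1 /= h1] := hr.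
have /is_lim_seq_spec/(_ (mkposreal _ e4)) [n2 /= h2] := hi.
pose n := maxn N (maxn n1 n2).
have -> : ((lr, li) - csum u N = ((lr, li) - csum u n) + (csum u n - csum u N))%C by ring.
apply: Rle_trans (Cmod_triangle _ _) _.
have hD : Cmod (csum u n - csum u N)%C <= M / a * Rpower (INR N) (- a).
  by apply: D; rewrite N0 leq_maxl.
have : Cmod ((lr, li) - csum u n)%C <= e.
  apply: Rle_trans (Cmod_le_ReIm _) _.
  have /h1 : (n1 <= n)%coq_nat by apply/leP; rewrite /n !leq_max leqnn orbT.
  have /h2 : (n2 <= n)%coq_nat by apply/leP; rewrite /n !leq_max leqnn !orbT.
  rewrite /Re /Im /=; split_Rabs; lra.
by lra.
Qed.

Lemma harmonic_le N : (0 < N)%N -> rsum (fun n => / INR n) N <= 1 + ln (INR N).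
Proof.
elim: N => [//|[|N] IH] _; first by rewrite rsumS rsum0 /= ln_1 Rinv_1; lra.
by rewrite rsumS; have := IH isT; have := @inv_le_diff_ln N.+1 isT; lra.
Qed.

Lemma ln_le_Rpower x b : 0 < x -> 0 < b -> ln x <= / b * Rpower x b.
Proof.
move=> x0 b0; have := exp_ineq1_le (b * ln x); rewrite -/(Rpower x b) => h.
by apply: (Rmult_le_reg_l b) => //; rewrite -Rmult_assoc Rinv_r; lra.
Qed.

Lemma Rpower_ge1 x b : 1 <= x -> 0 <= b -> 1 <= Rpower x b.
Proof.
move=> x1 b0; rewrite -exp_0; apply: exp_le; apply: Rmult_le_pos => //.
by rewrite -ln_1; apply: ln_le; lra.
Qed.

(** This is [ln x <= / c * x ^ c] with [c = b / (k + 1)], raised to the power [k]. Dividing [b] by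
    [k + 1] and not by [k] covers [k = 0] without a separate case. *)
Lemma pow_ln_le (k n : nat) b : 0 < b -> (0 < n)%N ->
  ln (INR n) ^ k <= (INR k.+1 / b) ^ k * Rpower (INR n) b.
Proof.
move=> b0 n0; have n1 := INR_ge1 n0; have k0 : 0 < INR k.+1 by apply: INR_gt0.
have c0 : 0 < b / INR k.+1 by apply: Rdiv_lt_0_compat.
apply: Rle_trans (_ : (INR k.+1 / b * Rpower (INR n) (b / INR k.+1)) ^ k <= _).
  apply: pow_incr; split; first exact: ln_INR_ge0.
  have -> : INR k.+1 / b = / (b / INR k.+1) by field; lra.
  by apply: ln_le_Rpower => //; lra.
rewrite Rpow_mult_distr; apply: Rmult_le_compat_l.
  by apply: pow_le; left; apply: Rdiv_lt_0_compat.
rewrite -Rpower_pow; last exact: Rpower_gt0.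
rewrite Rpower_mult; apply: Rle_Rpower => //.
rewrite S_INR in k0 *; apply: (Rmult_le_reg_r (INR k + 1)) => //.
have -> : b / (INR k + 1) * INR k * (INR k + 1) = b * INR k by field; lra.
by nra.
Qed.

(** * Dirichlet series of the von Mangoldt function *)

Definition vonMangoldt (n : nat) : R :=
  if primes n is [:: p] then ln (INR p) else 0.

Lemma vonMangoldt_prime_power p k : prime p -> (0 < k)%N ->
  vonMangoldt (p ^ k) = ln (INR p).
Proof. by move=> pp k0; rewrite /vonMangoldt primesX // primes_prime. Qed.

Lemma vonMangoldt_ge0 n : 0 <= vonMangoldt n.
Proof.
rewrite /vonMangoldt; case: (primes n) => [|p [|q s]]; try by lra.
exact: ln_INR_ge0.
Qed.

Lemma vonMangoldt_eq0 n : ~~ (size (primes n) == 1)%N -> vonMangoldt n = 0.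
Proof. by rewrite /vonMangoldt; case: (primes n) => [|p [|q s]]. Qed.

Lemma primes1_eq n p : primes n = [:: p] -> n = (p ^ logn p n)%N /\ prime p.
Proof.
case: n => [//|n] E.
have : p \in primes n.+1 by rewrite E mem_head.
rewrite mem_primes => /and3P[pp _ _]; split=> //.
have := prod_prime_decomp (ltn0Sn n); rewrite prime_decompE E /= big_seq1 => {1}->.
by [].
Qed.

Lemma vonMangoldt_le_ln n : (0 < n)%N -> vonMangoldt n <= ln (INR n).
Proof.
move=> n0; rewrite /vonMangoldt; case E: (primes n) => [|p [|q s]]; try exact: ln_INR_ge0.
have : p \in primes n by rewrite E mem_head.
rewrite mem_primes => /and3P[pp _ pn].
by apply: ln_le; [apply: INR_gt0; apply: prime_gt0 | apply: INR_leq; apply: dvdn_leq].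
Qed.

(** The divisors gained are those divisible by [p ^ k.+1], and among them only [p ^ k.+1] itself is
    a prime power: a power of another prime would divide [m], and a smaller power of [p] is not new.
    The range is cut at an arbitrary [N] beyond the number, so that all [n] can share one range when
    sums are exchanged. *)
Lemma sum_vonMangoldt_step (p k m N : nat) : prime p -> coprime p m -> (0 < m)%N ->
  (p ^ k.+1 * m <= N)%N ->
  \big[Rplus/0]_(1 <= d < N.+1 | d %| p ^ k.+1 * m) vonMangoldt d =
  \big[Rplus/0]_(1 <= d < N.+1 | d %| p ^ k * m) vonMangoldt d + ln (INR p).
Proof.
move=> pp cpm m0 leN.
rewrite (bigID (fun d => d %| p ^ k * m)%N) /=; congr (_ + _).
  apply: eq_bigl => d; rewrite andb_idl // => h; apply: dvdn_trans h _.
  by rewrite dvdn_pmul2r // dvdn_exp2l.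
have pk0 : (0 < p ^ k.+1)%N by rewrite expn_gt0 prime_gt0.
have pN : (p ^ k.+1)%N \in index_iota 1 N.+1.
  by rewrite mem_index_iota pk0 ltnS; apply: leq_trans leN; apply: leq_pmulr.
rewrite big_mkcond (bigD1_seq (p ^ k.+1)%N) ?iota_uniq //=.
have -> : (p ^ k.+1 %| p ^ k.+1 * m)%N && ~~ (p ^ k.+1 %| p ^ k * m)%N.
  rewrite dvdn_mulr //= expnSr dvdn_pmul2l ?expn_gt0 ?prime_gt0 //.
  by rewrite -prime_coprime.
rewrite vonMangoldt_prime_power // big1 ?Rplus_0_r // => d dp; case: ifP => // /andP[dn].
case V: (size (primes d) == 1)%N; last by rewrite vonMangoldt_eq0 ?V.
move=> ndk; exfalso; apply: negP ndk _; move: V.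
case E: (primes d) => [|q [|q' s]] // _; have [dE qp] := primes1_eq E.
have [pq|npq] := eqVneq p q; last first.
  move: dn; rewrite Gauss_dvdr; first by move=> h; apply: dvdn_mull.
  by rewrite dE coprime_sym coprimeXl // coprimeXr // prime_coprime // dvdn_prime2.
subst q; move: dp dn; rewrite dE; move: (logn p d) => j.
rewrite eqn_exp2l ?prime_gt1 // Gauss_dvdl ?coprimeXl // dvdn_Pexp2l ?prime_gt1 //.
by move=> jk jk1; rewrite dvdn_mulr // dvdn_exp2l // -ltnS ltn_neqAle jk.
Qed.

(** Strong induction: the full power of the least prime factor is split off, the cofactor is
    smaller, and the prime is then put back one factor at a time. *)
Lemma sum_vonMangoldt_divisors (n N : nat) : (0 < n <= N)%N ->
  \big[Rplus/0]_(1 <= d < N.+1 | d %| n) vonMangoldt d = ln (INR n).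
Proof.
elim/ltn_ind: n N => n IH N /andP[n0 nN].
have [->|n1] := eqVneq n 1%N.
  rewrite ln_1; apply: big1 => d; rewrite dvdn1 => /eqP->.
  by rewrite vonMangoldt_eq0.
have {n1}n1 : (1 < n)%N by rewrite ltn_neqAle eq_sym n1.
have pp := pdiv_prime n1; set p := pdiv n in pp.
have [m cpm nE] := pfactor_coprime pp n0.
have k0 : (0 < logn p n)%N by rewrite logn_gt0 pi_pdiv.
have m0 : (0 < m)%N by move: n0; rewrite nE muln_gt0 => /andP[].
rewrite mulnC in nE; rewrite nE in nN *.
have mn : (m < n)%N.
  by rewrite [in ltnRHS]nE ltn_Pmull // -(exp1n (logn p n)) ltn_exp2r ?prime_gt1.
have IHm := IH m mn; clear -nN pp cpm m0 IHm.
move: (logn p n) nN => k; elim: k N => [|k IHk] N nN.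
  rewrite expn0 mul1n in nN *; apply: IHm; by rewrite m0 nN.
have pkm : (p ^ k * m <= N)%N.
  by apply: leq_trans nN; rewrite leq_pmul2r // leq_exp2l // prime_gt1.
rewrite sum_vonMangoldt_step // IHk // expnS -mulnA [in RHS]mult_INR ln_mult; first by ring.
  by apply: INR_gt0; apply: prime_gt0.
by apply: INR_gt0; rewrite muln_gt0 m0 expn_gt0 prime_gt0.
Qed.

Lemma csum_multiples d N (F : nat -> C) : (0 < d)%N ->
  \big[Cplus/RtoC 0]_(1 <= n < N.+1 | d %| n) F (n %/ d)%N = csum F (N %/ d)%N.
Proof.
move=> d0; rewrite big_mkcond; elim: N => [|N IH]; first by rewrite big_geq // div0n csum0.
rewrite big_nat_recr //= IH divnS //; case: ifP => dN.
  by rewrite csumS dN.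
by rewrite /= add0n; exact: Cplus_0_r.
Qed.

Lemma csum_convolution (A B w : nat -> C) N :
  (forall n, (0 < n <= N)%N -> w n =
     \big[Cplus/RtoC 0]_(1 <= d < N.+1 | d %| n) (A d * B (n %/ d)%N)%C) ->
  csum w N = csum (fun d => A d * csum B (N %/ d)%N)%C N.
Proof.
move=> wE; rewrite (csum_eq wE) /csum.
rewrite (exchange_big_dep_nat xpredT) //=; apply: eq_big_nat => d /andP[d0 dN].
by rewrite -/(csum _ _) -csum_multiples // big_distrr.
Qed.

Lemma csum_sub u v N : csum (fun n => (u n - v n)%C) N = (csum u N - csum v N)%C.
Proof.
elim: N => [|N IH]; first by rewrite !csum0; ring.
by rewrite !csumS IH; ring.
Qed.

Lemma csum_scalr a u N : csum (fun n => (u n * a)%C) N = (csum u N * a)%C.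
Proof. by rewrite /csum big_distrl. Qed.

(** The quotient [q] is at least 1, so [N < d * (q + 1) <= 2 * d * q]; this gives the factor
    [Rpower 2 a]. *)
Lemma Rpower_divn_le a d N : 0 < a -> (0 < d <= N)%N ->
  Rpower (INR (N %/ d)%N) (- a) <= Rpower 2 a * Rpower (INR d) a * Rpower (INR N) (- a).
Proof.
move=> a0 /andP[d0 dN]; have N0 := leq_trans d0 dN.
have q0 : (0 < N %/ d)%N by rewrite divn_gt0.
have d0' := INR_gt0 d0; have N0' := INR_gt0 N0; have q0' := INR_gt0 q0.
rewrite /Rpower -!exp_plus; apply: exp_le.
suff : ln (INR N) <= ln 2 + ln (INR d) + ln (INR (N %/ d)) by nra.
rewrite -!ln_mult; [|nra..].
apply: ln_le => //; rewrite -[2]/(INR 2) -!mult_INR; apply: INR_leq.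
rewrite {1}(divn_eq N d); move: q0 (ltn_pmod N d0) {q0'}.
move: (N %/ d)%N (N %% d)%N => q r /ltP q0 /ltP rd.
by apply/leP; rewrite -!multE -plusE; nia.
Qed.

(** Constant and rate are existential: sums and Dirichlet products worsen both, and only the limit
    matters afterwards. *)
Definition cvgC (u : nat -> C) (l : C) : Prop :=
  exists K b, 0 < b /\ forall N, (0 < N)%N ->
    Cmod (l - csum u N)%C <= K * Rpower (INR N) (- b).

Lemma cvgC_cinf u l : cvgC u l -> cinf u = l.
Proof. by move=> [K [b [b0 h]]]; exact: cinf_unique b0 h. Qed.

Lemma dominated_cvgC u M a : 0 < a -> dominated u M a -> cvgC u (cinf u).
Proof.
by move=> a0 du; exists (M / a), a; split=> // N; exact: dominated_cinf.
Qed.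

Lemma cvgC_ext u v l : (forall n, (0 < n)%N -> u n = v n) -> cvgC u l -> cvgC v l.
Proof.
move=> uv [K [b [b0 h]]]; exists K, b; split=> // N N0.
by rewrite -(csum_eq (u := u)); [exact: h | move=> n /andP[n0 _]; exact: uv].
Qed.

Lemma cvgC_add u v l m : cvgC u l -> cvgC v m -> cvgC (fun n => u n + v n)%C (l + m)%C.
Proof.
move=> [K [b [b0 h]]] [K' [b' [b'0 h']]].
exists (Rabs K + Rabs K'), (Rmin b b'); split; first exact: Rmin_pos.
move=> N N0; rewrite csum_plus.
have -> : (l + m - (csum u N + csum v N) = (l - csum u N) + (m - csum v N))%C by ring.
apply: Rle_trans (Cmod_triangle _ _) _.
rewrite Rmult_plus_distr_r.
have aux L c : Rmin b b' <= c ->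
    L * Rpower (INR N) (- c) <= Rabs L * Rpower (INR N) (- Rmin b b').
  move=> lec; apply: Rle_trans (Rmult_le_compat_r _ _ _ _ (Rle_abs L)) _.
    exact: Rlt_le (Rpower_gt0 _ _).
  apply: Rmult_le_compat_l; first exact: Rabs_pos.
  by apply: exp_le; have := ln_INR_ge0 N; nra.
apply: Rplus_le_compat.
  exact: Rle_trans (h _ N0) (aux _ _ (Rmin_l _ _)).
exact: Rle_trans (h' _ N0) (aux _ _ (Rmin_r _ _)).
Qed.

Lemma cvgC_scal c u l : cvgC u l -> cvgC (fun n => c * u n)%C (c * l)%C.
Proof.
move=> [K [b [b0 h]]]; exists (Cmod c * K), b; split=> // N N0.
rewrite csum_scal (_ : _ - _ = c * (l - csum u N))%C; last by ring.
rewrite Cmod_mult Rmult_assoc; apply: Rmult_le_compat_l; [exact: Cmod_ge_0 | exact: h].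
Qed.

(** Grouping by [d], the tail of [B] beyond [N / d] costs at most a constant times [d ^ (-1 - a) *
    (N / d) ^ (- a) = N ^ (- a) / d]. The sum over [d] is harmonic, and half of the rate [a] is
    given up to absorb its logarithm. *)
Lemma dirichlet_product (A B w : nat -> C) MA MB a : 0 < a ->
  dominated A MA a -> dominated B MB a ->
  (forall N n, (0 < n <= N)%N -> w n =
     \big[Cplus/RtoC 0]_(1 <= d < N.+1 | d %| n) (A d * B (n %/ d)%N)%C) ->
  cvgC w (cinf A * cinf B)%C.
Proof.
move=> a0 dA dB wE; have A0 := dominated_M_ge0 dA; have B0 := dominated_M_ge0 dB.
pose K := MA / a * Cmod (cinf B) + MA * (MB / a * Rpower 2 a) * (1 + 2 / a).
have a2 : 0 < a / 2 by lra.
exists K, (a / 2); split=> // N N0.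
rewrite (csum_convolution (wE N)).
have -> : (cinf A * cinf B - csum (fun d => A d * csum B (N %/ d)%N) N =
   (cinf A - csum A N) * cinf B + csum (fun d => A d * (cinf B - csum B (N %/ d)%N)) N)%C.
  rewrite [X in _ = (_ + X)%C](csum_eq (v := fun d => (A d * cinf B - A d * csum B (N %/ d)%N)%C)).
    by rewrite csum_sub csum_scalr; ring.
  by move=> n _; ring.
apply: Rle_trans (Cmod_triangle _ _) _; rewrite Cmod_mult.
have h1 := dominated_cinf a0 dA N0.
have N1 := INR_ge1 N0.
have P0 := Rpower_gt0 (INR N) (- (a / 2)).
have PE : Rpower (INR N) (- a) = Rpower (INR N) (- (a / 2)) * Rpower (INR N) (- (a / 2)).
  by rewrite -Rpower_plus; congr Rpower; field.
have P1 : Rpower (INR N) (- (a / 2)) <= 1.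
  by rewrite -exp_0; apply: exp_le; have := ln_INR_ge0 N; nra.
set P := Rpower (INR N) (- (a / 2)) in P0 P1 PE *.
have Ba : 0 <= MB / a by apply: Rdiv_le_0_compat.
have Aa : 0 <= MA / a by apply: Rdiv_le_0_compat.
have h2 : Cmod (csum (fun d => A d * (cinf B - csum B (N %/ d)%N))%C N) <=
    MA * (MB / a * Rpower 2 a) * Rpower (INR N) (- a) * (1 + ln (INR N)).
  apply: Rle_trans (csum_abs _ _) _.
  apply: Rle_trans (Rmult_le_compat_l _ _ _ _ (harmonic_le N0)); last first.
    apply: Rmult_le_pos; last by left; apply: Rpower_gt0.
    apply: Rmult_le_pos => //; apply: Rmult_le_pos => //; left; exact: Rpower_gt0.
  rewrite -rsum_scal; apply: rsum_le => d dN; rewrite Cmod_mult.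
  have /andP[d0 dN'] := dN; have d0' := INR_gt0 d0.
  have h3 := dA d d0.
  have q0 : (0 < N %/ d)%N by rewrite divn_gt0.
  have h4 := dominated_cinf a0 dB q0.
  have h5 := Rpower_divn_le a0 dN.
  have -> : / INR d = Rpower (INR d) (-1 - a) * Rpower (INR d) a.
    rewrite -Rpower_plus (_ : -1 - a + a = - (1)); last by ring.
    by rewrite Rpower_Ropp Rpower_1.
  apply: Rle_trans (Rmult_le_compat _ _ _ _ (Cmod_ge_0 _) (Cmod_ge_0 _) h3 _) _.
    apply: Rle_trans h4 _; apply: Rmult_le_compat_l h5; exact: Ba.
  by right; ring.
have h3 : ln (INR N) <= 2 / a * Rpower (INR N) (a / 2).
  have := @ln_le_Rpower (INR N) (a / 2); rewrite (_ : / (a / 2) = 2 / a); last by field; lra.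
  by apply; lra.
have PP : P * Rpower (INR N) (a / 2) = 1.
  by rewrite -Rpower_plus Rplus_opp_l Rpower_O //; lra.
have h4 : Rpower (INR N) (- a) * (1 + ln (INR N)) <= (1 + 2 / a) * P.
  rewrite PE; set Q := Rpower _ (a / 2) in PP h3.
  apply: Rle_trans (_ : P * P * (1 + 2 / a * Q) <= _).
    by apply: Rmult_le_compat_l; [nra | lra].
  have -> : P * P * (1 + 2 / a * Q) = P * P + 2 / a * P * (P * Q) by ring.
  rewrite PP; nra.
have h5 : MA / a * Rpower (INR N) (- a) * Cmod (cinf B) <= MA / a * Cmod (cinf B) * P.
  rewrite PE (_ : _ * Cmod _ = MA / a * Cmod (cinf B) * (P * P)); last by ring.
  apply: Rmult_le_compat_l; [exact: Rmult_le_pos (Cmod_ge_0 _) | nra].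
rewrite /K Rmult_plus_distr_r; apply: Rplus_le_compat.
  by apply: Rle_trans h5; apply: Rmult_le_compat_r h1; exact: Cmod_ge_0.
apply: Rle_trans h2 _; rewrite Rmult_assoc [X in _ <= X]Rmult_assoc.
apply: Rmult_le_compat_l h4; apply: Rmult_le_pos => //.
by apply: Rmult_le_pos => //; exact: Rlt_le (Rpower_gt0 _ _).
Qed.

Definition cexp (z : C) : C := (exp (Re z) * cos (Im z), exp (Re z) * sin (Im z)).

Lemma cexpD z w : cexp (z + w)%C = (cexp z * cexp w)%C.
Proof.
rewrite /cexp /Cmult /= /Re /Im /= exp_plus cos_plus sin_plus.
by congr (_, _); ring.
Qed.

Lemma Cmod_cexp z : Cmod (cexp z) = exp (Re z).
Proof.
rewrite /Cmod /cexp /=.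
have -> : exp (Re z) * cos (Im z) * (exp (Re z) * cos (Im z) * 1) +
    exp (Re z) * sin (Im z) * (exp (Re z) * sin (Im z) * 1) =
    (exp (Re z))² * ((sin (Im z))² + (cos (Im z))²) by rewrite /Rsqr; ring.
by rewrite sin2_cos2 Rmult_1_r sqrt_Rsqr //; left; exact: exp_pos.
Qed.

Definition npow (s : C) (n : nat) : C := cexp (- (s * RtoC (ln (INR n))))%C.

(* [Z k s] is (-1)^k times the k-th derivative of zeta at s, and [V k s] is (-1)^k times the k-th
   derivative of - zeta' / zeta. *)
Definition zterm (k : nat) (s : C) (n : nat) : C :=
  (RtoC (ln (INR n) ^ k) * npow s n)%C.
Definition vterm (k : nat) (s : C) (n : nat) : C :=
  (RtoC (vonMangoldt n) * zterm k s n)%C.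

Definition Z (k : nat) (s : C) : C := cinf (zterm k s).
Definition V (k : nat) (s : C) : C := cinf (vterm k s).

Lemma npowM s m n : (0 < m)%N -> (0 < n)%N ->
  npow s (m * n) = (npow s m * npow s n)%C.
Proof.
move=> m0 n0; rewrite /npow -cexpD mult_INR ln_mult; try exact: INR_gt0.
by congr cexp; rewrite RtoC_plus; ring.
Qed.

Lemma Cmod_npow s n : Cmod (npow s n) = Rpower (INR n) (- Re s).
Proof.
rewrite Cmod_cexp /Rpower; congr exp.
by rewrite /Re /Copp /Cmult /RtoC /=; ring.
Qed.

Definition ln_const (k : nat) (a : R) : R := (INR k.+1 / a) ^ k.

Lemma Cmod_zterm k s n : Cmod (zterm k s n) = ln (INR n) ^ k * Rpower (INR n) (- Re s).
Proof.
rewrite Cmod_mult Cmod_npow Cmod_R Rabs_pos_eq //; apply: pow_le; exact: ln_INR_ge0.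
Qed.

(** One half of the margin [2 * a] pays for the power of the logarithm, the other half remains as
    the rate. *)
Lemma dominated_zterm k s a : 0 < a -> 1 + 2 * a <= Re s ->
  dominated (zterm k s) (ln_const k a) a.
Proof.
move=> a0 sa n n0; rewrite Cmod_zterm.
apply: Rle_trans (_ : ln_const k a * Rpower (INR n) a * Rpower (INR n) (- Re s) <= _).
  apply: Rmult_le_compat_r; first exact: Rlt_le (Rpower_gt0 _ _).
  exact: pow_ln_le.
rewrite Rmult_assoc -Rpower_plus; apply: Rmult_le_compat_l.
  by apply: pow_le; apply: Rdiv_le_0_compat => //; exact: pos_INR.
by apply: exp_le; apply: Rmult_le_compat_r; [exact: ln_INR_ge0 | lra].
Qed.

Lemma dominated_vterm k s a : 0 < a -> 1 + 2 * a <= Re s ->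
  dominated (vterm k s) (ln_const k.+1 a) a.
Proof.
move=> a0 sa n n0; apply: Rle_trans (dominated_zterm k.+1 a0 sa n0).
rewrite Cmod_mult !Cmod_zterm Cmod_R Rabs_pos_eq; last exact: vonMangoldt_ge0.
rewrite -Rmult_assoc; apply: Rmult_le_compat_r; first exact: Rlt_le (Rpower_gt0 _ _).
apply: Rmult_le_compat_r; first by apply: pow_le; exact: ln_INR_ge0.
exact: vonMangoldt_le_ln.
Qed.

Lemma RtoC_bigsum (r : seq nat) (P : pred nat) (F : nat -> R) :
  RtoC (\big[Rplus/0]_(i <- r | P i) F i) =
  \big[Cplus/RtoC 0]_(i <- r | P i) RtoC (F i).
Proof. by apply: (big_morph RtoC) => // x y; rewrite RtoC_plus. Qed.

Section Products.
Variables (s : C) (a : R).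
Hypotheses (a0 : 0 < a) (sa : 1 + 2 * a <= Re s).

Let conv (A B : nat -> C) (N n : nat) : C :=
  \big[Cplus/RtoC 0]_(1 <= d < N.+1 | d %| n) (A d * B (n %/ d)%N)%C.

Lemma zterm1_conv N n : (0 < n <= N)%N ->
  zterm 1 s n = conv (vterm 0 s) (zterm 0 s) N n.
Proof.
move=> nN; rewrite /zterm pow_1 -(sum_vonMangoldt_divisors nN) RtoC_bigsum.
rewrite big_distrl /= /conv big_nat_cond [RHS]big_nat_cond.
have /andP[n0 _] := nN.
apply: eq_bigr => d /andP[/andP[d0 _] dn]; rewrite /vterm /zterm /=.
rewrite -{1}(divnK dn) mulnC npowM //; last by rewrite divn_gt0 // dvdn_leq.
by ring.
Qed.

Lemma zterm_ln k n : zterm k.+1 s n = (RtoC (ln (INR n)) * zterm k s n)%C.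
Proof. by rewrite /zterm /= RtoC_mult; ring. Qed.

Lemma vterm_ln k n : vterm k.+1 s n = (RtoC (ln (INR n)) * vterm k s n)%C.
Proof. by rewrite /vterm zterm_ln; ring. Qed.

(** As [ln n = ln d + ln (n / d)], multiplication by the logarithm is a derivation for Dirichlet
    convolution. The differentiated forms of [- zeta' = (- zeta' / zeta) * zeta] thus follow on
    coefficients, with no series differentiated. *)
Lemma conv_leibniz A B N n : (0 < n)%N ->
  (RtoC (ln (INR n)) * conv A B N n =
   conv (fun d => RtoC (ln (INR d)) * A d) B N n +
   conv A (fun d => RtoC (ln (INR d)) * B d) N n)%C.
Proof.
move=> n0; rewrite /conv -big_split big_distrr /= big_nat_cond [RHS]big_nat_cond.
apply: eq_bigr => d /andP[/andP[d0 _] dn].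
have q0 : (0 < n %/ d)%N by rewrite divn_gt0 // dvdn_leq.
rewrite -{1}(divnK dn) mult_INR ln_mult; [|exact: INR_gt0..].
by rewrite RtoC_plus; ring.
Qed.

Lemma conv_ext A A' B B' N n : A =1 A' -> B =1 B' -> conv A B N n = conv A' B' N n.
Proof. by move=> hA hB; apply: eq_bigr => d _; rewrite hA hB. Qed.

Lemma zterm2_conv N n : (0 < n <= N)%N ->
  zterm 2 s n = (conv (vterm 1 s) (zterm 0 s) N n + conv (vterm 0 s) (zterm 1 s) N n)%C.
Proof.
move=> nN; have /andP[n0 _] := nN.
rewrite zterm_ln (zterm1_conv nN) conv_leibniz //.
by congr Cplus; apply: conv_ext => d; rewrite ?zterm_ln ?vterm_ln.
Qed.

Lemma zterm3_conv N n : (0 < n <= N)%N ->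
  zterm 3 s n = (conv (vterm 2 s) (zterm 0 s) N n +
    (conv (vterm 1 s) (zterm 1 s) N n + conv (vterm 1 s) (zterm 1 s) N n) +
    conv (vterm 0 s) (zterm 2 s) N n)%C.
Proof.
move=> nN; have /andP[n0 _] := nN.
rewrite zterm_ln (zterm2_conv nN) Cmult_plus_distr_l !conv_leibniz //.
set x := conv (vterm 2 s) _ _ _; set y := conv (vterm 1 s) (zterm 1 s) _ _.
set z := conv (vterm 0 s) (zterm 2 s) _ _.
have -> : (x + (y + y) + z = x + y + (y + z))%C by ring.
by congr (Cplus (Cplus _ _) (Cplus _ _)); apply: conv_ext => d; rewrite ?zterm_ln ?vterm_ln.
Qed.

Lemma conv_widen A B N n : (0 < n <= N)%N -> conv A B N n = conv A B n n.
Proof.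
move=> /andP[n0 nN]; rewrite /conv (@big_cat_nat _ _ _ n.+1) //= [X in Cplus _ X]big_nat_cond.
rewrite [X in Cplus _ X]big1 ?Cplus_0_r // => d /andP[/andP[nd _] dn].
by move: (dvdn_leq n0 dn); rewrite leqNgt nd.
Qed.

Lemma conv_cvg i j :
  cvgC (fun n => conv (vterm i s) (zterm j s) n n) (V i s * Z j s)%C.
Proof.
apply: (dirichlet_product a0 (dominated_vterm i a0 sa) (dominated_zterm j a0 sa)).
by move=> N n nN; rewrite -(conv_widen _ _ nN).
Qed.

Lemma Z1_eq : Z 1 s = (V 0 s * Z 0 s)%C.
Proof.
apply: cvgC_cinf; apply: cvgC_ext (conv_cvg 0 0) => n n0.
by rewrite -zterm1_conv // n0 leqnn.
Qed.

Lemma Z2_eq : Z 2 s = (V 1 s * Z 0 s + V 0 s * Z 1 s)%C.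
Proof.
apply: cvgC_cinf; apply: cvgC_ext (cvgC_add (conv_cvg 1 0) (conv_cvg 0 1)) => n n0.
by rewrite -zterm2_conv // n0 leqnn.
Qed.

Lemma Z3_eq : Z 3 s = (V 2 s * Z 0 s + (V 1 s * Z 1 s + V 1 s * Z 1 s) + V 0 s * Z 2 s)%C.
Proof.
apply: cvgC_cinf.
apply: cvgC_ext (cvgC_add (cvgC_add (conv_cvg 2 0)
  (cvgC_add (conv_cvg 1 1) (conv_cvg 1 1))) (conv_cvg 0 2)) => n n0.
by rewrite -zterm3_conv // n0 leqnn.
Qed.

End Products.

(** * Euler summation for zeta and its derivatives *)

Definition is_deriveC (f : R -> C) (x : R) (l : C) : Prop :=
  is_derive (fun y => Re (f y)) x (Re l) /\ is_derive (fun y => Im (f y)) x (Im l).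

Lemma is_derive_val (f : R -> R) (x l l' : R) :
  l = l' -> is_derive f x l -> is_derive f x l'.
Proof. by move=> ->. Qed.

Lemma is_deriveC_eq f x l l' : l = l' -> is_deriveC f x l -> is_deriveC f x l'.
Proof. by move=> ->. Qed.

Lemma is_deriveC_const c x : is_deriveC (fun=> c) x 0%C.
Proof. by split; apply: is_derive_const. Qed.

Lemma is_deriveC_RtoC g x l : is_derive g x l -> is_deriveC (fun y => RtoC (g y)) x (RtoC l).
Proof. by move=> h; split; [exact: h | apply: is_derive_const]. Qed.

Lemma is_deriveC_add f g x l m : is_deriveC f x l -> is_deriveC g x m ->
  is_deriveC (fun y => f y + g y)%C x (l + m)%C.
Proof. by move=> [h1 h2] [h3 h4]; split; apply: is_derive_plus. Qed.

Lemma is_deriveC_ext f g x l : (forall y, f y = g y) -> is_deriveC f x l -> is_deriveC g x l.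
Proof.
move=> fg [h1 h2].
by split; [apply: is_derive_ext h1 | apply: is_derive_ext h2] => y; rewrite fg.
Qed.

Lemma is_deriveC_mul f g x l m : is_deriveC f x l -> is_deriveC g x m ->
  is_deriveC (fun y => f y * g y)%C x (l * g x + f x * m)%C.
Proof.
move=> [h1 h2] [h3 h4].
have h13 := is_derive_mult _ _ _ _ _ h1 h3 Rmult_comm.
have h24 := is_derive_mult _ _ _ _ _ h2 h4 Rmult_comm.
have h14 := is_derive_mult _ _ _ _ _ h1 h4 Rmult_comm.
have h23 := is_derive_mult _ _ _ _ _ h2 h3 Rmult_comm.
split.
  have := is_derive_minus _ _ _ _ _ h13 h24.
  by congr is_derive; rewrite /minus /plus /opp /mult /Re /Im /=; ring.
have := is_derive_plus _ _ _ _ _ h14 h23.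
by congr is_derive; rewrite /plus /mult /Re /Im /=; ring.
Qed.

Lemma is_deriveC_cexp f x l : is_deriveC f x l ->
  is_deriveC (fun y => cexp (f y)) x (l * cexp (f x))%C.
Proof.
move=> [h1 h2].
have he : is_derive (fun y => exp (Re (f y))) x (Re l * exp (Re (f x))).
  by apply: is_derive_comp h1; apply: is_derive_exp.
have hc : is_derive (fun y => cos (Im (f y))) x (Im l * - sin (Im (f x))).
  by apply: is_derive_comp h2; apply: is_derive_cos.
have hs : is_derive (fun y => sin (Im (f y))) x (Im l * cos (Im (f x))).
  by apply: is_derive_comp h2; apply: is_derive_sin.
split.
  have := is_derive_mult _ _ _ _ _ he hc Rmult_comm.
  by congr is_derive; rewrite /plus /mult /cexp /Re /Im /=; ring.
have := is_derive_mult _ _ _ _ _ he hs Rmult_comm.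
by congr is_derive; rewrite /plus /mult /cexp /Re /Im /=; ring.
Qed.

Lemma mvt_abs (f : R -> R) f' a b M : a <= b ->
  (forall x, a <= x <= b -> is_derive f x (f' x)) ->
  (forall x, a <= x <= b -> Rabs (f' x) <= M) -> Rabs (f b - f a) <= M * (b - a).
Proof.
move=> ab df Mf.
have [|x hx|c [hc ->]] := @MVT_gen f a b f'.
- by move=> x; rewrite Rmin_left // Rmax_right // => hx; apply: df; lra.
- apply/continuity_pt_filterlim/ex_derive_continuous; exists (f' x); apply: df.
  by move: hx; rewrite Rmin_left // Rmax_right.
rewrite Rmin_left // Rmax_right // in hc.
by rewrite Rabs_mult (Rabs_pos_eq (b - a)); [apply: Rmult_le_compat_r; [lra|exact: Mf]|lra].
Qed.

(** The mean value theorem fails for complex values; it is applied to real and imaginary parts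
    separately, whence the factor 2. *)
Lemma mvtC f f' a b M : a <= b ->
  (forall x, a <= x <= b -> is_deriveC f x (f' x)) ->
  (forall x, a <= x <= b -> Cmod (f' x) <= M) ->
  Cmod (f b - f a)%C <= 2 * M * (b - a).
Proof.
move=> ab df Mf; apply: Rle_trans (Cmod_le_ReIm _) _.
have h1 : Rabs (Re (f b) - Re (f a)) <= M * (b - a).
  apply: mvt_abs ab (fun x hx => proj1 (df x hx)) _ => x hx.
  exact: Rle_trans (re_le_Cmod _) (Mf x hx).
have h2 : Rabs (Im (f b) - Im (f a)) <= M * (b - a).
  apply: mvt_abs ab (fun x hx => proj2 (df x hx)) _ => x hx.
  exact: Rle_trans (im_le_Cmod _) (Mf x hx).
rewrite (_ : Re (f b - f a)%C = Re (f b) - Re (f a)) //.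
rewrite (_ : Im (f b - f a)%C = Im (f b) - Im (f a)) //; lra.
Qed.

(** The error of the rectangle rule at the right endpoint: [mvtC] is used for [F x - f b * x], whose
    derivative [f x - f b] is itself bounded by [mvtC]. The two factors 2 give 4. *)
Lemma euler_step F f f' a b M : a <= b ->
  (forall x, a <= x <= b -> is_deriveC F x (f x)) ->
  (forall x, a <= x <= b -> is_deriveC f x (f' x)) ->
  (forall x, a <= x <= b -> Cmod (f' x) <= M) ->
  Cmod (F b - F a - f b * RtoC (b - a))%C <= 4 * M * (b - a) ^ 2.
Proof.
move=> ab dF df Mf.
have M0 : 0 <= M by apply: Rle_trans (Cmod_ge_0 _) (Mf a _); lra.
pose G x := (F x + - f b * RtoC x)%C.
have -> : (F b - F a - f b * RtoC (b - a) = G b - G a)%C.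
  by rewrite /G RtoC_minus; ring.
have -> : 4 * M * (b - a) ^ 2 = 2 * (2 * M * (b - a)) * (b - a) by ring.
apply: (@mvtC G (fun x => f x - f b)%C a b (2 * M * (b - a)) ab) => x hx.
  apply: is_deriveC_eq (is_deriveC_add (dF x hx)
    (is_deriveC_mul (is_deriveC_const (- f b)%C x) (is_deriveC_RtoC (is_derive_id x)))).
  by rewrite /one /=; ring.
rewrite -Cmod_opp (_ : - (f x - f b) = f b - f x)%C; last by ring.
apply: Rle_trans (_ : 2 * M * (b - x) <= _); last first.
  by apply: Rmult_le_compat_l; lra.
by apply: (@mvtC f f'); [lra | move=> y hy; apply: df; lra | move=> y hy; apply: Mf; lra].
Qed.

Definition zfun (k : nat) (s : C) (x : R) : C :=
  (RtoC (ln x ^ k) * cexp (- (s * RtoC (ln x))))%C.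

(* [tail_int k s x] is the integral of u^(-s) log^k u over u >= x. *)
Fixpoint tail_poly (k : nat) (w : C) (y : R) : C :=
  if k is k'.+1 then ((RtoC (y ^ k) + RtoC (INR k) * tail_poly k' w y) / w)%C
  else (/ w)%C.

Definition tail_int (k : nat) (s : C) (x : R) : C :=
  (tail_poly k (s - 1) (ln x) * cexp (- ((s - 1) * RtoC (ln x))))%C.

Lemma is_derive_pow_ln k x : 0 < x ->
  is_derive (fun y => ln y ^ k) x (INR k * ln x ^ k.-1 / x).
Proof.
move=> x0; apply: is_derive_val (is_derive_pow _ k _ _ (is_derive_ln x x0)).
by rewrite /Rdiv; ring.
Qed.

Lemma is_deriveC_cexp_ln s x : 0 < x ->
  is_deriveC (fun y => cexp (- (s * RtoC (ln y)))%C) x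
     (- (s * RtoC (/ x)) * cexp (- (s * RtoC (ln x))))%C.
Proof.
move=> x0; apply: is_deriveC_cexp.
apply: is_deriveC_ext (is_deriveC_eq _ (is_deriveC_mul (is_deriveC_const (- s)%C x)
  (is_deriveC_RtoC (is_derive_ln x x0)))) => [y|]; ring.
Qed.

Lemma is_deriveC_zfun k s x : 0 < x -> is_deriveC (zfun k s) x
  ((RtoC (INR k * ln x ^ k.-1) - s * RtoC (ln x ^ k)) * RtoC (/ x) *
    cexp (- (s * RtoC (ln x))))%C.
Proof.
move=> x0; apply: is_deriveC_eq (is_deriveC_mul (is_deriveC_RtoC (is_derive_pow_ln k x0))
  (is_deriveC_cexp_ln s x0)).
by rewrite /Rdiv !RtoC_mult; ring.
Qed.

(** The recursion of [tail_poly] is integration by parts: for [k > 0], [w * tail_poly k w y - y ^ k]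
    is [k] times the preceding polynomial, and this is also the derivative in [y]. *)
Lemma is_deriveC_tail_poly k (w : C) x : w <> 0%C -> 0 < x ->
  is_deriveC (fun y => tail_poly k w (ln y)) x
    ((w * tail_poly k w (ln x) - RtoC (ln x ^ k)) * RtoC (/ x))%C.
Proof.
move=> w0 x0; elim: k => [|k IH].
  apply: is_deriveC_eq (is_deriveC_const _ _); by rewrite /= Cinv_r //; ring.
apply: is_deriveC_ext (is_deriveC_eq _ (is_deriveC_mul
  (is_deriveC_add (is_deriveC_RtoC (is_derive_pow_ln k.+1 x0))
     (is_deriveC_mul (is_deriveC_const (RtoC (INR k.+1)) x) IH))
  (is_deriveC_const (/ w)%C x))) => [y|]; first by [].
rewrite [tail_poly k.+1 w _]/= -[k.+1.-1]/k.
rewrite -[match k with 0%N => 1 | _.+1 => INR k + 1 end]/(INR k.+1) /Rdiv !RtoC_mult. by field.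
Qed.

Lemma is_deriveC_tail_int k (s : C) x : s <> 1%C -> 0 < x ->
  is_deriveC (tail_int k s) x (- zfun k s x)%C.
Proof.
move=> s1 x0; have w0 : (s - 1)%C <> 0%C.
  by move=> h; apply: s1; rewrite -(Cplus_0_r 1) -h; ring.
apply: is_deriveC_eq (is_deriveC_mul (is_deriveC_tail_poly k w0 x0)
  (is_deriveC_cexp_ln (s - 1)%C x0)).
rewrite /zfun; have -> : cexp (- ((s - 1) * RtoC (ln x)))%C =
    (cexp (- (s * RtoC (ln x))) * RtoC x)%C.
  rewrite -{3}(exp_ln x) // (_ : RtoC (exp (ln x)) = cexp (RtoC (ln x))).
    by rewrite -cexpD; congr cexp; ring.
  by rewrite /cexp /= cos_0 sin_0 /RtoC; congr (_, _); ring.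
have xx : (RtoC x * RtoC (/ x) = 1)%C by rewrite -RtoC_mult Rinv_r //; lra.
set L := RtoC (ln x ^ k); set E := cexp _; set T := tail_poly _ _ _.
have -> : (((s - 1) * T - L) * RtoC (/ x) * (E * RtoC x) +
  T * (- ((s - 1) * RtoC (/ x)) * (E * RtoC x)) =
  - (L * E) * (RtoC x * RtoC (/ x)))%C by ring.
by rewrite xx; ring.
Qed.

Lemma pow_1ln_le (k : nat) b x : 0 < b -> 1 <= x ->
  (1 + ln x) ^ k <= (1 + INR k.+1 / b) ^ k * Rpower x b.
Proof.
move=> b0 x1; have k0 : 0 < INR k.+1 by apply: INR_gt0.
have c0 : 0 < b / INR k.+1 by apply: Rdiv_lt_0_compat.
have l0 : 0 <= ln x by rewrite -ln_1; apply: ln_le; lra.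
have d0 : 0 < INR k.+1 / b by apply: Rdiv_lt_0_compat.
apply: Rle_trans (_ : ((1 + INR k.+1 / b) * Rpower x (b / INR k.+1)) ^ k <= _).
  apply: pow_incr; split; first by lra.
  have -> : INR k.+1 / b = / (b / INR k.+1) by field; lra.
  rewrite Rmult_plus_distr_r Rmult_1_l; apply: Rplus_le_compat.
    by apply: Rpower_ge1 => //; lra.
  by apply: ln_le_Rpower => //; lra.
rewrite Rpow_mult_distr; apply: Rmult_le_compat_l; first by apply: pow_le; lra.
rewrite -Rpower_pow; last exact: Rpower_gt0.
rewrite Rpower_mult; apply: Rle_Rpower => //.
rewrite S_INR in k0 *; apply: (Rmult_le_reg_r (INR k + 1)) => //.
have -> : b / (INR k + 1) * INR k * (INR k + 1) = b * INR k by field; lra.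
by nra.
Qed.

Lemma Re_le_Cmod s : Re s <= Cmod s.
Proof. exact: Rle_trans (Rle_abs _) (re_le_Cmod s). Qed.

Lemma Cmod_sub_le x y : Cmod (x - y)%C <= Cmod x + Cmod y.
Proof. by apply: Rle_trans (Cmod_triangle _ _) _; rewrite Cmod_opp; lra. Qed.

(** The 4 is the square of [/ x <= 2 / (n + 1)], the factor [k + 1] counts the two terms of the
    derivative, and the power is the constant of [pow_1ln_le] for [b = / 2]: half a power of [n] is
    spent on the logarithms. *)
Definition euler_const (k : nat) : R := 4 * INR k.+1 * (1 + INR k.+1 / / 2) ^ k.

Lemma zfun_derive_bound k s n x : 1 < Re s -> (0 < n)%N -> INR n <= x <= INR n.+1 ->
  Cmod ((RtoC (INR k * ln x ^ k.-1) - s * RtoC (ln x ^ k)) * RtoC (/ x) *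
    cexp (- (s * RtoC (ln x))))%C <=
  euler_const k * Cmod s * Rpower (INR n.+1) (-1 - / 2).
Proof.
move=> s1 n0 hx; have n1 := INR_ge1 n0; have sm := Re_le_Cmod s.
have m0 : 0 < INR n.+1 by apply: INR_gt0.
have l0 : 0 <= ln x by rewrite -ln_1; apply: ln_le; lra.
have lm : ln x <= ln (INR n.+1) by apply: ln_le; lra.
pose Y := 1 + ln (INR n.+1).
rewrite !Cmod_mult Cmod_cexp Cmod_R.
have -> : Re (- (s * RtoC (ln x))) = - Re s * ln x.
  by rewrite /Re /Copp /Cmult /RtoC /=; ring.
have ix : 0 < / x by apply: Rinv_0_lt_compat; lra.
have e1 : exp (- Re s * ln x) <= / x.
  rewrite -[X in _ <= / X]exp_ln; last by lra.
  rewrite -exp_Ropp; apply: exp_le; nra.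
have Yk : 0 <= Y ^ k by apply: pow_le; rewrite /Y; lra.
have h1 : Cmod (RtoC (INR k * ln x ^ k.-1) - s * RtoC (ln x ^ k))%C <=
    INR k.+1 * Cmod s * Y ^ k.
  apply: Rle_trans (Cmod_sub_le _ _) _; rewrite Cmod_mult !Cmod_R.
  have k0 := pos_INR k.
  have p1 : 0 <= ln x ^ k <= Y ^ k.
    by split; [apply: pow_le | apply: pow_incr; rewrite /Y; lra].
  have p2 : 0 <= ln x ^ k.-1 <= Y ^ k.
    split; first exact: pow_le.
    apply: Rle_trans (_ : Y ^ k.-1 <= _); first by apply: pow_incr; rewrite /Y; lra.
    by apply: Rle_pow; [rewrite /Y; lra | apply/leP; exact: leq_pred].
  rewrite !Rabs_pos_eq; [|by lra|by apply: Rmult_le_pos; lra].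
  rewrite S_INR.
  have : INR k * ln x ^ k.-1 <= INR k * Cmod s * Y ^ k.
    rewrite Rmult_assoc; apply: Rmult_le_compat_l => //; nra.
  have : Cmod s * ln x ^ k <= Cmod s * Y ^ k by apply: Rmult_le_compat_l; lra.
  by lra.
rewrite (Rabs_pos_eq (/ x)); last by lra.
have xm : / x <= 2 * / INR n.+1.
  have -> : 2 * / INR n.+1 = / (INR n.+1 / 2) by field; lra.
  by apply: Rinv_le_contravar; rewrite S_INR; lra.
have h2 : / x * exp (- Re s * ln x) <= 4 * (/ INR n.+1 * / INR n.+1).
  have := exp_pos (- Re s * ln x); nra.
have h3 : Y ^ k <= (1 + INR k.+1 / / 2) ^ k * Rpower (INR n.+1) (/ 2).
  by apply: pow_1ln_le; [lra | rewrite S_INR; lra].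
rewrite Rmult_assoc.
apply: Rle_trans (Rmult_le_compat _ _ _ _ (Cmod_ge_0 _) _ h1 h2) _.
  by apply: Rmult_le_pos; [lra | left; exact: exp_pos].
have -> : Rpower (INR n.+1) (-1 - / 2) = Rpower (INR n.+1) (/ 2) * (/ INR n.+1 * / INR n.+1).
  have -> : -1 - / 2 = / 2 + (- (1) + - (1)) by field.
  by rewrite !Rpower_plus Rpower_Ropp Rpower_1.
have k1 : 0 <= INR k.+1 * Cmod s by apply: Rmult_le_pos; [exact: pos_INR | exact: Cmod_ge_0].
have i2 : 0 <= 4 * (/ INR n.+1 * / INR n.+1).
  have : 0 < / INR n.+1 by apply: Rinv_0_lt_compat.
  nra.
apply: Rle_trans (_ : INR k.+1 * Cmod s * ((1 + INR k.+1 / / 2) ^ k * Rpower (INR n.+1) (/ 2)) * (4 * (/ INR n.+1 * / INR n.+1)) <= _).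
  apply: Rmult_le_compat_r => //; exact: Rmult_le_compat_l.
by right; rewrite /euler_const; ring.
Qed.

Fixpoint tail_const (k : nat) (d : R) : R :=
  if k is k'.+1 then (1 + INR k * tail_const k' d) / d else / d.

Lemma tail_const_gt0 k d : 0 < d -> 0 < tail_const k d.
Proof.
move=> d0; elim: k => [|k IH]; first exact: Rinv_0_lt_compat.
apply: Rdiv_lt_0_compat => //; have := pos_INR k.+1; rewrite -/(tail_const k d); nra.
Qed.

Lemma tail_poly_bound k w y d : 0 < d -> d <= Cmod w -> 0 <= y ->
  Cmod (tail_poly k w y) <= tail_const k d * (1 + y) ^ k.
Proof.
move=> d0 dw y0; have w0 : w <> 0%C by apply/Cmod_gt_0; lra.
have iw : Cmod (/ w)%C <= / d.
  by rewrite Cmod_inv //; apply: Rinv_le_contravar.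
elim: k => [|k IH]; first by rewrite Rmult_1_r.
have k1 := pos_INR k.+1; have c0 := tail_const_gt0 k d0.
have -> : tail_poly k.+1 w y =
  ((RtoC (y ^ k.+1) + RtoC (INR k.+1) * tail_poly k w y) * / w)%C by [].
have -> : tail_const k.+1 d = (1 + INR k.+1 * tail_const k d) * / d by [].
rewrite Cmod_mult.
rewrite (_ : _ * / d * _ = (1 + INR k.+1 * tail_const k d) * (1 + y) ^ k.+1 * / d); last by ring.
apply: Rmult_le_compat; try exact: Cmod_ge_0; last by [].
apply: Rle_trans (Cmod_triangle _ _) _; rewrite Cmod_mult !Cmod_R.
rewrite !Rabs_pos_eq //; last exact: pow_le.
have p1 : y ^ k.+1 <= (1 + y) ^ k.+1 by apply: pow_incr; lra.
have p2 : (1 + y) ^ k <= (1 + y) ^ k.+1 by apply: Rle_pow; [lra | apply/leP].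
have p3 : Cmod (tail_poly k w y) <= tail_const k d * (1 + y) ^ k.+1.
  by apply: Rle_trans IH _; apply: Rmult_le_compat_l; lra.
have := Rmult_le_compat_l _ _ _ k1 p3; lra.
Qed.

Lemma tail_int_bound k s x d : 0 < d -> d <= Cmod (s - 1)%C -> 1 <= x ->
  Cmod (tail_int k s x) <= tail_const k d * (1 + ln x) ^ k * Rpower x (- (Re s - 1)).
Proof.
move=> d0 ds x1; have l0 : 0 <= ln x by rewrite -ln_1; apply: ln_le; lra.
rewrite Cmod_mult Cmod_cexp.
have -> : Re (- ((s - 1) * RtoC (ln x))) = - (Re s - 1) * ln x.
  by rewrite /Re /Copp /Cmult /Cminus /Cplus /RtoC /=; ring.
apply: Rmult_le_compat_r; first exact: Rlt_le (exp_pos _).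
exact: tail_poly_bound.
Qed.

(* The difference between a term of the series and the integral over [n - 1, n]. *)
Definition euler_term (k : nat) (s : C) (n : nat) : C :=
  if (n <= 1)%N then RtoC 0
  else (zterm k s n + tail_int k s (INR n) - tail_int k s (INR n.-1))%C.

Lemma euler_term_dominated k s : 1 < Re s ->
  dominated (euler_term k s) (4 * (euler_const k * Cmod s)) (/ 2).
Proof.
move=> s1 n n0; rewrite /euler_term.
have e0 : 0 <= euler_const k.
  apply: Rmult_le_pos; first by have := pos_INR k.+1; lra.
  apply: pow_le; have : 0 <= INR k.+1 / / 2 by apply: Rdiv_le_0_compat; [exact: pos_INR | lra].
  lra.
case: leqP => n1.
  rewrite Cmod_0; apply: Rmult_le_pos; last by left; exact: Rpower_gt0.
  by have := Rmult_le_pos _ _ e0 (Cmod_ge_0 s); lra.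
case: n n1 {n0} => [//|n]; rewrite ltnS -[n.+1.-1]/n => n0.
have s1' : s <> 1%C by move=> h; move: s1; rewrite h /Re /=; lra.
have pos x : INR n <= x -> 0 < x by have := INR_gt0 n0; lra.
have := @euler_step (tail_int k s) (fun x => - zfun k s x)%C
  (fun x => - ((RtoC (INR k * ln x ^ k.-1) - s * RtoC (ln x ^ k)) * RtoC (/ x) *
    cexp (- (s * RtoC (ln x)))))%C (INR n) (INR n.+1)
  (euler_const k * Cmod s * Rpower (INR n.+1) (-1 - / 2)).
have -> : INR n.+1 - INR n = 1 by rewrite S_INR; ring.
have -> : (tail_int k s (INR n.+1) - tail_int k s (INR n) - - zfun k s (INR n.+1) * RtoC 1 =
  zterm k s n.+1 + tail_int k s (INR n.+1) - tail_int k s (INR n))%C.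
  by rewrite /zterm /npow /zfun; ring.
move=> h; apply: Rle_trans (h _ _ _ _) _.
- by apply: INR_leq.
- by move=> x hx; apply: is_deriveC_tail_int => //; apply: pos; lra.
- move=> x hx; apply: is_deriveC_ext (is_deriveC_eq _ (is_deriveC_mul
    (is_deriveC_const (- (1))%C x) (is_deriveC_zfun k s (pos x _)))) => [y||]; [ring|ring|lra].
- by move=> x hx; rewrite Cmod_opp; apply: zfun_derive_bound.
by rewrite pow1; right; ring.
Qed.

Lemma csum_euler_term k s N : (0 < N)%N ->
  csum (euler_term k s) N =
  (csum (zterm k s) N - zterm k s 1 + tail_int k s (INR N) - tail_int k s 1)%C.
Proof.
elim: N => [//|[|N] IH] _.
  by rewrite !csumS !csum0 (_ : euler_term k s 1 = 0%C) // -[INR 1]/1; ring.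
by rewrite csumS IH // [in RHS]csumS [euler_term k s N.+2]/euler_term -[N.+2.-1]/N.+1 ltnS ltn0; ring.
Qed.

Lemma tail_int_cvg0 k s : 1 < Re s -> exists K b, 0 < b /\ forall x, 1 <= x ->
  Cmod (tail_int k s x) <= K * Rpower x (- b).
Proof.
move=> s1; have d0 : 0 < Re s - 1 by lra.
have ds : Re s - 1 <= Cmod (s - 1)%C by apply: Rle_trans (Re_le_Cmod _); rewrite /Re /=; lra.
have b0 : 0 < (Re s - 1) / 2 by lra.
exists (tail_const k (Re s - 1) * (1 + INR k.+1 / ((Re s - 1) / 2)) ^ k), ((Re s - 1) / 2).
split=> // x x1; apply: Rle_trans (tail_int_bound k d0 ds x1) _.
rewrite !Rmult_assoc; apply: Rmult_le_compat_l; first exact: Rlt_le (tail_const_gt0 _ _).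
apply: Rle_trans (Rmult_le_compat_r _ _ _ (Rlt_le _ _ (Rpower_gt0 _ _)) (pow_1ln_le k b0 x1)) _.
rewrite Rmult_assoc -Rpower_plus; right; congr (_ * Rpower _ _); field.
Qed.

(** The bound depends on [s] only through [Cmod s], so it stays uniform as [Re s] tends to 1. The
    Euler terms telescope against the series, and their domination with [a = / 2] turns the constant
    4 into 8. *)
Lemma euler_Z k s N : 1 < Re s -> (0 < N)%N ->
  Cmod (Z k s - csum (zterm k s) N - tail_int k s (INR N))%C <=
  8 * euler_const k * Cmod s * Rpower (INR N) (- / 2).
Proof.
move=> s1 N0.
have a0 : 0 < (Re s - 1) / 2 by lra.
have dz := @dominated_zterm k s ((Re s - 1) / 2) a0 (ltac:(lra)).
have [K [b [b0 hK]]] := dominated_cvgC a0 dz.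
have [K' [b' [b'0 hT]]] := tail_int_cvg0 k s1.
have h2 : 0 < / 2 by lra.
have hl : cinf (euler_term k s) = (Z k s - zterm k s 1 - tail_int k s 1)%C.
  (* The difference telescopes to [tail_int] at [N], which tends to 0; adding the series of [zterm]
     back identifies the sum of the Euler terms. *)
  have c1 : cvgC (fun n => euler_term k s n + - (1) * zterm k s n)%C (- zterm k s 1 - tail_int k s 1)%C.
    exists K', b'; split=> // n n0; rewrite csum_plus csum_scal csum_euler_term //.
    apply: Rle_trans (hT _ (INR_ge1 n0)); rewrite -Cmod_opp; right; congr Cmod; ring.
  apply: cvgC_cinf; apply: cvgC_ext (_ : cvgC (fun n => (euler_term k s n + - (1) * zterm k s n) + zterm k s n)%C _).
    by move=> n _; ring.
  have -> : (Z k s - zterm k s 1 - tail_int k s 1 = (- zterm k s 1 - tail_int k s 1) + Z k s)%C by ring.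
  by apply: cvgC_add c1 _; exists K, b.
have := dominated_cinf h2 (euler_term_dominated k s1) N0.
rewrite hl csum_euler_term //.
rewrite (_ : 4 * (euler_const k * Cmod s) / / 2 = 8 * euler_const k * Cmod s); last by field.
by apply: Rle_trans; right; congr Cmod; ring.
Qed.

(** * Bounds to the right of the line Re s = 1 *)

(* The exponent 54 makes ell^27 = sqrt (t + 2), and 27 is the power of [ell] that bounds [V 2]. *)
Definition ell (t : R) : R := Rpower (t + 2) (/ 54).

Lemma ell_ge1 t : 0 <= t -> 1 <= ell t.
Proof. by move=> t0; apply: Rpower_ge1; lra. Qed.

Lemma ln_le_ell t : 0 <= t -> ln (t + 2) <= 54 * ell t.
Proof.
move=> t0; have := @ln_le_Rpower (t + 2) (/ 54); rewrite Rinv_inv -/(ell t).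
by apply; lra.
Qed.

Lemma ell_pow t : 0 <= t -> ell t ^ 54 = t + 2.
Proof.
move=> t0; rewrite -Rpower_pow; last exact: Rpower_gt0.
rewrite Rpower_mult (_ : / 54 * INR 54 = 1); first by rewrite Rpower_1 //; lra.
by rewrite INR_IZR_INZ /=; field.
Qed.

Lemma euler_const_ge0 k : 0 <= euler_const k.
Proof.
apply: Rmult_le_pos; first by have := pos_INR k.+1; lra.
apply: pow_le; have : 0 <= INR k.+1 / / 2 by apply: Rdiv_le_0_compat; [exact: pos_INR | lra].
lra.
Qed.

Lemma nat_ceil x : 0 <= x -> exists N : nat, x <= INR N <= x + 1.
Proof.
move=> x0; have [h1 h2] := archimed x.
exists (Z.to_nat (up x)); rewrite INR_IZR_INZ Z2Nat.id; first by lra.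
by apply: le_IZR; lra.
Qed.

Lemma pow_le1_mono x m n : 1 <= x -> (m <= n)%N -> x ^ m <= x ^ n.
Proof. by move=> x1 mn; apply: Rle_pow => //; apply/leP. Qed.

(** Cutting the series at [N] close to [(t + 2) ^ 2] makes the Euler error [Cmod s * N ^ (- / 2)] at
    most 1. The partial sum and the tail integral are then powers of [1 + ln N]; the distance [d]
    keeps [s] away from the pole. *)
Lemma Z_bound k d : 0 < d -> exists K, 0 < K /\
  forall s, 1 < Re s <= 2 -> d <= Im s -> Cmod (Z k s) <= K * ell (Im s) ^ k.+1.
Proof.
move=> d0; have ek := euler_const_ge0 k; have tc := tail_const_gt0 k d0.
exists (217 ^ k.+1 * (1 + tail_const k d) + 8 * euler_const k); split.
  have : 0 < 217 ^ k.+1 by apply: pow_lt; lra.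
  nra.
move=> s s12 dt; set t := Im s in dt *.
have t0 : 0 < t by lra.
have [N [N1 N2]] := @nat_ceil ((t + 2) ^ 2) (ltac:(nra)).
have N0 : (0 < N)%N by apply/ltP/INR_lt; rewrite [INR 0]/(0); nra.
have Npos := INR_ge1 N0.
have l0 := ln_INR_ge0 N.
have l1 := ell_ge1 (Rlt_le _ _ t0).
(* [N <= (t + 2) ^ 4], so [ln N <= 4 * 54 * ell t = 216 * ell t], and [1 <= ell t]. *)
have lN : 1 + ln (INR N) <= 217 * ell t.
  have : ln (INR N) <= ln ((t + 2) ^ 4) by apply: ln_le; [lra | nra].
  rewrite ln_pow; last by lra.
  rewrite INR_IZR_INZ /=; have := ln_le_ell (Rlt_le _ _ t0); lra.
have h1 : Cmod (csum (zterm k s) N) <= (1 + ln (INR N)) ^ k.+1.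
  apply: Rle_trans (csum_abs _ _) _.
  apply: Rle_trans (_ : rsum (fun n => (1 + ln (INR N)) ^ k * / INR n) N <= _).
    apply: rsum_le => n /andP[n0 nN]; rewrite Cmod_zterm; have n1 := INR_ge1 n0.
    apply: Rmult_le_compat; [by apply: pow_le; exact: ln_INR_ge0 | exact: Rlt_le (Rpower_gt0 _ _) | |].
      apply: pow_incr; split; first exact: ln_INR_ge0.
      by have : ln (INR n) <= ln (INR N) by [apply: ln_le; [lra | exact: INR_leq]]; lra.
    rewrite Rpower_Ropp; apply: Rinv_le_contravar; first by lra.
    rewrite -{1}(Rpower_1 (INR n)); last by lra.
    by apply: Rle_Rpower; lra.
  rewrite rsum_scal /= Rmult_comm; apply: Rmult_le_compat_r; last exact: harmonic_le.
  by apply: pow_le; lra.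
have dw : d <= Cmod (s - 1)%C.
  apply: Rle_trans (im_le_Cmod _); rewrite (_ : Im (s - 1)%C = t).
    by rewrite Rabs_pos_eq; lra.
  by rewrite /Im /= -/(Im s) -/t; lra.
have h2 : Cmod (tail_int k s (INR N)) <= tail_const k d * (1 + ln (INR N)) ^ k.+1.
  apply: Rle_trans (tail_int_bound k d0 dw Npos) _.
  rewrite Rmult_assoc; apply: Rmult_le_compat_l; first by lra.
  rewrite -[X in _ <= X]Rmult_1_r; apply: Rmult_le_compat.
  - by apply: pow_le; lra.
  - exact: Rlt_le (Rpower_gt0 _ _).
  - by apply: pow_le1_mono => //; lra.
  by rewrite -[X in _ <= X]exp_0; apply: exp_le; nra.
have h3 := euler_Z k (proj1 s12) N0.
have ms : Cmod s <= t + 2.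
  by apply: Rle_trans (Cmod_le_ReIm _) _; rewrite -/t !Rabs_pos_eq; lra.
have h4 : 8 * euler_const k * Cmod s * Rpower (INR N) (- / 2) <= 8 * euler_const k.
  rewrite Rmult_assoc -[X in _ <= X]Rmult_1_r; apply: Rmult_le_compat_l; first by lra.
  have : Rpower (INR N) (- / 2) <= / (t + 2).
    rewrite Rpower_Ropp; apply: Rinv_le_contravar; first by lra.
    rewrite -[t + 2](_ : Rpower ((t + 2) ^ 2) (/ 2) = _).
      by apply: Rle_Rpower_l; [lra | split; [apply: pow_lt; lra | exact: N1]].
    by rewrite Rpower_sqrt; [rewrite sqrt_pow2 //; lra | apply: pow_lt; lra].
  move=> h; apply: Rle_trans (_ : (t + 2) * / (t + 2) <= _); last by rewrite Rinv_r; lra.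
  apply: Rmult_le_compat => //; [exact: Cmod_ge_0 | exact: Rlt_le (Rpower_gt0 _ _)].
have h5 : (1 + ln (INR N)) ^ k.+1 <= 217 ^ k.+1 * ell t ^ k.+1.
  by rewrite -Rpow_mult_distr; apply: pow_incr; lra.
have h6 : 1 <= ell t ^ k.+1 by apply: pow_R1_Rle.
have -> : Z k s = ((Z k s - csum (zterm k s) N - tail_int k s (INR N)) +
  (csum (zterm k s) N + tail_int k s (INR N)))%C by ring.
have := Cmod_triangle (Z k s - csum (zterm k s) N - tail_int k s (INR N))%C
  (csum (zterm k s) N + tail_int k s (INR N))%C.
have := Cmod_triangle (csum (zterm k s) N) (tail_int k s (INR N)).
have : tail_const k d * (1 + ln (INR N)) ^ k.+1 <= tail_const k d * (217 ^ k.+1 * ell t ^ k.+1).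
  by apply: Rmult_le_compat_l; lra.
nra.
Qed.

(** Euler summation stopped at [N = 1]. The value of [tail_poly] at 0 is the principal part
    [k! / (s - 1) ^ (k + 1)], so this bounds the regular part without continuing zeta. *)
Lemma Z_pole k s : 1 < Re s ->
  Cmod (Z k s - tail_poly k (s - 1) 0)%C <= 1 + 8 * euler_const k * Cmod s.
Proof.
move=> s1; have := euler_Z k s1 (ltn0Sn 0); rewrite csumS csum0.
have e1 : cexp 0%C = 1%C by rewrite /cexp /= exp_0 cos_0 sin_0 Rmult_1_l Rmult_0_r.
have -> : tail_int k s (INR 1) = tail_poly k (s - 1) 0.
  rewrite /tail_int ln_1 (_ : - ((s - 1) * 0) = 0)%C; last by ring.
  by rewrite e1; ring.
have -> : Rpower (INR 1) (- / 2) = 1 by rewrite /Rpower ln_1 Rmult_0_r exp_0.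
rewrite Rmult_1_r => h.
have -> : (Z k s - tail_poly k (s - 1) 0 = zterm k s 1 + (Z k s - (0 + zterm k s 1) - tail_poly k (s - 1) 0))%C by ring.
apply: Rle_trans (Cmod_triangle _ _) _; apply: Rplus_le_compat h.
rewrite Cmod_zterm ln_1 /Rpower ln_1 Rmult_0_r exp_0 Rmult_1_r.
by case: k => [|k] /=; lra.
Qed.

Lemma is_deriveC_quadratic (f : R -> C) (x : R) (l : C) (K r : R) : 0 < r ->
  (forall h, Rabs h <= r -> Cmod (f (Rplus x h) - f x - RtoC h * l)%C <= K * h ^ 2) ->
  is_deriveC f x l.
Proof.
move=> r0 H.
have main (p : C -> R) (ps : forall u v, p (u - v)%C = p u - p v)
    (pr : forall h u, p (RtoC h * u)%C = h * p u) (pc : forall u, Rabs (p u) <= Cmod u) :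
    is_derive (fun y => p (f y)) x (p l).
  apply/is_derive_Reals => e e0.
  have K1 : 0 < Rabs K + 1 by have := Rabs_pos K; lra.
  have d0 : 0 < Rmin r (e / (Rabs K + 1)).
    by apply: Rmin_pos => //; apply: Rdiv_lt_0_compat.
  exists (mkposreal _ d0) => h h0 /= hd.
  have h1 : Rabs h <= r by have := Rmin_l r (e / (Rabs K + 1)); lra.
  have h2 : Rabs h < e / (Rabs K + 1) by have := Rmin_r r (e / (Rabs K + 1)); lra.
  have ah : 0 < Rabs h by apply: Rabs_pos_lt.
  have -> : (p (f (Rplus x h)) - p (f x)) / h - p l = p (f (Rplus x h) - f x - RtoC h * l)%C / h.
    by rewrite !ps pr; field.
  rewrite Rabs_div //; apply: (Rmult_lt_reg_r (Rabs h)) => //.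
  rewrite /Rdiv Rmult_assoc Rinv_l ?Rmult_1_r; last by lra.
  apply: Rle_lt_trans (pc _) _; apply: Rle_lt_trans (H h h1) _.
  rewrite -[h ^ 2]pow2_abs.
  have h3 : Rabs h * (Rabs K + 1) < e.
    have := Rmult_lt_compat_r _ _ _ K1 h2; rewrite (_ : e / _ * _ = e) //; field; lra.
  have := Rle_abs K; nra.
split; apply: main.
- by [].
- by move=> h u; rewrite /Re /Cmult /=; ring.
- exact: re_le_Cmod.
- by [].
- by move=> h u; rewrite /Im /Cmult /=; ring.
- exact: im_le_Cmod.
Qed.

Lemma exp_taylor1 u : Rabs (exp u - 1 - u) <= u ^ 2 * exp (Rabs u).
Proof.
have h1 := exp_ineq1_le u; have h2 := exp_ineq1_le (- u); have e0 := exp_pos u.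
have h3 : exp u * exp (- u) = 1 by rewrite -exp_plus Rplus_opp_r exp_0.
have h4 : exp u - 1 <= u * exp u by nra.
have h5 := exp_ineq1_le (Rabs u).
rewrite Rabs_pos_eq; last by lra.
case: (Rle_lt_dec 0 u) => u0.
  by rewrite Rabs_pos_eq //; nra.
have : 1 <= exp (Rabs u) by have := Rabs_pos u; lra.
nra.
Qed.

Lemma dominated_cinf_le u M a : 0 < a -> dominated u M a ->
  Cmod (cinf u) <= M + M / a.
Proof.
move=> a0 du; have := dominated_cinf a0 du (ltn0Sn 0).
have := du 1%N isT; rewrite csumS csum0 /Rpower ln_1 !Rmult_0_r exp_0 !Rmult_1_r => h1 h2.
have -> : cinf u = ((cinf u - (0 + u 1%N)) + u 1%N)%C by ring.
by apply: Rle_trans (Cmod_triangle _ _) _; lra.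
Qed.

(** The Taylor remainder of each term is at most [h ^ 2] times the term of [Z 2] at [x - Rabs h].
    With [a = (x - 1) / 4] and [Rabs h <= a] these terms stay dominated, so the remainder of the sum
    is quadratic in [h]. *)
Lemma is_deriveC_Z0 x t : 1 < x -> is_deriveC (fun y => Z 0 (y, t)) x (- Z 1 (x, t))%C.
Proof.
move=> x1; pose a := (x - 1) / 4; have a0 : 0 < a by rewrite /a; lra.
apply: (@is_deriveC_quadratic _ _ _ (ln_const 2 a + ln_const 2 a / a) a a0) => h ha.
pose u n := (zterm 0 ((Rplus x h), t) n - zterm 0 (x, t) n + RtoC h * zterm 1 (x, t) n)%C.
have uE n : u n = (RtoC (exp (- h * ln (INR n)) - 1 - (- h * ln (INR n))) * npow (x, t) n)%C.
  rewrite /u /zterm /=.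
  have -> : npow ((Rplus x h), t) n = (RtoC (exp (- h * ln (INR n))) * npow (x, t) n)%C.
    have -> : RtoC (exp (- h * ln (INR n))) = cexp (RtoC (- h * ln (INR n))).
      by rewrite /cexp /= cos_0 sin_0 /RtoC; congr (_, _); ring.
    rewrite -cexpD; congr cexp.
    by rewrite /RtoC /Cmult /Copp /Cplus /=; congr (_, _); ring.
  by rewrite !RtoC_minus !RtoC_mult RtoC_opp; ring.
have ud : dominated u (h ^ 2 * ln_const 2 a) a.
  move=> n n0; have L0 := ln_INR_ge0 n.
  have := @dominated_zterm 2 (x - Rabs h, t) a a0; move=> /(_ _ n n0) H.
  rewrite Rmult_assoc; apply: Rle_trans (_ : h ^ 2 * Cmod (zterm 2 (x - Rabs h, t) n) <= _); last first.
    apply: Rmult_le_compat_l; first exact: pow2_ge_0.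
    by apply: H; rewrite /Re /= /a; move: ha; rewrite /a; lra.
  rewrite uE Cmod_zterm Cmod_mult Cmod_R Cmod_npow /Re /=.
  have := exp_taylor1 (- h * ln (INR n)).
  rewrite Rabs_mult Rabs_Ropp (Rabs_pos_eq (ln _)) // => h1.
  have -> : Rpower (INR n) (- (x - Rabs h)) = exp (Rabs h * ln (INR n)) * Rpower (INR n) (- x).
    by rewrite /Rpower -exp_plus; congr exp; ring.
  apply: Rle_trans (Rmult_le_compat_r _ _ _ (Rlt_le _ _ (Rpower_gt0 _ _)) h1) _.
  by right; ring.
have da s k := @dominated_zterm k s a a0.
have sx : 1 + 2 * a <= Re (x, t) by rewrite /Re /= /a; lra.
have sxh : 1 + 2 * a <= Re ((Rplus x h), t) by rewrite /Re /=; move: ha; rewrite /a; split_Rabs; lra.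
have := cvgC_add (cvgC_add (dominated_cvgC a0 (da _ 0%N sxh)) (cvgC_scal (- (1))%C (dominated_cvgC a0 (da _ 0%N sx))))
  (cvgC_scal (RtoC h) (dominated_cvgC a0 (da _ 1%N sx))) => hc.
have uc : cinf u = (Z 0 ((Rplus x h), t) - Z 0 (x, t) + RtoC h * Z 1 (x, t))%C.
  have -> : (Z 0 ((Rplus x h), t) - Z 0 (x, t) + RtoC h * Z 1 (x, t) =
   Z 0 ((Rplus x h), t) + - (1) * Z 0 (x, t) + RtoC h * Z 1 (x, t))%C by ring.
  by apply: cvgC_cinf; apply: cvgC_ext hc => n _; rewrite /u; ring.
have -> : (Z 0 ((Rplus x h), t) - Z 0 (x, t) - RtoC h * - Z 1 (x, t))%C = cinf u.
  by rewrite uc; ring.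
by apply: Rle_trans (dominated_cinf_le a0 ud) _; right; field; lra.
Qed.

(** The modulus is squared to remain differentiable at a possible zero of zeta. *)
Definition sqZ (t x : R) : R := Re (Z 0 (x, t)) ^ 2 + Im (Z 0 (x, t)) ^ 2.

Lemma sqZ_Cmod t x : sqZ t x = Cmod (Z 0 (x, t)) ^ 2.
Proof. by rewrite Cmod2_alt. Qed.

Lemma is_derive_sqZ t x : 1 < x ->
  is_derive (sqZ t) x (- (2) * sqZ t x * Re (V 0 (x, t))).
Proof.
move=> x1; have [h1 h2] := is_deriveC_Z0 t x1.
have a0 : 0 < (x - 1) / 2 by lra.
have E := @Z1_eq (x, t) ((x - 1) / 2) a0 ltac:(by rewrite /Re /=; lra).
apply: is_derive_val (is_derive_plus _ _ _ _ _ (is_derive_pow _ 2 _ _ h1) (is_derive_pow _ 2 _ _ h2)).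
rewrite /plus /sqZ E /Re /Im /=; ring.
Qed.

Lemma cvgC_Re_ge0 u l : cvgC u l -> (forall n, (0 < n)%N -> 0 <= Re (u n)) -> 0 <= Re l.
Proof.
move=> [K [b [b0 h]]] u0; apply: le_epsilon => e e0.
have K1 : 0 < Rabs K + 1 by have := Rabs_pos K; lra.
have [N hN] := Rpower_cvg0 b0 (Rdiv_lt_0_compat _ _ e0 K1).
have h1 := hN _ (ltnSn N); have h2 := h N.+1 isT.
have h3 : K * Rpower (INR N.+1) (- b) <= e.
  have := Rpower_gt0 (INR N.+1) (- b) => P0.
  have := Rmult_lt_compat_r _ _ _ K1 h1; rewrite (_ : e / _ * _ = e); last by field; lra.
  have := Rle_abs K; nra.
have : 0 <= Re (csum u N.+1) by rewrite Re_csum; apply: rsum_ge0 => n /andP[n0 _]; exact: u0.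
have := re_le_Cmod (l - csum u N.+1)%C.
rewrite (_ : Re (l - csum u N.+1)%C = Re l - Re (csum u N.+1)) //.
by split_Rabs; lra.
Qed.

Lemma Re_vterm0 x t n :
  Re (vterm 0 (x, t) n) = vonMangoldt n * Rpower (INR n) (- x) * cos (t * ln (INR n)).
Proof.
rewrite /vterm /zterm /npow /cexp /Rpower /Re /Cmult /Copp /=.
rewrite -[cos (t * _)]cos_neg.
set c := cos _; set c' := cos _; have -> : c = c' by congr cos; ring.
set e := exp _; set e' := exp _; have -> : e = e' by congr exp; ring.
by ring.
Qed.

Lemma three_four_one x t : 1 < x ->
  0 <= 3 * Re (V 0 (x, 0)) + 4 * Re (V 0 (x, t)) + Re (V 0 (x, 2 * t)).
Proof.
move=> x1; have a0 : 0 < (x - 1) / 2 by lra.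
have sx y : 1 + 2 * ((x - 1) / 2) <= Re (x, y) by rewrite /Re /=; lra.
have dv y := dominated_cvgC a0 (dominated_vterm 0 a0 (sx y)).
have := cvgC_Re_ge0 (cvgC_add (cvgC_add (cvgC_scal (RtoC 3) (dv 0)) (cvgC_scal (RtoC 4) (dv t))) (dv (2 * t))).
set l := (_ + _)%C; have -> : Re l = 3 * Re (V 0 (x, 0)) + 4 * Re (V 0 (x, t)) + Re (V 0 (x, 2 * t)).
  by rewrite /l /V /Re /=; ring.
apply=> n n0.
set c := (_ + _)%C; have -> : Re c = 3 * Re (vterm 0 (x, 0) n) + 4 * Re (vterm 0 (x, t) n) + Re (vterm 0 (x, 2 * t) n).
  by rewrite /c /Re /=; ring.
rewrite !Re_vterm0 Rmult_0_l cos_0 (Rmult_assoc 2) cos_2a_cos.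
set q := cos _; set w := _ * Rpower _ _.
have w0 : 0 <= w by apply: Rmult_le_pos; [exact: vonMangoldt_ge0 | exact: Rlt_le (Rpower_gt0 _ _)].
have -> : 3 * (w * 1) + 4 * (w * q) + w * (2 * q * q - 1) = w * (2 * (1 + q) ^ 2) by ring.
by apply: Rmult_le_pos => //; have := pow2_ge_0 (1 + q); lra.
Qed.

(* The derivative of its logarithm is -2 (3 V(x) + 4 Re V(x + i t) + Re V(x + 2 i t)) <= 0; working
   with the product itself avoids assuming that zeta does not vanish. *)
Definition prod341 (t x : R) : R := sqZ 0 x ^ 3 * sqZ t x ^ 4 * sqZ (2 * t) x.

Lemma prod341_mono t x : 1 < x <= 3 -> prod341 t 3 <= prod341 t x.
Proof.
move=> [x1 x3].
pose D y := - (2) * prod341 t y * (3 * Re (V 0 (y, 0)) + 4 * Re (V 0 (y, t)) + Re (V 0 (y, 2 * t))).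
have dQ y : 1 < y -> is_derive (prod341 t) y (D y).
  move=> y1; apply: is_derive_val (is_derive_mult _ _ _ _ _ (is_derive_mult _ _ _ _ _
    (is_derive_pow _ 3 _ _ (is_derive_sqZ 0 y1)) (is_derive_pow _ 4 _ _ (is_derive_sqZ t y1)) Rmult_comm)
    (is_derive_sqZ (2 * t) y1) Rmult_comm).
  by rewrite /plus /mult /D /prod341 /=; ring.
have sq0 z y : 0 <= sqZ z y by rewrite sqZ_Cmod; exact: pow2_ge_0.
have [|y hy|c [hc E]] := @MVT_gen (prod341 t) x 3 D.
- by move=> y; rewrite Rmin_left // Rmax_right // => hy; apply: dQ; lra.
- apply/continuity_pt_filterlim/ex_derive_continuous; exists (D y); apply: dQ.
  by move: hy; rewrite Rmin_left // Rmax_right //; lra.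
rewrite Rmin_left // Rmax_right // in hc.
have c1 : 1 < c by lra.
have := three_four_one t c1.
have : 0 <= prod341 t c.
  by apply: Rmult_le_pos => //; apply: Rmult_le_pos; apply: pow_le.
set T := 3 * _ + _ + _; rewrite -/T /D -/T in E * => p0 T0.
have : 0 <= prod341 t c * T * (3 - x) by apply: Rmult_le_pos; [apply: Rmult_le_pos | lra].
rewrite -/T in E; nra.
Qed.

(** At real part 3 the terms after the first add up to at most [M / a = / 2], so zeta has modulus at
    least [/ 2]. This anchors the monotone product [prod341]. *)
Lemma sqZ_3_ge t : / 4 <= sqZ t 3.
Proof.
rewrite sqZ_Cmod.
have d : dominated (zterm 0 (3, t)) 1 2.
  move=> n n0; rewrite Cmod_zterm /= !Rmult_1_l; right; congr Rpower; rewrite /Re /=; ring.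
have := dominated_cinf Rlt_0_2 d (ltn0Sn 0).
rewrite csumS csum0.
have := Cmod_triangle (Z 0 (3, t)) (- (Z 0 (3, t) - (0 + zterm 0 (3, t) 1)))%C.
rewrite Cmod_opp -/(Z 0 (3, t)).
have -> : (Z 0 (3, t) + - (Z 0 (3, t) - (0 + zterm 0 (3, t) 1)) = zterm 0 (3, t) 1)%C by ring.
rewrite Cmod_zterm /Rpower ln_1 !Rmult_0_r exp_0 /= => h1 h2.
have : / 2 <= Cmod (Z 0 (3, t)) by lra.
nra.
Qed.

Lemma Z0_le s : 1 < Re s -> Cmod (Z 0 s) <= 1 + / (Re s - 1).
Proof.
move=> s1; have a0 : 0 < Re s - 1 by lra.
have d : dominated (zterm 0 s) 1 (Re s - 1).
  move=> n n0; rewrite Cmod_zterm /= !Rmult_1_l; right; congr Rpower; ring.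
by apply: Rle_trans (dominated_cinf_le a0 d) _; lra.
Qed.

Lemma ell_double t : 0 <= t -> ell (2 * t) <= 2 * ell t.
Proof.
move=> t0; apply: Rle_trans (_ : Rpower (2 * (t + 2)) (/ 54) <= _).
  by apply: Rle_Rpower_l; lra.
rewrite -Rpower_mult_distr; [|lra..].
apply: Rmult_le_compat_r; first exact: Rlt_le (Rpower_gt0 _ _).
by rewrite -{2}(Rpower_1 2); [apply: Rle_Rpower|]; lra.
Qed.

Lemma pow_le_inv x y n : 0 <= y -> 0 <= x -> x ^ n.+1 <= y ^ n.+1 -> x <= y.
Proof.
move=> y0 x0 h; case: (Rle_lt_dec x y) => // yx.
have : y ^ n.+1 < x ^ n.+1.
  elim: n {h} => [|n IH]; first by rewrite !pow_1.
  by rewrite -![_ ^ n.+2]/(_ * _ ^ n.+1); apply: Rmult_le_0_lt_compat => //; apply: pow_le.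
by lra.
Qed.

Lemma Z0_pow4_lower d : 0 < d -> exists A, 0 < A /\ forall s, 1 < Re s <= 2 -> d <= Im s ->
  (Re s - 1) ^ 3 <= A * ell (Im s) * Cmod (Z 0 s) ^ 4.
Proof.
move=> d0; have [K [K0 HK]] := Z_bound 0 d0.
(* The inequality is proved squared: [4096 ^ 2 = 4 ^ 8 * 2 ^ 6 * 2 ^ 2], from the lower bound at 3,
   the sixth power of [2 / (x - 1)], and the square of [2 * K * ell t]. *)
exists (4096 * K); split; first by lra.
move=> s; rewrite (surjective_pairing s) -/(Re s) -/(Im s) [Re (_, _)]/= [Im (_, _)]/=.
move: (Re s) (Im s) => x t {s} [x1 x2] dt; have t0 : 0 <= t by lra.
have l1 := ell_ge1 t0; have K1 : 0 < 4096 * K * ell t by nra.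
apply: (@pow_le_inv _ _ 1).
- by apply: Rmult_le_pos; [lra | apply: pow_le; exact: Cmod_ge_0].
- by apply: pow_le; lra.
have m := @prod341_mono t x ltac:(lra).
have h3 : / 4 ^ 8 <= prod341 t 3.
  have g y n : (/ 4) ^ n <= sqZ y 3 ^ n by apply: pow_incr; have := sqZ_3_ge y; lra.
  have p n : 0 <= (/ 4) ^ n by apply: pow_le; lra.
  rewrite (_ : / 4 ^ 8 = (/ 4) ^ 3 * (/ 4) ^ 4 * (/ 4) ^ 1); last by field.
  rewrite /prod341 -[sqZ (2 * t) 3]pow_1.
  apply: Rmult_le_compat => //; first exact: Rmult_le_pos.
  exact: Rmult_le_compat.
have z0 : sqZ 0 x <= (2 / (x - 1)) ^ 2.
  rewrite sqZ_Cmod; apply: pow_incr; split; first exact: Cmod_ge_0.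
  have := @Z0_le (x, 0); rewrite [Re (_, _)]/= => /(_ x1) h; apply: Rle_trans h _.
  have : 1 <= / (x - 1) by rewrite -Rinv_1; apply: Rinv_le_contravar; lra.
  rewrite /Rdiv; lra.
have z2 : sqZ (2 * t) x <= (2 * K * ell t) ^ 2.
  rewrite sqZ_Cmod; apply: pow_incr; split; first exact: Cmod_ge_0.
  have := HK (x, 2 * t); rewrite [Re (_, _)]/= [Im (_, _)]/= => /(_ (conj x1 x2) ltac:(lra)) h.
  apply: Rle_trans h _; rewrite pow_1; have := ell_double t0; nra.
have sq0 z y : 0 <= sqZ z y by rewrite sqZ_Cmod; exact: pow2_ge_0.
have q : prod341 t x <= ((2 / (x - 1)) ^ 2) ^ 3 * (Cmod (Z 0 (x, t)) ^ 2) ^ 4 * (2 * K * ell t) ^ 2.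
  rewrite /prod341 -(sqZ_Cmod t x).
  apply: Rmult_le_compat => //; first by apply: Rmult_le_pos; apply: pow_le.
  apply: Rmult_le_compat_r; first exact: pow_le.
  by apply: pow_incr.
have e0 : 0 < x - 1 by lra.
have := Rmult_le_compat_l ((x - 1) ^ 6 * 4 ^ 8) _ _ ltac:(apply: Rmult_le_pos; apply: pow_le; lra)
  (Rle_trans _ _ _ h3 (Rle_trans _ _ _ m q)).
have -> : (x - 1) ^ 6 * 4 ^ 8 * / 4 ^ 8 = ((x - 1) ^ 3) ^ 2 by field.
move=> h; apply: Rle_trans h _; right; field; lra.
Qed.

(** To the right of [1 + eta] the bound on the fourth power suffices. Closer to the line, zeta is
    compared with its value at [1 + eta], at a cost of at most [2 * K * ell ^ 2 * eta] by the bound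
    on [Z 1]. *)
Lemma Z0_lower d : 0 < d -> exists B, 0 < B /\ forall s, 1 < Re s <= 2 -> d <= Im s ->
  1 <= B * ell (Im s) ^ 7 * Cmod (Z 0 s).
Proof.
move=> d0; have [A [A0 HA]] := Z0_pow4_lower d0; have [K [K0 HK]] := Z_bound 1 d0.
pose B := 1 + A; have B1 : 1 < B by rewrite /B; lra.
have AB : A <= B ^ 4 by have := pow_le1_mono (Rlt_le _ _ B1) (isT : (1 <= 4)%N); rewrite /B pow_1; lra.
(* Chosen so that [2 * B * K * k <= / 2]: the displacement loses at most half of the lower bound. *)
pose k := / (4 * B * K + 1).
have BK : 0 < 4 * B * K by apply: Rmult_lt_0_compat; lra.
have k0 : 0 < k by apply: Rinv_0_lt_compat; lra.
have kE : k * (4 * B * K + 1) = 1 by rewrite Rinv_l; lra.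
have k1 : k <= 1 by nra.
have k3 : 0 < k ^ 3 by apply: pow_lt.
exists (2 * B / k ^ 3); split; first by apply: Rdiv_lt_0_compat; lra.
move=> s; rewrite (surjective_pairing s) -/(Re s) -/(Im s) [Re (_, _)]/= [Im (_, _)]/=.
move: (Re s) (Im s) => x t {s} [x1 x2] dt; have t0 : 0 <= t by lra.
have l1 := ell_ge1 t0; set l := ell t in l1 *.
have il : 0 < / l <= 1 by split; [apply: Rinv_0_lt_compat; lra | rewrite -Rinv_1; apply: Rinv_le_contravar; lra].
have ll : l * / l = 1 by rewrite Rinv_r; lra.
pose i := / l; rewrite -/i in il ll.
have i7 : 0 < i ^ 7 by apply: pow_lt; lra.
(* If [eta] has order [ell ^ (- e)], the lower bound has order [ell ^ (- (3 e + 1) / 4)] and the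
   loss [ell ^ (2 - e)]. They balance at [e = 9], where both exponents are -7. *)
pose eta := k ^ 4 * i ^ 9.
have i9 : 0 < i ^ 9 <= 1 by split; [apply: pow_lt; lra | rewrite -(pow1 9); apply: pow_incr; lra].
have k4 : 0 < k ^ 4 <= 1 by split; [apply: pow_lt; lra | rewrite -(pow1 4); apply: pow_incr; lra].
have eta0 : 0 < eta <= 1 by rewrite /eta; nra.
have step y : 1 + eta <= y <= 2 -> k ^ 3 * i ^ 7 <= B * Cmod (Z 0 (y, t)).
  move=> hy; apply: (@pow_le_inv _ _ 3).
  - by apply: Rmult_le_pos; [lra | exact: Cmod_ge_0].
  - by apply: Rmult_le_pos; lra.
  have := HA (y, t); rewrite [Re _]/= [Im _]/= -/l => /(_ ltac:(lra) dt) h.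
  have e3 : eta ^ 3 <= (y - 1) ^ 3 by apply: pow_incr; lra.
  have h' := Rmult_le_compat_r i _ _ ltac:(lra) (Rle_trans _ _ _ e3 h).
  rewrite (_ : (k ^ 3 * i ^ 7) ^ 4 = eta ^ 3 * i); last by rewrite /eta; ring.
  apply: Rle_trans h' _.
  rewrite (_ : A * l * _ * i = A * Cmod (Z 0 (y, t)) ^ 4 * (l * i)); last by ring.
  rewrite ll Rmult_1_r Rpow_mult_distr; apply: Rmult_le_compat_r => //.
  by apply: pow_le; exact: Cmod_ge_0.
suff h : k ^ 3 * i ^ 7 <= 2 * B * Cmod (Z 0 (x, t)).
  have := Rmult_le_compat_r (l ^ 7 / k ^ 3) _ _ _ h.
  have -> : k ^ 3 * i ^ 7 * (l ^ 7 / k ^ 3) = (l * i) ^ 7 by field; lra.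
  rewrite ll pow1 => h'; apply: Rle_trans (h' _) _.
    by apply: Rdiv_le_0_compat => //; apply: pow_le; lra.
  by right; field; lra.
case: (Rle_lt_dec (1 + eta) x) => hx.
  by have := step x ltac:(lra); have := Cmod_ge_0 (Z 0 (x, t)); nra.
have h1 := step (1 + eta) ltac:(lra).
have h2 : Cmod (Z 0 (Rplus 1 eta, t) - Z 0 (x, t))%C <= 2 * (K * l ^ 2) * ((1 + eta) - x).
  apply: (@mvtC (fun y => Z 0 (y, t)) (fun y => - Z 1 (y, t))%C); first by lra.
    by move=> y hy; apply: is_deriveC_Z0; lra.
  move=> y hy; rewrite Cmod_opp; have := HK (y, t); rewrite [Re _]/= [Im _]/= -/l.
  by apply; lra.
have h3 : 2 * (K * l ^ 2) * ((1 + eta) - x) <= 2 * K * k * (k ^ 3 * i ^ 7).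
  apply: Rle_trans (_ : 2 * (K * l ^ 2) * eta <= _).
    by apply: Rmult_le_compat_l; [have := pow2_ge_0 l; nra | lra].
  right; rewrite /eta (_ : _ * _ = 2 * K * k * (k ^ 3 * i ^ 7) * (l * i) ^ 2); last by ring.
  by rewrite ll; ring.
have h4 : Cmod (Z 0 (Rplus 1 eta, t)) <= Cmod (Z 0 (x, t)) + Cmod (Z 0 (Rplus 1 eta, t) - Z 0 (x, t))%C.
  apply: Rle_trans (Cmod_triangle _ _); right; congr Cmod; ring.
have h5 : B * (2 * K * k) <= / 2 by nra.
set q := k ^ 3 * i ^ 7 in h1 h3 *.
have q0 : 0 < q by apply: Rmult_lt_0_compat.
have h6 : B * Cmod (Z 0 (Rplus 1 eta, t)) <= B * (Cmod (Z 0 (x, t)) + 2 * K * k * q).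
  by apply: Rmult_le_compat_l; lra.
have h7 : B * (2 * K * k) * q <= / 2 * q by apply: Rmult_le_compat_r; lra.
by lra.
Qed.

(** The constant does not depend on the real part, so estimates to the right of the line reduce to
    counting powers of [ell]: a maximum for sums, a sum for products. *)
Definition strip_le (d : R) (f : C -> C) (m : nat) : Prop :=
  exists A, 0 <= A /\ forall s, 1 < Re s <= 2 -> d <= Im s -> Cmod (f s) <= A * ell (Im s) ^ m.

Section StripBounds.
Variable d : R.
Hypothesis d0 : 0 < d.

Lemma strip_le_ext f g m :
  (forall s, 1 < Re s <= 2 -> d <= Im s -> f s = g s) -> strip_le d f m -> strip_le d g m.
Proof. by move=> fg [A [A0 h]]; exists A; split=> // s s1 s2; rewrite -fg //; exact: h. Qed.

Lemma strip_le_add f g m n : strip_le d f m -> strip_le d g n ->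
  strip_le d (fun s => f s + g s)%C (maxn m n).
Proof.
move=> [A [A0 hf]] [B [B0 hg]]; exists (A + B); split; first by lra.
move=> s s1 s2; have l1 := @ell_ge1 (Im s) ltac:(lra).
have lm : ell (Im s) ^ m <= ell (Im s) ^ maxn m n by apply: pow_le1_mono => //; exact: leq_maxl.
have ln : ell (Im s) ^ n <= ell (Im s) ^ maxn m n by apply: pow_le1_mono => //; exact: leq_maxr.
apply: Rle_trans (Cmod_triangle _ _) _; rewrite Rmult_plus_distr_r.
apply: Rplus_le_compat.
  by apply: Rle_trans (hf _ s1 s2) _; exact: Rmult_le_compat_l.
by apply: Rle_trans (hg _ s1 s2) _; exact: Rmult_le_compat_l.
Qed.

Lemma strip_le_mul f g m n : strip_le d f m -> strip_le d g n ->
  strip_le d (fun s => f s * g s)%C (m + n).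
Proof.
move=> [A [A0 hf]] [B [B0 hg]]; exists (A * B); split; first exact: Rmult_le_pos.
move=> s s1 s2; rewrite Cmod_mult pow_add.
apply: Rle_trans (Rmult_le_compat _ _ _ _ (Cmod_ge_0 _) (Cmod_ge_0 _) (hf _ s1 s2) (hg _ s1 s2)) _.
by right; ring.
Qed.

Lemma strip_le_opp f m : strip_le d f m -> strip_le d (fun s => - f s)%C m.
Proof. by move=> [A [A0 h]]; exists A; split=> // s s1 s2; rewrite Cmod_opp; exact: h. Qed.

Lemma strip_Z k : strip_le d (Z k) k.+1.
Proof. by have [K [K0 h]] := Z_bound k d0; exists K; split; [lra | exact: h]. Qed.

Lemma Z0_neq0_strip s : 1 < Re s <= 2 -> d <= Im s -> Z 0 s <> 0%C.
Proof.
move=> s1 s2 z; have [B [B0 h]] := Z0_lower d0.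
by have := h s s1 s2; rewrite z Cmod_0; lra.
Qed.

Lemma strip_invZ : strip_le d (fun s => / Z 0 s)%C 7.
Proof.
have [B [B0 h]] := Z0_lower d0; exists B; split; first by lra.
move=> s s1 s2; have z0 := Z0_neq0_strip s1 s2; rewrite Cmod_inv //.
have c0 : 0 < Cmod (Z 0 s) by apply/Cmod_gt_0.
apply: (Rmult_le_reg_r (Cmod (Z 0 s))) => //; rewrite Rinv_l; last by lra.
exact: h.
Qed.

Lemma Z_identities s : 1 < Re s ->
  [/\ Z 1 s = (V 0 s * Z 0 s)%C, Z 2 s = (V 1 s * Z 0 s + V 0 s * Z 1 s)%C &
   Z 3 s = (V 2 s * Z 0 s + (V 1 s * Z 1 s + V 1 s * Z 1 s) + V 0 s * Z 2 s)%C].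
Proof.
move=> s1; have a0 : 0 < (Re s - 1) / 2 by lra.
have sa : 1 + 2 * ((Re s - 1) / 2) <= Re s by lra.
by split; [exact: Z1_eq a0 sa | exact: Z2_eq a0 sa | exact: Z3_eq a0 sa].
Qed.

Lemma strip_V0 : strip_le d (V 0) 9.
Proof.
apply: strip_le_ext (strip_le_mul (strip_Z 1) strip_invZ) => s s1 s2.
have [-> _ _] := Z_identities (proj1 s1); have := Z0_neq0_strip s1 s2.
by move=> z0; field.
Qed.

Lemma strip_V1 : strip_le d (V 1) 18.
Proof.
apply: strip_le_ext (strip_le_mul (strip_le_add (strip_Z 2)
  (strip_le_opp (strip_le_mul strip_V0 (strip_Z 1)))) strip_invZ) => s s1 s2.
have [_ -> _] := Z_identities (proj1 s1); have := Z0_neq0_strip s1 s2.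
by move=> z0; field.
Qed.

(** [Z3_eq] is solved for [V 2]. The worst product is [V 1 * Z 1], of exponent 18 + 2, and division
    by zeta adds 7; likewise 9 = 2 + 7 and 18 = 9 + 2 + 7 for [V 0] and [V 1]. *)
Lemma strip_V2 : strip_le d (V 2) 27.
Proof.
apply: strip_le_ext (strip_le_mul (strip_le_add (strip_Z 3)
  (strip_le_opp (strip_le_add
    (strip_le_add (strip_le_mul strip_V1 (strip_Z 1)) (strip_le_mul strip_V1 (strip_Z 1)))
    (strip_le_mul strip_V0 (strip_Z 2))))) strip_invZ) => s s1 s2.
have [_ _ ->] := Z_identities (proj1 s1); have := Z0_neq0_strip s1 s2.
by move=> z0; field.
Qed.

Lemma strip_D2 : strip_le d (fun s => V 2 s - Z 2 s)%C 27.
Proof. exact: strip_le_add strip_V2 (strip_le_opp (strip_Z 2)). Qed.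

End StripBounds.

(** * Cancellation of the poles at s = 1 *)

Lemma tail_poly_at0 (w : C) : w <> 0%C ->
  [/\ tail_poly 0 w 0 = (/ w)%C, tail_poly 1 w 0 = (/ (w * w))%C,
      tail_poly 2 w 0 = (2 / (w * w * w))%C & tail_poly 3 w 0 = (6 / (w * w * w * w))%C].
Proof.
move=> w0.
have e1 : tail_poly 1 w 0 = (/ (w * w))%C.
  by rewrite /= Rmult_0_l; field.
have e2 : tail_poly 2 w 0 = (2 / (w * w * w))%C.
  rewrite -[tail_poly 2 w 0]/((RtoC (0 * 0 ^ 1) + RtoC (INR 2) * tail_poly 1 w 0) / w)%C e1 Rmult_0_l.
  by rewrite (_ : INR 2 = 2) //; field.
split=> //.
rewrite -[tail_poly 3 w 0]/((RtoC (0 * 0 ^ 2) + RtoC (INR 3) * tail_poly 2 w 0) / w)%C e2 Rmult_0_l.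
rewrite (_ : INR 3 = 3); last by rewrite INR_IZR_INZ.
have -> : RtoC 6 = (RtoC 2 * RtoC 3)%C by rewrite -RtoC_mult; congr RtoC; ring.
by field.
Qed.

(* Here w = s - 1 and h_k is the regular part of [Z k] at 1. As q = w zeta(s) has derivatives
   - g1, g2, - g3, the first three terms on the right are - (q' / q)'', that is [V 2 - 2 / w^3]. *)
Lemma D2_near_pole_identity (w h0 h1 h2 h3 Z0 Z1 Z2 Z3 V0 V1 V2 : C) :
  let q := (1 + w * h0)%C in
  let g1 := (w * h1 - h0)%C in let g2 := (w * h2 - 2 * h1)%C in
  let g3 := (w * h3 - 3 * h2)%C in
  w <> 0%C -> q <> 0%C ->
  Z0 = (/ w + h0)%C -> Z1 = (/ (w * w) + h1)%C -> Z2 = (2 / (w * w * w) + h2)%C ->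
  Z3 = (6 / (w * w * w * w) + h3)%C ->
  Z1 = (V0 * Z0)%C -> Z2 = (V1 * Z0 + V0 * Z1)%C ->
  Z3 = (V2 * Z0 + (V1 * Z1 + V1 * Z1) + V0 * Z2)%C ->
  (V2 - Z2 = g3 * / q - 3 * (g2 * / q) * (g1 * / q) +
    2 * ((g1 * / q) * (g1 * / q) * (g1 * / q)) - h2)%C.
Proof.
move=> q g1 g2 g3 w0 q0 E0 E1 E2 E3 I1 I2 I3.
have z0 : Z0 <> 0%C.
  move=> h; apply: q0; rewrite /q.
  have -> : (1 + w * h0 = w * (/ w + h0))%C by field.
  by rewrite -E0 h; ring.
have -> : V2 = ((Z3 - (V1 * Z1 + V1 * Z1) - V0 * Z2) / Z0)%C by rewrite I3; field.
have -> : V1 = ((Z2 - V0 * Z1) / Z0)%C by rewrite I2; field.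
have -> : V0 = (Z1 / Z0)%C by rewrite I1; field.
rewrite {}E1 {}E2 {}E3 in I1 I2 I3 *; rewrite {}E0 in z0 I1 I2 I3 *.
rewrite /g1 /g2 /g3 /q; clear I1 I2 I3.
have z0' : (1 + h0 * w <> 0)%C by rewrite Cmult_comm.
by field; repeat split.
Qed.

Lemma D2_near_pole : exists d C, [/\ 0 < d <= 1, 0 <= C &
  forall s, 1 < Re s <= 1 + d -> 0 <= Im s <= d -> Cmod (V 2 s - Z 2 s)%C <= C].
Proof.
pose e := euler_const 0 + euler_const 1 + euler_const 2 + euler_const 3.
have ek := euler_const_ge0.
have e_le k : (k < 4)%N -> euler_const k <= e.
  have := ek 0%N; have := ek 1%N; have := ek 2%N; have := ek 3%N.
  by rewrite /e; case: k => [|[|[|[|k]]]] //= *; lra.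
have e0 : 0 <= e by apply: Rle_trans (ek 0%N) (e_le _ _).
(* A common bound for the four regular parts, from [Z_pole] with [Cmod s <= 3]. Then [d = / (4 * H)]
   gives [Cmod (w * h0) <= 2 * d * H = / 2], so the denominator stays above [/ 2]. *)
pose H := 1 + 24 * e; have H1 : 1 <= H by rewrite /H; lra.
pose d := / (4 * H).
have dH : d * H = / 4 by rewrite /d; field; lra.
have d0 : 0 < d by apply: Rinv_0_lt_compat; lra.
have d4 : d <= / 4 by nra.
(* The three quotients are at most [4 * H], [6 * H] and [8 * H]; the middle terms are [3 * 6 * 4]
   and [2 * 4 ^ 3]. *)
exists d, (8 * H + 72 * H ^ 2 + 128 * H ^ 3 + H); split; first by lra.
  have := pow_le H 2; have := pow_le H 3; lra.
move=> s s1 s2.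
have hs k : (k < 4)%N -> Cmod (Z k s - tail_poly k (s - 1) 0)%C <= H.
  move=> k4; apply: Rle_trans (Z_pole k (proj1 s1)) _; rewrite /H.
  have : Cmod s <= 3.
    by apply: Rle_trans (Cmod_le_ReIm _) _; rewrite !Rabs_pos_eq; lra.
  by have := e_le k k4; have := ek k; have := Cmod_ge_0 s; nra.
set w := (s - 1)%C in hs.
have w0 : w <> 0%C.
  have hr : Re w = Re s - 1 by rewrite /w /Re /=; ring.
  by move=> h; move: hr; rewrite h /Re /= -/(Re s); lra.
have wm : Cmod w <= 2 * d.
  apply: Rle_trans (Cmod_le_ReIm _) _.
  have -> : Re w = Re s - 1 by rewrite /w /Re /=; ring.
  have -> : Im w = Im s by rewrite /w /Im /=; ring.
  by rewrite !Rabs_pos_eq; lra.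
have [t0 t1 t2 t3] := tail_poly_at0 w0.
have [I1 I2 I3] := Z_identities (proj1 s1).
have b0 := hs 0%N isT; have b1 := hs 1%N isT; have b2 := hs 2%N isT; have b3 := hs 3%N isT.
rewrite t0 in b0; rewrite t1 in b1; rewrite t2 in b2; rewrite t3 in b3.
set h0 := (Z 0 s - _)%C in b0; set h1 := (Z 1 s - _)%C in b1.
set h2 := (Z 2 s - _)%C in b2; set h3 := (Z 3 s - _)%C in b3.
have q2 : / 2 <= Cmod (1 + w * h0)%C.
  have : Cmod (w * h0)%C <= / 2.
    rewrite Cmod_mult; have := Cmod_ge_0 w; have := Cmod_ge_0 h0; nra.
  have := Cmod_triangle (1 + w * h0)%C (- (w * h0))%C.
  rewrite Cmod_opp (_ : 1 + w * h0 + - (w * h0) = 1)%C; last by ring.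
  by rewrite Cmod_1; lra.
have q0 : (1 + w * h0)%C <> 0%C by apply/Cmod_gt_0; lra.
have iq : Cmod (/ (1 + w * h0))%C <= 2.
  by rewrite Cmod_inv // -[2]Rinv_inv; apply: Rinv_le_contravar; lra.
rewrite (D2_near_pole_identity (w := w) (h0 := h0) (h1 := h1) (h2 := h2) (h3 := h3) w0 q0 _ _ _ _ I1 I2 I3);
  try by rewrite /h0 /h1 /h2 /h3; ring.
have wH x : Cmod x <= H -> Cmod (w * x)%C <= H.
  by move=> hx; rewrite Cmod_mult; have := Cmod_ge_0 w; have := Cmod_ge_0 x; nra.
have g1 : Cmod ((w * h1 - h0) * / (1 + w * h0))%C <= 4 * H.
  rewrite Cmod_mult; have := Cmod_sub_le (w * h1)%C h0; have := wH _ b1.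
  have := Cmod_ge_0 (w * h1 - h0)%C; have := Cmod_ge_0 (/ (1 + w * h0))%C; nra.
have g2 : Cmod ((w * h2 - 2 * h1) * / (1 + w * h0))%C <= 6 * H.
  rewrite Cmod_mult; have := Cmod_sub_le (w * h2)%C (2 * h1)%C; have := wH _ b2.
  rewrite [Cmod (2 * h1)]Cmod_mult Cmod_R Rabs_pos_eq; last by lra.
  have := Cmod_ge_0 (w * h2 - 2 * h1)%C; have := Cmod_ge_0 (/ (1 + w * h0))%C; nra.
have g3 : Cmod ((w * h3 - 3 * h2) * / (1 + w * h0))%C <= 8 * H.
  rewrite Cmod_mult; have := Cmod_sub_le (w * h3)%C (3 * h2)%C; have := wH _ b3.
  rewrite [Cmod (3 * h2)]Cmod_mult Cmod_R Rabs_pos_eq; last by lra.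
  have := Cmod_ge_0 (w * h3 - 3 * h2)%C; have := Cmod_ge_0 (/ (1 + w * h0))%C; nra.
move: g1 g2 g3; set G1 := (_ * / _)%C; set G2 := (_ * / _)%C; set G3 := (_ * / _)%C => g1 g2 g3.
clearbody G1 G2 G3.
apply: Rle_trans (Cmod_sub_le _ _) _; apply: Rplus_le_compat => //.
apply: Rle_trans (Cmod_triangle _ _) _; apply: Rplus_le_compat.
  apply: Rle_trans (Cmod_sub_le _ _) _; apply: Rplus_le_compat => //.
  rewrite !Cmod_mult Cmod_R Rabs_pos_eq; last by lra.
  by have := Rmult_le_compat _ _ _ _ (Cmod_ge_0 G2) (Cmod_ge_0 G1) g2 g1; lra.
rewrite !Cmod_mult Cmod_R Rabs_pos_eq; last by lra.
have -> : Cmod G1 * Cmod G1 * Cmod G1 = Cmod G1 ^ 3 by ring.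
have -> : 128 * H ^ 3 = 2 * (4 * H) ^ 3 by ring.
by apply: Rmult_le_compat_l; [lra | apply: pow_incr; have := Cmod_ge_0 G1; lra].
Qed.

Lemma D2_bound : exists d C, [/\ 0 < d <= 1, 0 < C &
  forall s, 1 < Re s <= 1 + d -> 0 < Im s -> Cmod (V 2 s - Z 2 s)%C <= C * sqrt (Im s + 2)].
Proof.
have [d [C [d01 C0 near]]] := D2_near_pole.
have [A [A0 far]] := strip_D2 (proj1 d01).
exists d, (C + A + 1); split=> //; first by lra.
move=> s s1 s2.
have E : sqrt (Im s + 2) = ell (Im s) ^ 27.
  rewrite -(ell_pow (Rlt_le _ _ s2)) -[54%N]/(27 * 2)%N.
  rewrite (pow_mult _ 27 2) sqrt_pow2 //; apply: pow_le.
  by have := ell_ge1 (Rlt_le _ _ s2); lra.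
have r1 : 1 <= ell (Im s) ^ 27 by apply: pow_R1_Rle; apply: ell_ge1; lra.
rewrite E; case: (Rle_lt_dec d (Im s)) => hd.
  have := far s ltac:(lra) hd; nra.
have := near s s1 ltac:(lra); nra.
Qed.

(** * Smoothed sums *)

Definition cos_kernel (a t : R) : R := (1 - cos (a * t)) / t ^ 2.
Definition cos_int (u T a : R) : R := RInt (cos_kernel a) u T.

Lemma continuous_cos_kernel a t : 0 < t -> continuous (cos_kernel a) t.
Proof.
move=> t0; apply: ex_derive_continuous; rewrite /cos_kernel; auto_derive.
by apply: Rgt_not_eq; nra.
Qed.

Lemma ex_RInt_cos_kernel a u T : 0 < u -> u <= T -> ex_RInt (cos_kernel a) u T.
Proof.
move=> u0 uT; apply: ex_RInt_continuous => t; rewrite Rmin_left // => ht.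
by apply: continuous_cos_kernel; lra.
Qed.

Lemma RInt_inv_sqr u T : 0 < u -> u <= T ->
  is_RInt (fun t => / t ^ 2) u T (/ u - / T).
Proof.
move=> u0 uT.
have := @is_RInt_derive R_CompleteNormedModule (fun t => - / t) (fun t => / t ^ 2) u T.
rewrite Rmin_left // Rmax_right // => h.
have -> : / u - / T = minus (- / T) (- / u) by rewrite /minus /plus /opp /=; ring.
apply: h => t ht; first by auto_derive; [lra | field; lra].
by apply: ex_derive_continuous; auto_derive; apply: Rgt_not_eq; nra.
Qed.

Lemma cos_ge x : 1 - x ^ 2 / 2 <= cos x.
Proof.
have h y : 0 <= y -> 1 - y ^ 2 / 2 <= cos y.
  move=> y0; pose f z := cos z + z ^ 2 / 2.
  have [||c [hc E]] := @MVT_gen f 0 y (fun z => z - sin z).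
  - by move=> z _; rewrite /f; auto_derive => //; field.
  - move=> z _; apply/continuity_pt_filterlim/ex_derive_continuous.
    by rewrite /f; auto_derive.
  rewrite Rmin_left // Rmax_right // in hc.
  have s : sin c <= c by case: (Req_dec c 0) => [->|c0]; [rewrite sin_0; lra | have := sin_lt_x c; lra].
  move: E; rewrite /f cos_0; nra.
case: (Rle_lt_dec 0 x) => x0; first exact: h.
by have := h (- x) ltac:(lra); rewrite cos_neg; lra.
Qed.

Lemma cos_kernel_bounds a t : 0 < t ->
  [/\ 0 <= cos_kernel a t, cos_kernel a t <= a ^ 2 / 2 & cos_kernel a t <= 2 * / t ^ 2].
Proof.
move=> t0; have t2 : 0 < t ^ 2 by apply: pow_lt.
have it2 : 0 < / t ^ 2 by apply: Rinv_0_lt_compat.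
have [c1 c2] := COS_bound (a * t); have c3 := cos_ge (a * t).
rewrite /cos_kernel /Rdiv; split; first by apply: Rmult_le_pos; lra.
  have -> : a ^ 2 * / 2 = (a ^ 2 / 2 * t ^ 2) * / t ^ 2 by field; lra.
  by apply: Rmult_le_compat_r; nra.
by apply: Rmult_le_compat_r; lra.
Qed.

Lemma cos_int_ge0 a u T : 0 < u -> u <= T -> 0 <= cos_int u T a.
Proof.
move=> u0 uT; apply: RInt_ge_0 => //; first exact: ex_RInt_cos_kernel.
by move=> t ht; case: (@cos_kernel_bounds a t); lra.
Qed.

Lemma cos_int_small u T : 0 < u -> u <= T -> cos_int u T 1 <= T / 2.
Proof.
move=> u0 uT; apply: Rle_trans (_ : RInt (fun=> / 2) u T <= _).
  apply: RInt_le => //; [exact: ex_RInt_cos_kernel | exact: ex_RInt_const|].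
  by move=> t ht; case: (@cos_kernel_bounds 1 t); lra.
by rewrite RInt_const /scal /= /mult /=; lra.
Qed.

Lemma cos_int_large u T a : 0 < u -> u <= T -> cos_int u T a <= 2 / u.
Proof.
move=> u0 uT; have h := is_RInt_scal _ _ _ 2 _ (RInt_inv_sqr u0 uT).
apply: Rle_trans (_ : RInt (fun t => scal 2 (/ t ^ 2)) u T <= _).
  apply: RInt_le => //; [exact: ex_RInt_cos_kernel | by eexists; exact: h|].
  by move=> t ht; case: (@cos_kernel_bounds a t); [lra|rewrite /scal /= /mult /=; lra].
rewrite (is_RInt_unique _ _ _ _ h) /scal /= /mult /=.
have : 0 < / T by apply: Rinv_0_lt_compat; lra.
by rewrite /Rdiv; lra.
Qed.

Lemma cos_int_Chasles u v T a : 0 < u -> u <= v -> v <= T ->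
  cos_int u T a = cos_int u v a + cos_int v T a.
Proof.
move=> u0 uv vT; rewrite /cos_int -(RInt_Chasles _ u v T) //; apply: ex_RInt_cos_kernel; lra.
Qed.

Lemma cos_int_extend u u' T' T : 0 < u -> u <= u' -> u' <= T' -> T' <= T ->
  cos_int u' T' 1 <= cos_int u T 1 <= cos_int u' T' 1 + u' / 2 + 2 / T'.
Proof.
move=> u0 h1 h2 h3.
rewrite (@cos_int_Chasles u u' T) ?(@cos_int_Chasles u' T' T); try lra.
have := @cos_int_ge0 1 u u'; have := @cos_int_small u u'.
have := @cos_int_ge0 1 T' T; have := @cos_int_large T' T 1; lra.
Qed.

(** The constant is the supremum of the truncated integrals, so no improper integral is formed. Two
    windows are compared inside a common larger one; the kernel is at most [/ 2] near 0 and
    [2 / t ^ 2] far away. The window [[1, 2]] shows positivity. *)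
Lemma cos_int_const : exists c, 0 < c /\ forall u T, 0 < u -> u <= T ->
  cos_int u T 1 <= c <= cos_int u T 1 + u / 2 + 2 / T.
Proof.
pose S x := exists u T, [/\ 0 < u, u <= T & x = cos_int u T 1].
have up u T u' T' : 0 < u -> u <= T -> 0 < u' -> u' <= T' ->
    cos_int u T 1 <= cos_int u' T' 1 + u' / 2 + 2 / T'.
  move=> u0 uT u'0 uT'.
  have m1 := Rmin_l u u'; have m2 := Rmin_r u u'.
  have M1 := Rmax_l T T'; have M2 := Rmax_r T T'.
  have m0 : 0 < Rmin u u' by apply: Rmin_pos.
  have := @cos_int_extend (Rmin u u') u T (Rmax T T') m0 m1 uT M1.
  have := @cos_int_extend (Rmin u u') u' T' (Rmax T T') m0 m2 uT' M2.
  by lra.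
have [|| c [c1 c2]] := completeness S.
- exists (cos_int 1 2 1 + 1 / 2 + 2 / 2) => x [u [T [u0 uT ->]]].
  by apply: up => //; lra.
- by exists (cos_int 1 2 1), 1, 2; split=> //; lra.
have c12 : 0 < cos_int 1 2 1.
  have cc : cos 1 < 1.
    by rewrite -[X in _ < X]cos_0; apply: cos_decreasing_1; have := PI2_3_2; lra.
  apply: Rlt_le_trans (_ : RInt (fun=> (1 - cos 1) / 4) 1 2 <= _).
    by rewrite RInt_const /scal /= /mult /=; lra.
  apply: RInt_le; [lra | exact: ex_RInt_const | apply: ex_RInt_cos_kernel; lra|].
  move=> t ht; rewrite /cos_kernel Rmult_1_l.
  have : cos t <= cos 1 by apply: cos_decr_1; have := PI2_3_2; lra.
  have : / 4 <= / t ^ 2 by apply: Rinv_le_contravar; nra.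
  rewrite /Rdiv; nra.
exists c; split.
  by apply: Rlt_le_trans c12 _; apply: c1; exists 1, 2; split=> //; lra.
move=> u T u0 uT; split; first by apply: c1; exists u, T.
by apply: c2 => x [u' [T' [u'0 uT' ->]]]; exact: up.
Qed.

Lemma cos_int_scal a u T : 0 < a -> 0 < u -> u <= T ->
  cos_int u T a = a * cos_int (a * u) (a * T) 1.
Proof.
move=> a0 u0 uT; rewrite /cos_int.
have := @RInt_comp_lin R_CompleteNormedModule (cos_kernel 1) a 0 u T.
rewrite !Rplus_0_r => <-; last by apply: ex_RInt_cos_kernel; nra.
have := @RInt_scal R_CompleteNormedModule (fun y => scal a (cos_kernel 1 (a * y + 0))) u T a.
move=> E; apply: etrans (E _).
  apply: RInt_ext => t; rewrite Rmin_left // => ht.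
  by rewrite /scal /= /mult /= /cos_kernel Rplus_0_r Rmult_1_l; field; nra.
apply: ex_RInt_continuous => t; rewrite Rmin_left // => ht.
apply: ex_derive_continuous; rewrite /cos_kernel /scal /= /mult /=; auto_derive.
by apply: Rgt_not_eq; rewrite Rmult_1_r; apply: Rmult_lt_0_compat; nra.
Qed.

(* Scaling the integration variable makes the integral of [(1 - cos (a t)) / t^2] over [(0, oo)]
   proportional to [|a|]; the value of the factor is never needed. *)
Lemma cos_int_abs : exists c, 0 < c /\ forall a T, 1 < T ->
  Rabs (cos_int (/ T) T a - c * Rabs a) <= (a ^ 2 / 2 + 2) / T.
Proof.
have [c [c0 H]] := cos_int_const; exists c; split=> // a T T1.
have iT : 0 < / T < 1 by split; [apply: Rinv_0_lt_compat | rewrite -Rinv_1; apply: Rinv_lt_contravar]; lra.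
have pos b : 0 < b -> Rabs (cos_int (/ T) T b - c * b) <= (b ^ 2 / 2 + 2) / T.
  move=> b0; rewrite cos_int_scal //; try lra.
  have [h1 h2] := H (b * / T) (b * T) ltac:(nra) ltac:(nra).
  have -> : (b ^ 2 / 2 + 2) / T = b * (b * / T / 2 + 2 / (b * T)) by field; lra.
  rewrite Rabs_left1; nra.
case: (Rtotal_order a 0) => [an|[->|ap]]; last by rewrite (Rabs_pos_eq a); [exact: pos | lra].
  have -> : cos_int (/ T) T a = cos_int (/ T) T (- a).
    by apply: RInt_ext => t _; rewrite /cos_kernel -Ropp_mult_distr_l cos_neg.
  by rewrite (Rabs_left a) //; have := pos (- a) ltac:(lra); rewrite (_ : (- a) ^ 2 = a ^ 2) //; ring.
rewrite Rabs_R0 Rmult_0_r Rminus_0_r.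
have -> : cos_int (/ T) T 0 = 0.
  rewrite -[RHS](_ : RInt (fun=> 0) (/ T) T = 0).
    by apply: RInt_ext => t _; rewrite /cos_kernel Rmult_0_l cos_0 Rminus_diag /Rdiv Rmult_0_l.
  by rewrite RInt_const /scal /= /mult /=; ring.
by rewrite Rabs_R0; apply: Rdiv_le_0_compat; lra.
Qed.

Lemma le_of_le_div X Y W : (forall T, 1 < T -> X <= Y + W / T) -> X <= Y.
Proof.
move=> H; apply: le_epsilon => e e0; have w0 := Rabs_pos W.
have T1 : 1 < Rabs W / e + 2.
  by have : 0 <= Rabs W / e by [apply: Rdiv_le_0_compat]; lra.
apply: Rle_trans (H _ T1) _; apply: Rplus_le_compat_l.
apply: (Rmult_le_reg_r (Rabs W / e + 2)); first by lra.
have -> : W / (Rabs W / e + 2) * (Rabs W / e + 2) = W by field; nra.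
have -> : e * (Rabs W / e + 2) = Rabs W + 2 * e by field; lra.
by have := Rle_abs W; lra.
Qed.

Lemma le_of_le_rate X Y K a (N0 : nat) : 0 < a ->
  (forall N, (N0 < N)%N -> X <= Y + K * Rpower (INR N) (- a)) -> X <= Y.
Proof.
move=> a0 H; apply: le_epsilon => e e0.
have K1 : 0 < Rabs K + 1 by have := Rabs_pos K; lra.
have [N hN] := Rpower_cvg0 a0 (Rdiv_lt_0_compat _ _ e0 K1).
pose n := (maxn N0 N).+1.
have h1 := hN n ltac:(by rewrite ltnS leq_maxr).
apply: Rle_trans (H n _) _; first by rewrite ltnS leq_maxl.
apply: Rplus_le_compat_l; have P0 := Rpower_gt0 (INR n) (- a).
have := Rmult_lt_compat_r _ _ _ K1 h1; rewrite (_ : e / _ * _ = e); last by field; lra.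
by have := Rle_abs K; nra.
Qed.

Definition trapezoid (v h u : R) : R :=
  (Rabs (u + h) - Rabs u - Rabs (u - v) + Rabs (u - v - h)) / (2 * h).

Definition trap_kernel (v h u t : R) : R :=
  cos_kernel (u + h) t - cos_kernel u t - cos_kernel (u - v) t + cos_kernel (u - v - h) t.

Definition weight (x : R) (n : nat) : R :=
  (vonMangoldt n - 1) * ln (INR n) ^ 2 * Rpower (INR n) (- x).

Definition cis (y : R) : C := cexp (0, y).

Lemma cisD x y : cis (x + y) = (cis x * cis y)%C.
Proof. by rewrite /cis -cexpD; congr cexp; rewrite /Cplus /= Rplus_0_l. Qed.

(** In the combination of four translates the constants 1 cancel, and the remaining cosines are the
    real part of [n ^ (- i t)] times this factor. Its product form shows both its size near [t = 0]
    and its boundedness. *)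
Definition trap_phase (v h t : R) : C :=
  ((1 - cis (- (h * t))) * (1 - cis ((v + h) * t)))%C.

Lemma Cmod_1_sub_cis y : Cmod (1 - cis y)%C <= 2 /\ Cmod (1 - cis y)%C <= Rabs y.
Proof.
have E : Cmod (1 - cis y)%C ^ 2 = 2 - 2 * cos y.
  rewrite Cmod2_alt /cis /cexp /Re /Im /= exp_0.
  have := sin2_cos2 y; rewrite /Rsqr => h; nra.
have [c1 c2] := COS_bound y; have c3 := cos_ge y.
have p := Cmod_ge_0 (1 - cis y)%C; have r := Rabs_pos y.
split; apply: (@pow_le_inv _ _ 1) => //; rewrite ?E; try lra.
by rewrite pow2_abs; lra.
Qed.

Lemma trap_phase_le v h t : 0 <= v -> 0 < h -> 0 < t ->
  Cmod (trap_phase v h t) <= 4 /\ Cmod (trap_phase v h t) <= h * (v + h) * t ^ 2.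
Proof.
move=> v0 h0 t0; rewrite /trap_phase Cmod_mult.
have [a1 a2] := Cmod_1_sub_cis (- (h * t)); have [b1 b2] := Cmod_1_sub_cis ((v + h) * t).
rewrite Rabs_Ropp Rabs_pos_eq in a2; last by nra.
rewrite Rabs_pos_eq in b2; last by nra.
set A := Cmod _ in a1 a2 *; set B := Cmod _ in b1 b2 *.
have A0 : 0 <= A by exact: Cmod_ge_0.
have B0 : 0 <= B by exact: Cmod_ge_0.
split; first by nra.
rewrite (_ : h * (v + h) * t ^ 2 = (h * t) * ((v + h) * t)); last by ring.
exact: Rmult_le_compat.
Qed.

Lemma weight_kernel x v h t n : 0 < t ->
  weight x n * trap_kernel v h (ln (INR n)) t =
  Re (trap_phase v h t * (vterm 2 (x, t) n - zterm 2 (x, t) n))%C / t ^ 2.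
Proof.
move=> t0; set u := ln (INR n).
have -> : (vterm 2 (x, t) n - zterm 2 (x, t) n =
    RtoC (weight x n) * cis (- (u * t)))%C.
  rewrite /vterm /zterm /npow /weight -/u.
  have -> : cexp (- ((x, t) * RtoC u))%C = (RtoC (Rpower (INR n) (- x)) * cis (- (u * t)))%C.
    have -> : RtoC (Rpower (INR n) (- x)) = cexp (RtoC (- x * u)).
      by rewrite /cexp /= cos_0 sin_0 /RtoC /Rpower -/u; congr (_, _); ring.
    by rewrite -cexpD; congr cexp; rewrite /Copp /Cmult /Cplus /RtoC /=; congr (_, _); ring.
  by rewrite !RtoC_mult RtoC_minus; ring.
have -> : (trap_phase v h t * (RtoC (weight x n) * cis (- (u * t))) =
  RtoC (weight x n) * (cis (- (u * t)) - cis (- ((u + h) * t))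
     - cis (- ((u - v - h) * t)) + cis (- ((u - v) * t))))%C.
  have -> : cis (- ((u + h) * t)) = (cis (- (u * t)) * cis (- (h * t)))%C.
    by rewrite -cisD; congr cis; ring.
  have -> : cis (- ((u - v - h) * t)) = (cis (- (u * t)) * cis ((v + h) * t))%C.
    by rewrite -cisD; congr cis; ring.
  have -> : cis (- ((u - v) * t)) = (cis (- (u * t)) * (cis ((v + h) * t) * cis (- (h * t))))%C.
    by rewrite -!cisD; congr cis; ring.
  by rewrite /trap_phase; ring.
rewrite /trap_kernel /cos_kernel /cis /cexp /Re /Cmult /= exp_0 !cos_neg.
by field; lra.
Qed.

Lemma is_RInt_rsum (f : nat -> R -> R) (l : nat -> R) a b N :
  (forall n, (0 < n)%N -> is_RInt (f n) a b (l n)) ->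
  is_RInt (fun t => rsum (fun n => f n t) N) a b (rsum l N).
Proof.
move=> H; elim: N => [|N IH].
  apply: is_RInt_ext (_ : is_RInt (fun=> 0) a b _) => [t _|]; first by rewrite rsum0.
  rewrite rsum0; have := @is_RInt_const R_NormedModule a b 0.
  by rewrite /scal /= /mult /= Rmult_0_r.
rewrite rsumS; apply: is_RInt_ext (is_RInt_plus _ _ _ _ _ _ IH (H N.+1 isT)) => t _.
by rewrite rsumS.
Qed.

Lemma is_RInt_cos_kernel a u T : 0 < u -> u <= T -> is_RInt (cos_kernel a) u T (cos_int u T a).
Proof. by move=> u0 uT; apply: RInt_correct; exact: ex_RInt_cos_kernel. Qed.

Definition trap_int (v h U u T : R) : R :=
  cos_int u T (U + h) - cos_int u T U - cos_int u T (U - v) + cos_int u T (U - v - h).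

Lemma is_RInt_trap_kernel v h U u T : 0 < u -> u <= T ->
  is_RInt (trap_kernel v h U) u T (trap_int v h U u T).
Proof.
move=> u0 uT; apply: is_RInt_plus; last exact: is_RInt_cos_kernel.
apply: is_RInt_minus; last exact: is_RInt_cos_kernel.
by apply: is_RInt_minus; exact: is_RInt_cos_kernel.
Qed.

Lemma is_RInt_inv_t_sqrt T : 1 <= T ->
  is_RInt (fun t => / (t * sqrt t)) 1 T (2 - 2 / sqrt T).
Proof.
move=> T1.
have := @is_RInt_derive R_CompleteNormedModule (fun t => - 2 / sqrt t) (fun t => / (t * sqrt t)) 1 T.
rewrite Rmin_left // Rmax_right // => h.
have -> : 2 - 2 / sqrt T = minus (- 2 / sqrt T) (- 2 / sqrt 1).
  by rewrite sqrt_1 /minus /plus /opp /=; field; apply: Rgt_not_eq; apply: sqrt_lt_R0; lra.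
have sp t : 1 <= t <= T -> 0 < sqrt t by move=> ht; apply: sqrt_lt_R0; lra.
apply: h => t ht; have s0 := sp t ht.
  auto_derive; first by split; [lra | split; [lra|]].
  have -> : t = sqrt t * sqrt t by rewrite sqrt_sqrt; lra.
  by rewrite sqrt_square; [field|]; lra.
apply: ex_derive_continuous; auto_derive; split; first by lra.
by split=> //; apply: Rgt_not_eq; apply: Rmult_lt_0_compat; lra.
Qed.

(** [t ^ (- 3 / 2)] has integral at most 2 beyond 1. The exponent is that of the kernel [t ^ (- 2)]
    times the growth [sqrt t] of the Dirichlet series. *)
Lemma trap_integral_bound (F : R -> R) T l A B : 1 < T -> 0 <= A -> 0 <= B ->
  is_RInt F (/ T) T l ->
  (forall t, 0 < t <= 1 -> Rabs (F t) <= A) ->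
  (forall t, 1 <= t -> Rabs (F t) <= B * / (t * sqrt t)) -> Rabs l <= A + 2 * B.
Proof.
move=> T1 A0 B0 HF h1 h2.
have iT : 0 < / T < 1 by split; [apply: Rinv_0_lt_compat | rewrite -Rinv_1; apply: Rinv_lt_contravar]; lra.
have ex : ex_RInt F (/ T) T by exists l.
have e1 : ex_RInt F (/ T) 1 by apply: ex_RInt_Chasles_1 ex; lra.
have e2 : ex_RInt F 1 T by apply: ex_RInt_Chasles_2 ex; lra.
rewrite -(is_RInt_unique _ _ _ _ HF) -(RInt_Chasles _ _ _ _ e1 e2).
have b1 : Rabs (RInt F (/ T) 1) <= A.
  apply: Rle_trans (_ : (1 - / T) * A <= _); last by nra.
  apply: (norm_RInt_le_const F (/ T) 1); first by lra.
    by move=> x hx; apply: h1; lra.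
  exact: RInt_correct.
have b2 : Rabs (RInt F 1 T) <= scal B (2 - 2 / sqrt T).
  apply: (norm_RInt_le F (fun t => scal B (/ (t * sqrt t))) 1 T).
  - by lra.
  - by move=> x hx; apply: h2; lra.
  - exact: RInt_correct.
  by apply: is_RInt_scal; apply: is_RInt_inv_t_sqrt; lra.
have : 0 < / sqrt T by apply: Rinv_0_lt_compat; apply: sqrt_lt_R0; lra.
move: b2; rewrite /scal /= /mult /= /Rdiv => b2 sT.
have := Rabs_triang (RInt F (/ T) 1) (RInt F 1 T); rewrite /plus /=; nra.
Qed.

Lemma trap_int_approx : exists c, 0 < c /\ forall v h U, 0 < h ->
  exists W, forall T, 1 < T ->
  Rabs (trap_int v h U (/ T) T - c * (2 * h * trapezoid v h U)) <= W / T.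
Proof.
have [c [c0 H]] := cos_int_abs; exists c; split=> // v h U h0.
pose W a := a ^ 2 / 2 + 2.
exists (W (U + h) + W U + W (U - v) + W (U - v - h)) => T T1.
have -> : 2 * h * trapezoid v h U = Rabs (U + h) - Rabs U - Rabs (U - v) + Rabs (U - v - h).
  by rewrite /trapezoid; field; lra.
have HW b : - (W b * / T) <= cos_int (/ T) T b - c * Rabs b <= W b * / T.
  by apply/Rabs_le_between; exact: H.
clearbody W; have := HW (U + h); have := HW U; have := HW (U - v); have := HW (U - v - h).
by move=> h1 h2 h3 h4; apply/Rabs_le_between; rewrite /trap_int; lra.
Qed.

(** [W] may depend on [n]; this is harmless because [T] tends to infinity while the number of terms
    is fixed. *)
Lemma rsum_approx (b : nat -> R) (f : nat -> R -> R) (g : nat -> R) N :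
  (forall n, exists W, forall T, 1 < T -> Rabs (f n T - g n) <= W / T) ->
  exists W, forall T, 1 < T ->
    Rabs (rsum (fun n => b n * f n T) N - rsum (fun n => b n * g n) N) <= W / T.
Proof.
move=> H; elim: N => [|N [W hW]].
  by exists 0 => T T1; rewrite !rsum0 Rminus_diag Rabs_R0 /Rdiv Rmult_0_l; lra.
have [W' hW'] := H N.+1; exists (W + Rabs (b N.+1) * W') => T T1; rewrite !rsumS.
have -> : rsum (fun n => b n * f n T) N + b N.+1 * f N.+1 T -
  (rsum (fun n => b n * g n) N + b N.+1 * g N.+1) =
  (rsum (fun n => b n * f n T) N - rsum (fun n => b n * g n) N) + b N.+1 * (f N.+1 T - g N.+1) by ring.
apply: Rle_trans (Rabs_triang _ _) _; rewrite Rabs_mult.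
have := hW T T1; have := Rmult_le_compat_l _ _ _ (Rabs_pos (b N.+1)) (hW' T T1).
by rewrite /Rdiv; lra.
Qed.

Lemma trapezoid_0 v h u : 0 <= v -> 0 < h -> v + h <= u -> trapezoid v h u = 0.
Proof. by move=> v0 h0 hu; rewrite /trapezoid !Rabs_pos_eq; try lra; field; lra. Qed.

Lemma trapezoid_1 v h u : 0 < h -> 0 <= u <= v -> trapezoid v h u = 1.
Proof.
move=> h0 hu; rewrite /trapezoid (Rabs_pos_eq (u + h)) ?(Rabs_pos_eq u); try lra.
by rewrite (Rabs_left1 (u - v)) ?(Rabs_left1 (u - v - h)); try lra; field; lra.
Qed.

Lemma trapezoid_bounds v h u : 0 < h -> 0 <= u -> 0 <= v -> 0 <= trapezoid v h u <= 1.
Proof.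
move=> h0 u0 v0; case: (Rle_lt_dec u v) => uv; first by rewrite trapezoid_1; lra.
case: (Rle_lt_dec (v + h) u) => uh; first by rewrite trapezoid_0; lra.
have -> : trapezoid v h u = (v + h - u) / h.
  rewrite /trapezoid (Rabs_pos_eq (u + h)) ?(Rabs_pos_eq u) ?(Rabs_pos_eq (u - v)); try lra.
  by rewrite (Rabs_left1 (u - v - h)); try lra; field; lra.
split; first by apply: Rdiv_le_0_compat; lra.
by apply: (Rmult_le_reg_r h) => //; rewrite /Rdiv Rmult_assoc Rinv_l; lra.
Qed.

(** For fixed [x], first [T] tends to infinity with [N'] fixed, then [N'] does. The smoothed sum
    does not change with [N'], while the truncation error [tau] of the two Dirichlet series
    vanishes, although its constant [M] blows up as [x] tends to 1. *)
Lemma smooth_bound : exists d C, [/\ 0 < d <= 1, 0 < C &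
  forall x v h N, 1 < x <= 1 + d -> 0 <= v -> 0 < h <= 1 -> v + h <= ln (INR N) ->
  Rabs (rsum (fun n => weight x n * trapezoid v h (ln (INR n))) N) <= C * (v + / h)].
Proof.
have [d [C [d01 C0 HD]]] := D2_bound.
have [c [c0 Hc]] := trap_int_approx.
(* The limit gives [2 * C * (h * (v + h) + 8)], at most [2 * C * 9 * (h * v + 1)] for [h <= 1], to
   be divided by [2 * h * c]. *)
exists d, (9 * C / c); split=> //; first by apply: Rdiv_lt_0_compat; lra.
move=> x v h N x1 v0 h01 vN.
have ih : 1 <= / h by rewrite -Rinv_1; apply: Rinv_le_contravar; lra.
pose a := (x - 1) / 2; have a0 : 0 < a by rewrite /a; lra.
have sx t : 1 + 2 * a <= Re (x, t) by rewrite /a /Re /=; lra.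
pose M := (ln_const 3 a + ln_const 2 a) / a.
set S := rsum _ N.
have SN N' : (N <= N')%N -> rsum (fun n => weight x n * trapezoid v h (ln (INR n))) N' = S.
  move=> NN'; rewrite -(subnKC NN'); elim: (N' - N)%N => [|k IH]; first by rewrite addn0.
  rewrite addnS rsumS IH trapezoid_0 ?Rmult_0_r ?Rplus_0_r //; first by lra.
  apply: Rle_trans vN _; case: (posnP N) => [->|N0]; last first.
    by apply: ln_le; [exact: INR_gt0 | apply: INR_leq; rewrite leqW // leq_addr].
  apply: Rle_trans (ln_INR_ge0 _); rewrite /= /ln; case: Rlt_dec => [q|_] /=; [case: (Rlt_irrefl _ q) | lra].
have main N' : (N < N')%N ->
    c * (2 * h) * Rabs S <= 2 * C * (h * (v + h) + 8) + M * (h * (v + h) + 8) * Rpower (INR N') (- a).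
  move=> NN'; have N'0 : (0 < N')%N by apply: leq_ltn_trans NN'.
  have [W hW] := rsum_approx (weight x) N' (fun n => Hc v h (ln (INR n)) (proj1 h01)).
  apply: (@le_of_le_div _ _ W) => T T1.
  have iT : 0 < / T < 1 by split; [apply: Rinv_0_lt_compat | rewrite -Rinv_1; apply: Rinv_lt_contravar]; lra.
  set tau := M * Rpower (INR N') (- a).
  have tau_le t : 0 < t -> Cmod (csum (fun n => vterm 2 (x, t) n - zterm 2 (x, t) n)%C N') <= C * sqrt (t + 2) + tau.
    move=> t0; rewrite csum_sub.
    have b1 := dominated_cinf a0 (dominated_vterm 2 a0 (sx t)) N'0.
    have b2 := dominated_cinf a0 (dominated_zterm 2 a0 (sx t)) N'0.
    have b3 := HD (x, t); rewrite [Re _]/= [Im _]/= in b3; have {}b3 := b3 x1 t0.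
    rewrite -/(V 2 (x, t)) in b1; rewrite -/(Z 2 (x, t)) in b2.
    have -> : (csum (vterm 2 (x, t)) N' - csum (zterm 2 (x, t)) N' =
      (V 2 (x, t) - Z 2 (x, t)) - ((V 2 (x, t) - csum (vterm 2 (x, t)) N') - (Z 2 (x, t) - csum (zterm 2 (x, t)) N')))%C by ring.
    apply: Rle_trans (Cmod_sub_le _ _) _; apply: Rplus_le_compat => //.
    apply: Rle_trans (Cmod_sub_le _ _) _.
    by rewrite /tau /M /Rdiv !Rmult_plus_distr_r; apply: Rplus_le_compat.
  have tau0 : 0 <= tau.
    apply: Rmult_le_pos; last exact: Rlt_le (Rpower_gt0 _ _).
    apply: Rdiv_le_0_compat => //; apply: Rplus_le_le_0_compat; apply: pow_le;
      by apply: Rdiv_le_0_compat => //; exact: pos_INR.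
  pose F t := rsum (fun n => weight x n * trap_kernel v h (ln (INR n)) t) N'.
  have FE t : 0 < t -> Rabs (F t) <= Cmod (trap_phase v h t) * (C * sqrt (t + 2) + tau) * / t ^ 2.
    move=> t0; have t2 : 0 < / t ^ 2 by apply: Rinv_0_lt_compat; apply: pow_lt.
    have -> : F t = / t ^ 2 * Re (trap_phase v h t * csum (fun n => vterm 2 (x, t) n - zterm 2 (x, t) n) N')%C.
      rewrite -csum_scal Re_csum -rsum_scal; apply: rsum_eq => n _.
      by rewrite weight_kernel // Rmult_comm.
    rewrite Rabs_mult (Rabs_pos_eq (/ _)); last by lra.
    rewrite Rmult_comm; apply: Rmult_le_compat_r; first by lra.
    apply: Rle_trans (re_le_Cmod _) _; rewrite Cmod_mult.
    by apply: Rmult_le_compat_l; [exact: Cmod_ge_0 | exact: tau_le].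
  have FI : is_RInt F (/ T) T (rsum (fun n => weight x n * trap_int v h (ln (INR n)) (/ T) T) N').
    apply: is_RInt_rsum => n _; apply: is_RInt_scal; apply: is_RInt_trap_kernel; lra.
  (* [sqrt (t + 2)] is at most 2 for [t <= 1] and at most [2 * sqrt t] beyond. *)
  pose P := 2 * C + tau.
  have P0 : 0 <= P by rewrite /P; lra.
  have := @trap_integral_bound F T _ (h * (v + h) * P) (4 * P) T1 _ _ FI.
  have hvh : 0 <= h * (v + h) by nra.
  move=> /(_ ltac:(nra) ltac:(lra)) bI.
  have {bI}bI := bI _ _.
  have l1 : Rabs (rsum (fun n => weight x n * trap_int v h (ln (INR n)) (/ T) T) N') <= h * (v + h) * P + 2 * (4 * P).
    apply: bI => t ht.
      have t0 : 0 < t by lra.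
      apply: Rle_trans (FE t t0) _; have [_ b] := trap_phase_le v0 (proj1 h01) t0.
      have s2 : sqrt (t + 2) <= 2.
        by rewrite -[X in _ <= X](sqrt_square 2); [apply: sqrt_le_1_alt; lra | lra].
      have i2 : 0 < / t ^ 2 by apply: Rinv_0_lt_compat; apply: pow_lt.
      apply: Rle_trans (_ : h * (v + h) * t ^ 2 * P * / t ^ 2 <= _).
        apply: Rmult_le_compat_r; first by lra.
        apply: Rmult_le_compat => //; first exact: Cmod_ge_0.
          by have := sqrt_pos (t + 2); nra.
        by have := sqrt_pos (t + 2); rewrite /P; nra.
      by right; field; lra.
    have t0 : 0 < t by lra.
    apply: Rle_trans (FE t t0) _; have [b _] := trap_phase_le v0 (proj1 h01) t0.
    have st : 1 <= sqrt t by rewrite -sqrt_1; apply: sqrt_le_1_alt.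
    have s2 : sqrt (t + 2) <= 2 * sqrt t.
      rewrite -[X in X * _](sqrt_square 2); last by lra.
      by rewrite -sqrt_mult_alt; [apply: sqrt_le_1_alt; lra | lra].
    have i2 : 0 < / t ^ 2 by apply: Rinv_0_lt_compat; apply: pow_lt.
    apply: Rle_trans (_ : 4 * (P * sqrt t) * / t ^ 2 <= _).
      apply: Rmult_le_compat_r; first by lra.
      apply: Rmult_le_compat => //; first exact: Cmod_ge_0.
        by have := sqrt_pos (t + 2); nra.
      have := Rmult_le_compat_l _ _ _ (Rlt_le _ _ C0) s2; rewrite /P; nra.
    right; rewrite [in / t ^ 2](_ : t = sqrt t * sqrt t); last by rewrite sqrt_sqrt; lra.
    rewrite -[X in / (X * sqrt t)](sqrt_sqrt t); last by lra.
    by field; lra.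
  have l2 := hW T T1.
  have E : rsum (fun n => weight x n * (c * (2 * h * trapezoid v h (ln (INR n))))) N' = c * (2 * h) * S.
    by rewrite -(SN N' (ltnW NN')) -rsum_scal; apply: rsum_eq => n _; ring.
  rewrite E in l2.
  have -> : c * (2 * h) * Rabs S = Rabs (c * (2 * h) * S).
    by rewrite Rabs_mult (Rabs_pos_eq (c * _)) //; nra.
  have -> : 2 * C * (h * (v + h) + 8) + M * (h * (v + h) + 8) * Rpower (INR N') (- a) =
    h * (v + h) * P + 2 * (4 * P) by rewrite /P /tau; ring.
  move: l1 l2; split_Rabs; lra.
have := le_of_le_rate a0 main.
have ch : 0 < c * (2 * h) by apply: Rmult_lt_0_compat; lra.
move=> HS; apply: (Rmult_le_reg_l (c * (2 * h))) => //; apply: Rle_trans HS _.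
have -> : c * (2 * h) * (9 * C / c * (v + / h)) = 2 * C * (9 * (h * v + 1)) by field; lra.
apply: Rmult_le_compat_l; first by lra.
by nra.
Qed.

Lemma ex_derive_rsum (f : nat -> R -> R) N x :
  (forall n, ex_derive (f n) x) -> ex_derive (fun y => rsum (fun n => f n y) N) x.
Proof.
move=> H; elim: N => [|N IH].
  by apply: ex_derive_ext (@ex_derive_const _ R_NormedModule 0 x) => y; rewrite rsum0.
apply: ex_derive_ext (ex_derive_plus _ _ _ IH (H N.+1)) => y.
by rewrite rsumS.
Qed.

Lemma continuous_le_right (f : R -> R) x d B : 0 < d -> continuous f x ->
  (forall y, x < y <= x + d -> Rabs (f y) <= B) -> Rabs (f x) <= B.
Proof.
move=> d0 cf H; apply: le_epsilon => e e0.
have /(_ (ball (f x) (mkposreal _ e0))) := cf.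
move=> /(_ (locally_ball _ _)) [r hr].
pose y := x + Rmin (r / 2) d.
have r0 := cond_pos r.
have m0 : 0 < Rmin (r / 2) d by apply: Rmin_pos; lra.
have m1 := Rmin_l (r / 2) d; have m2 := Rmin_r (r / 2) d.
have : ball x r y.
  rewrite /ball /= /AbsRing_ball /abs /= /minus /plus /opp /= /y.
  by rewrite (_ : x + _ + - x = Rmin (r / 2) d); [rewrite Rabs_pos_eq; lra | ring].
move=> /hr; rewrite /ball /= /AbsRing_ball /abs /= /minus /plus /opp /= => h1.
have := H y ltac:(rewrite /y; lra); move: h1; split_Rabs; lra.
Qed.

(** The sum is finite and its bound is independent of [x], so continuity from the right reaches
    [x = 1]; zeta on the line itself does not enter. *)
Lemma smooth_bound1 : exists C, 0 < C /\
  forall v h N, 0 <= v -> 0 < h <= 1 -> v + h <= ln (INR N) ->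
  Rabs (rsum (fun n => weight 1 n * trapezoid v h (ln (INR n))) N) <= C * (v + / h).
Proof.
have [d [C [d01 C0 H]]] := smooth_bound; exists C; split=> // v h N v0 h0 vN.
apply: (@continuous_le_right (fun x => rsum (fun n => weight x n * trapezoid v h (ln (INR n))) N) 1 d).
- by lra.
- apply: ex_derive_continuous; apply: ex_derive_rsum => n.
  by rewrite /weight /Rpower; auto_derive.
by move=> x hx; apply: H.
Qed.

(** * Removal of the smoothing *)

Definition log_weight (n : nat) : R := ln (INR n) ^ 2 * Rpower (INR n) (- (1)).

Lemma log_weight_ge0 n : 0 <= log_weight n.
Proof. by apply: Rmult_le_pos; [exact: pow2_ge_0 | exact: Rlt_le (Rpower_gt0 _ _)]. Qed.

Lemma log_weightE n : (0 < n)%N -> log_weight n = ln (INR n) ^ 2 / INR n.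
Proof. by move=> n0; rewrite /log_weight Rpower_Ropp Rpower_1 //; exact: INR_gt0. Qed.

Lemma weight1E n : weight 1 n = vonMangoldt n * log_weight n - log_weight n.
Proof. by rewrite /weight /log_weight; ring. Qed.

Lemma rsum_interval_le u M N B : (M <= N)%N ->
  (forall n, (M < n <= N)%N -> u n <= B) -> rsum u N - rsum u M <= (INR N - INR M) * B.
Proof.
move=> MN; rewrite -(subnKC MN); elim: (N - M)%N => [|k IH] H; first by rewrite addn0; lra.
rewrite addnS rsumS S_INR.
have h1 : u (M + k).+1 <= B by apply: H; rewrite addnS ltnS leq_addr leqnn.
have h2 : rsum u (M + k) - rsum u M <= (INR (M + k) - INR M) * B.
  by apply: IH => n /andP[n1 n2]; apply: H; rewrite n1 addnS leqW.
by lra.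
Qed.

Lemma rsum_mono u M N : (M <= N)%N -> (forall n, 0 <= u n) -> rsum u M <= rsum u N.
Proof.
move=> MN u0; rewrite -(subnKC MN); elim: (N - M)%N => [|k IH]; first by rewrite addn0; lra.
by rewrite addnS rsumS; have := u0 (M + k).+1; lra.
Qed.

Lemma ln3_ge1 : 1 <= ln 3.
Proof. by rewrite -[X in X <= _](ln_exp 1); apply: ln_le; [exact: exp_pos | exact: exp_le_3]. Qed.

Lemma tauberian_upper : exists C, 0 < C /\ forall N, (9 <= N)%N ->
  rsum (fun n => vonMangoldt n * log_weight n) N - rsum log_weight N <= C * ln (INR N).
Proof.
have [C [C0 H]] := smooth_bound1; exists (64 + 2 * C); split; first by lra.
move=> N N9; have N9' : 9 <= INR N by have := INR_leq N9; rewrite [INR 9]INR_IZR_INZ.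
set v := ln (INR N).
have v1 : 1 <= v by apply: Rle_trans ln3_ge1 _; apply: ln_le; lra.
pose h := / v; have h0 : 0 < h <= 1.
  by split; [apply: Rinv_0_lt_compat; lra | rewrite -Rinv_1; apply: Rinv_le_contravar; lra].
have hv : h * v = 1 by rewrite /h Rinv_l; lra.
(* [exp h <= 1 + 3 * h] for [h <= 1], so [N2] lies past the end of the edge. *)
have [N2 [hN2 hN2']] := @nat_ceil (INR N * (1 + 3 * h)) ltac:(nra).
have NN2 : (N <= N2)%N by apply/leP/INR_le; nra.
have eh : exp h <= 1 + 3 * h.
  have e1 := exp_ineq1_le (- h); have e2 : exp h * exp (- h) = 1 by rewrite -exp_plus Rplus_opp_r exp_0.
  have e3 : exp h <= 3 by apply: Rle_trans exp_le_3; apply: exp_le; lra.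
  have := exp_pos h; nra.
have vh : v + h <= ln (INR N2).
  rewrite -[h]ln_exp -ln_mult; [|lra|exact: exp_pos].
  apply: ln_le; first by have := exp_pos h; nra.
  by apply: Rle_trans hN2; apply: Rmult_le_compat_l; lra.
have S := H v h N2 ltac:(lra) h0 vh; rewrite Rinv_inv in S.
set g := trapezoid v h in S.
have g1 n : (0 < n <= N)%N -> g (ln (INR n)) = 1.
  move=> /andP[n0 nN]; apply: trapezoid_1; first by lra.
  by split; [exact: ln_INR_ge0 | apply: ln_le; [exact: INR_gt0 | exact: INR_leq]].
have g01 n : 0 <= g (ln (INR n)) <= 1.
  by apply: trapezoid_bounds; [lra | exact: ln_INR_ge0 | lra].
pose A n := vonMangoldt n * log_weight n * g (ln (INR n)).
pose L n := log_weight n * g (ln (INR n)).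
have SE : rsum (fun n => weight 1 n * g (ln (INR n))) N2 = rsum A N2 - rsum L N2.
  by rewrite -rsum_minus; apply: rsum_eq => n _; rewrite weight1E /A /L; ring.
have h1 : rsum (fun n => vonMangoldt n * log_weight n) N <= rsum A N2.
  have -> : rsum (fun n => vonMangoldt n * log_weight n) N = rsum A N.
    by apply: rsum_eq => n hn; rewrite /A g1 // Rmult_1_r.
  apply: rsum_mono => // n.
  by apply: Rmult_le_pos; [apply: Rmult_le_pos; [exact: vonMangoldt_ge0 | exact: log_weight_ge0] | apply g01].
have h2 : rsum L N2 - rsum log_weight N <= 64 * v.
  have -> : rsum log_weight N = rsum L N.
    by apply: rsum_eq => n hn; rewrite /L g1 // Rmult_1_r.
  apply: Rle_trans (_ : (INR N2 - INR N) * (16 * v ^ 2 / INR N) <= _).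
    apply: rsum_interval_le => // n /andP[Nn nN2].
    have n0 : (0 < n)%N by apply: leq_ltn_trans Nn.
    apply: Rle_trans (_ : log_weight n <= _).
      by rewrite /L; have := g01 n; have := log_weight_ge0 n; nra.
    rewrite log_weightE // /Rdiv; apply: Rmult_le_compat.
    + exact: pow2_ge_0.
    + by left; apply: Rinv_0_lt_compat; exact: INR_gt0.
    + rewrite (_ : 16 * v ^ 2 = (4 * v) ^ 2); last by ring.
      apply: pow_incr; split; first exact: ln_INR_ge0.
      apply: Rle_trans (_ : ln (INR N * (3 ^ 3)) <= _).
        apply: ln_le; first exact: INR_gt0.
        by apply: Rle_trans (INR_leq nN2) _; nra.
      rewrite ln_mult; [|lra|lra]; rewrite ln_pow; last by lra.
      have : ln 3 <= v by apply: ln_le; lra.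
      by rewrite -/v (_ : INR 3 = 3); [lra | rewrite INR_IZR_INZ].
    by apply: Rinv_le_contravar; [lra | apply: INR_leq; exact: ltnW].
  have vN : v <= INR N - 1 by apply: ln_le_sub1; lra.
  apply: Rle_trans (_ : (3 * h * INR N + 1) * (16 * v ^ 2 / INR N) <= _).
    by apply: Rmult_le_compat_r; [apply: Rdiv_le_0_compat; nra | nra].
  have -> : (3 * h * INR N + 1) * (16 * v ^ 2 / INR N) = 48 * (h * v) * v + 16 * v * (v / INR N) by field; lra.
  have : v / INR N <= 1 by apply: (Rmult_le_reg_r (INR N)); [lra | rewrite /Rdiv Rmult_assoc Rinv_l; lra].
  rewrite hv; nra.
rewrite SE in S; move: S => /Rabs_le_between; lra.
Qed.

(** Now the edge ends at [ln N], so the trapezoid is at most the indicator. [9 = 3 ^ 2] ensures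
    [v >= 2], hence [h <= / 2], and the integers on the edge exceed [N / 2]. *)
Lemma tauberian_lower : exists C, 0 < C /\ forall N, (9 <= N)%N ->
  - (C * ln (INR N)) <= rsum (fun n => vonMangoldt n * log_weight n) N - rsum log_weight N.
Proof.
have [C [C0 H]] := smooth_bound1; exists (4 + 2 * C); split; first by lra.
move=> N N9; have N9' : 9 <= INR N by have := INR_leq N9; rewrite [INR 9]INR_IZR_INZ.
set v := ln (INR N).
have v2 : 2 <= v.
  have := ln3_ge1; have : ln (3 ^ 2) <= v by apply: ln_le; lra.
  by rewrite ln_pow; [rewrite /=; lra | lra].
pose h := / v; have h0 : 0 < h <= / 2.
  by split; [apply: Rinv_0_lt_compat; lra | apply: Rinv_le_contravar; lra].
have hv : h * v = 1 by rewrite /h Rinv_l; lra.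
have [N1' [hN1 hN1']] := @nat_ceil (INR N * (1 - h)) ltac:(nra).
(* The predecessor of the rounded-up value is at most [N * (1 - h) <= N * exp (- h)], so up to [N1]
   the trapezoid is 1. *)
pose N1 := N1'.-1.
have N1'0 : (0 < N1')%N by apply/ltP/INR_lt; rewrite [INR 0]/(0); nra.
have N1E : INR N1 = INR N1' - 1 by rewrite -[N1' in RHS](prednK N1'0) S_INR -/N1; ring.
have NN1 : (N1 <= N)%N by apply/leP/INR_le; nra.
have S := H (v - h) h N ltac:(lra) ltac:(lra) ltac:(rewrite /v; lra); rewrite Rinv_inv in S.
set g := trapezoid (v - h) h in S.
have g1 n : (0 < n <= N1)%N -> g (ln (INR n)) = 1.
  move=> /andP[n0 nN]; apply: trapezoid_1; first by lra.
  split; first exact: ln_INR_ge0.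
  have -> : v - h = ln (INR N * exp (- h)) by rewrite ln_mult ?ln_exp; [|lra|exact: exp_pos].
  apply: ln_le; first exact: INR_gt0.
  apply: Rle_trans (INR_leq nN) _; have := exp_ineq1_le (- h); nra.
have g01 n : 0 <= g (ln (INR n)) <= 1.
  by apply: trapezoid_bounds; [lra | exact: ln_INR_ge0 | lra].
pose A n := vonMangoldt n * log_weight n * g (ln (INR n)).
pose L n := log_weight n * g (ln (INR n)).
have SE : rsum (fun n => weight 1 n * g (ln (INR n))) N = rsum A N - rsum L N.
  by rewrite -rsum_minus; apply: rsum_eq => n _; rewrite weight1E /A /L; ring.
have h1 : rsum A N <= rsum (fun n => vonMangoldt n * log_weight n) N.
  apply: rsum_le => n _; rewrite /A; have := g01 n.
  have : 0 <= vonMangoldt n * log_weight n by apply: Rmult_le_pos; [exact: vonMangoldt_ge0 | exact: log_weight_ge0].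
  by nra.
have h2 : rsum log_weight N - rsum L N <= 4 * v.
  have -> : rsum log_weight N - rsum L N = rsum (fun n => log_weight n - L n) N - rsum (fun n => log_weight n - L n) N1.
    rewrite !rsum_minus (_ : rsum L N1 = rsum log_weight N1); first by ring.
    by apply: rsum_eq => n hn; rewrite /L g1 // Rmult_1_r.
  apply: Rle_trans (_ : (INR N - INR N1) * (2 * v ^ 2 / INR N) <= _).
    apply: rsum_interval_le => // n /andP[Nn nN2].
    have n0 : (0 < n)%N by apply: leq_ltn_trans Nn.
    have nN' : INR N / 2 <= INR n.
      have : INR N1 + 1 <= INR n by rewrite -S_INR; apply: INR_leq.
      nra.
    apply: Rle_trans (_ : log_weight n <= _).
      by rewrite /L; have := g01 n; have := log_weight_ge0 n; nra.
    rewrite log_weightE //; apply: Rle_trans (_ : v ^ 2 * / (INR N / 2) <= _); last by right; field; lra.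
    apply: Rmult_le_compat.
    + exact: pow2_ge_0.
    + by left; apply: Rinv_0_lt_compat; exact: INR_gt0.
    + apply: pow_incr; split; first exact: ln_INR_ge0.
      by apply: ln_le; [exact: INR_gt0 | exact: INR_leq].
    by apply: Rinv_le_contravar; lra.
  have vN : v <= INR N - 1 by apply: ln_le_sub1; lra.
  apply: Rle_trans (_ : (h * INR N + 1) * (2 * v ^ 2 / INR N) <= _).
    by apply: Rmult_le_compat_r; [apply: Rdiv_le_0_compat; nra | nra].
  have -> : (h * INR N + 1) * (2 * v ^ 2 / INR N) = 2 * (h * v) * v + 2 * v * (v / INR N) by field; lra.
  have : v / INR N <= 1 by apply: (Rmult_le_reg_r (INR N)); [lra | rewrite /Rdiv Rmult_assoc Rinv_l; lra].
  rewrite hv; nra.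
rewrite SE in S; move: S => /Rabs_le_between; nra.
Qed.

Lemma tauberian : exists C, 0 < C /\ forall N, (0 < N)%N ->
  Rabs (rsum (weight 1) N) <= C * (1 + ln (INR N)).
Proof.
have [C [C0 H]] := tauberian_upper; have [D [D0 H']] := tauberian_lower.
pose K := rsum (fun n => Rabs (weight 1 n)) 9.
have K0 : 0 <= K by apply: rsum_ge0 => n _; exact: Rabs_pos.
exists (C + D + K); split; first by lra.
move=> N N0; have l0 := ln_INR_ge0 N.
case: (leqP 9 N) => N9.
  have -> : rsum (weight 1) N = rsum (fun n => vonMangoldt n * log_weight n) N - rsum log_weight N.
    by rewrite -rsum_minus; apply: rsum_eq => n _; rewrite weight1E.
  apply/Rabs_le_between; have := H N N9; have := H' N N9; nra.
have : rsum (fun n => Rabs (weight 1 n)) N <= K.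
  by apply: rsum_mono (ltnW N9) _ => n; exact: Rabs_pos.
have := rsum_abs (weight 1) N; nra.
Qed.

Lemma ln_INR_ge_half n : (1 < n)%N -> / 2 < ln (INR n).
Proof.
move=> n1; apply: Rlt_le_trans ln_lt_2 _; apply: ln_le; first by lra.
exact: (INR_leq n1).
Qed.

Lemma ln_succ_bounds n x : (0 < n)%N -> INR n <= x <= INR n.+1 ->
  ln (INR n) <= ln x <= ln (INR n.+1).
Proof. by move=> n0 hx; have := INR_gt0 n0; split; apply: ln_le; lra. Qed.

Lemma mvt_succ (f f' : R -> R) n : (1 < n)%N ->
  (forall x, 1 < x -> is_derive f x (f' x)) ->
  exists x, INR n <= x <= INR n.+1 /\ f (INR n.+1) - f (INR n) = f' x.
Proof.
move=> n1 df; have n2 : 2 <= INR n by exact: (INR_leq n1).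
have nn : INR n <= INR n.+1 by rewrite S_INR; lra.
have [|y hy|c [hc E]] := @MVT_gen f (INR n) (INR n.+1) f'.
- by move=> y; rewrite Rmin_left // Rmax_right // => hy; apply: df; lra.
- apply/continuity_pt_filterlim/ex_derive_continuous; exists (f' y); apply: df.
  by move: hy; rewrite Rmin_left // Rmax_right //; lra.
rewrite Rmin_left // Rmax_right // in hc; exists c; split=> //.
by rewrite E S_INR; ring.
Qed.

Lemma ln_gt0 x : 1 < x -> 0 < ln x.
Proof. by move=> x1; rewrite -ln_1; apply: ln_increasing; lra. Qed.

(** * Partial summation *)

Definition inv_log_sqr (n : nat) : R := / ln (INR n) ^ 2.

Lemma inv_log_sqr_ge0 n : 0 <= inv_log_sqr n.
Proof.
rewrite /inv_log_sqr; have [->|h] := Req_dec (ln (INR n) ^ 2) 0; first by rewrite Rinv_0; lra.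
by left; apply: Rinv_0_lt_compat; have := pow2_ge_0 (ln (INR n)); lra.
Qed.

(* [ln 1 = 0] and [/ 0 = 0]. *)
Lemma inv_log_sqr1 : inv_log_sqr 1 = 0.
Proof. by rewrite /inv_log_sqr ln_1 pow_i ?Rinv_0 //; apply/ltP. Qed.

(** Lets additive constants be absorbed into the error term for every [N > 1]. *)
Lemma main_term_ge N : (1 < N)%N -> / 4 <= INR N / ln (INR N) ^ 2.
Proof.
move=> N1; have l1 := ln_INR_ge_half N1; have N2 : 2 <= INR N by exact: (INR_leq N1).
have h := @ln_le_Rpower (INR N) (/ 2) ltac:(lra) ltac:(lra).
rewrite Rpower_sqrt ?Rinv_inv in h; last by lra.
have s := sqrt_sqrt (INR N) ltac:(lra); have sp := sqrt_pos (INR N).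
have l2 : 0 < ln (INR N) ^ 2 by apply: pow_lt; lra.
apply: (Rmult_le_reg_r (ln (INR N) ^ 2)) => //.
rewrite /Rdiv Rmult_assoc Rinv_l ?Rmult_1_r; [nra | lra].
Qed.

Lemma sum_inv_log_sqr : exists K, 0 < K /\ forall N, (1 < N)%N ->
  rsum inv_log_sqr N <= K * (INR N / ln (INR N) ^ 2).
Proof.
(* Up to 81 the sum is at most [81 * 4 = 324 <= 1300 / 4]. From [81 = 3 ^ 4] on, [ln x >= 4] makes
   the derivative of [x / ln x ^ 2] at least half of [/ ln x ^ 2], which suffices for the
   induction. *)
exists 1300; split; first by lra.
elim=> [//|N IH] N1; case: (leqP N.+1 81) => N81.
  have h4 := main_term_ge N1.
  apply: Rle_trans (_ : 1300 * / 4 <= _); last by apply: Rmult_le_compat_l; lra.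
  apply: Rle_trans (_ : rsum (fun=> 4) N.+1 <= _).
    apply: rsum_le => -[//|[|n]] _; first by rewrite inv_log_sqr1; lra.
    have l1 := @ln_INR_ge_half n.+2 isT.
    rewrite /inv_log_sqr -[4]Rinv_inv; apply: Rinv_le_contravar; nra.
  have -> : rsum (fun=> 4) N.+1 = 4 * INR N.+1.
    by elim: N.+1 => [|k E]; rewrite ?rsum0 ?rsumS ?E ?S_INR; [rewrite /=; lra | lra].
  have := INR_leq N81; rewrite [INR 81]INR_IZR_INZ [IZR _]/= ; lra.
have N1' : (1 < N)%N by rewrite ltnS in N81; apply: leq_trans N81.
have {}IH := IH N1'; rewrite rsumS.
have df x : 1 < x -> is_derive (fun x => x / ln x ^ 2) x ((1 - 2 / ln x) / ln x ^ 2).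
  move=> x1; have l0 := ln_gt0 x1.
  auto_derive; first by split; [lra|split=> //; apply: Rgt_not_eq; nra].
  by field; lra.
have [x [hx E]] := mvt_succ N1' df.
have [l1 l2] := ln_succ_bounds (ltnW N1') hx.
have l4 : 4 <= ln (INR N).
  have h : ln (3 ^ 4) <= ln (INR N).
    apply: ln_le; first by lra.
    by have := @INR_leq 81 N N81; rewrite [INR 81]INR_IZR_INZ [IZR _]/=; lra.
  rewrite ln_pow in h; last by lra.
  by have := ln3_ge1; move: h; rewrite [INR 4]INR_IZR_INZ [IZR _]/=; lra.
have h1 : inv_log_sqr N.+1 <= / ln x ^ 2.
  by rewrite /inv_log_sqr; apply: Rinv_le_contravar; [apply: pow_lt; lra | apply: pow_incr; lra].
have h2 : / 2 <= 1 - 2 / ln x.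
  have : / ln x <= / 4 by apply: Rinv_le_contravar; lra.
  by rewrite /Rdiv; lra.
have h3 : 0 < / ln x ^ 2 by apply: Rinv_0_lt_compat; apply: pow_lt; lra.
rewrite /Rdiv in E IH *; nra.
Qed.

(** The increment of [x / ln x] is [/ ln x - / ln x ^ 2] at an intermediate point, so each step adds
    an error of at most [2 / ln n ^ 2]; these add up by [sum_inv_log_sqr]. *)
Lemma sum_inv_log : exists K, 0 < K /\ forall N, (1 < N)%N ->
  Rabs (rsum (fun n => / ln (INR n)) N - INR N / ln (INR N)) <= K * (INR N / ln (INR N) ^ 2).
Proof.
have [K [K0 H]] := sum_inv_log_sqr; exists (2 * K + 8); split; first by lra.
suff main N : (0 < N)%N ->
    Rabs (rsum (fun n => / ln (INR n)) N.+1 - INR N.+1 / ln (INR N.+1)) <= 2 + 2 * rsum inv_log_sqr N.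
  move=> [//|N] N1; have := main N N1; have := H _ N1; have := main_term_ge N1.
  by rewrite rsumS; have := inv_log_sqr_ge0 N.+1; lra.
elim: N => [//|[|N] IH] _.
  rewrite !rsumS !rsum0 inv_log_sqr1 ln_1 Rinv_0 -[INR 2]/2.
  have l2 := ln_lt_2; have : 0 < / ln 2 by apply: Rinv_0_lt_compat; lra.
  have : / ln 2 <= 2 by rewrite -[X in _ <= X]Rinv_inv; apply: Rinv_le_contravar; lra.
  by rewrite /Rdiv => h1 h2; rewrite Rabs_left1; lra.
have {}IH := IH isT; have N1 : (1 < N.+2)%N by [].
rewrite rsumS [rsum inv_log_sqr N.+2]rsumS.
have df x : 1 < x -> is_derive (fun x => x / ln x) x (/ ln x - / ln x ^ 2).
  move=> x1; have l0 := ln_gt0 x1; auto_derive; first by split; lra.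
  by field; lra.
have [x [hx E]] := mvt_succ N1 df.
have [l1 l2] := ln_succ_bounds (ltnW N1) hx.
have lN := ln_INR_ge_half N1.
have d1 : ln (INR N.+3) - ln (INR N.+2) <= 1.
  have n2 : 2 <= INR N.+2 by exact: (INR_leq N1).
  rewrite -ln_div; [|rewrite [INR N.+3]S_INR; lra|lra].
  apply: Rle_trans (ln_le_sub1 _) _; first by apply: Rdiv_lt_0_compat; rewrite ?[INR N.+3]S_INR; lra.
  have : / INR N.+2 <= 1 by rewrite -[X in _ <= X]Rinv_1; apply: Rinv_le_contravar; lra.
  by rewrite [INR N.+3]S_INR /Rdiv Rmult_plus_distr_r Rinv_r; lra.
set a := ln (INR N.+2) in l1 lN d1 E IH; set b := ln (INR N.+3) in l2 d1 E *; set y := ln x in E l1 l2.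
have i1 : / b <= / y by apply: Rinv_le_contravar; lra.
have i2 : / y <= / a by apply: Rinv_le_contravar; lra.
have i3 : / y ^ 2 <= / a ^ 2 by apply: Rinv_le_contravar; [apply: pow_lt; lra | apply: pow_incr; lra].
have i4 : / a - / b <= / a ^ 2.
  have -> : / a - / b = (b - a) * (/ a * / b) by field; lra.
  have ib : / b <= / a by apply: Rinv_le_contravar; lra.
  have ia : 0 < / b by apply: Rinv_0_lt_compat; lra.
  have iaa : 0 < / a by lra.
  rewrite (_ : / a ^ 2 = / a * / a); last by field; lra.
  apply: Rle_trans (_ : 1 * (/ a * / b) <= _); last by nra.
  by apply: Rmult_le_compat_r; nra.
have i5 : 0 < / y ^ 2 by apply: Rinv_0_lt_compat; apply: pow_lt; lra.
have i6 : inv_log_sqr N.+2 = / a ^ 2 by [].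
have := Rabs_triang (rsum (fun n => / ln (INR n)) N.+2 - INR N.+2 / a)
  (/ b - (/ y - / y ^ 2)).
rewrite i6.
have : Rabs (/ b - (/ y - / y ^ 2)) <= 2 * / a ^ 2 by apply/Rabs_le_between; lra.
have -> : rsum (fun n => / ln (INR n)) N.+2 - INR N.+2 / a + (/ b - (/ y - / y ^ 2)) =
  rsum (fun n => / ln (INR n)) N.+2 + / b - INR N.+3 / b by rewrite -E; ring.
by lra.
Qed.

Lemma abel_summation (c f : nat -> R) N :
  rsum (fun n => c n * f n) N.+1 =
  rsum c N.+1 * f N.+1 - rsum (fun n => rsum c n * (f n.+1 - f n)) N.
Proof.
elim: N => [|N IH]; first by rewrite !rsumS !rsum0; ring.
rewrite [LHS]rsumS IH [rsum c N.+2]rsumS.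
rewrite [rsum (fun n => rsum c n * (f n.+1 - f n)) N.+1]rsumS; ring.
Qed.

(** The factor that turns [(vonMangoldt n - 1) * ln n ^ 2 / n] into [(vonMangoldt n - 1) / ln n]. *)
Definition log_density (n : nat) : R := INR n / ln (INR n) ^ 3.

Lemma log_density_step n : (1 < n)%N ->
  Rabs (log_density n.+1 - log_density n) <= 7 * / ln (INR n) ^ 3.
Proof.
move=> n1.
have df x : 1 < x -> is_derive (fun x => x / ln x ^ 3) x ((1 - 3 / ln x) / ln x ^ 3).
  move=> x1; have l0 := ln_gt0 x1.
  auto_derive; first by split; [lra|split=> //; apply: Rgt_not_eq; repeat apply: Rmult_lt_0_compat; lra].
  by field; lra.
have [x [hx E]] := mvt_succ n1 df; rewrite /log_density E.
have [l1 l2] := ln_succ_bounds (ltnW n1) hx; have lh := ln_INR_ge_half n1.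
rewrite /Rdiv Rabs_mult; apply: Rmult_le_compat; try exact: Rabs_pos.
  have : / ln x <= 2 by rewrite -[X in _ <= X]Rinv_inv; apply: Rinv_le_contravar; lra.
  have : 0 < / ln x by apply: Rinv_0_lt_compat; lra.
  by move=> *; apply/Rabs_le_between; lra.
rewrite Rabs_pos_eq; last by left; apply: Rinv_0_lt_compat; apply: pow_lt; lra.
by apply: Rinv_le_contravar; [apply: pow_lt; lra | apply: pow_incr; lra].
Qed.

Lemma weight_density n : (1 < n)%N ->
  weight 1 n * log_density n = vonMangoldt n / ln (INR n) - / ln (INR n).
Proof.
move=> n1; have n0 : (0 < n)%N by exact: ltnW.
have l := ln_INR_ge_half n1; have n0' := INR_gt0 n0.
by rewrite weight1E log_weightE // /log_density; field; split; lra.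
Qed.

Lemma sum_vonMangoldt_div_ln : exists K, 0 < K /\ forall N, (1 < N)%N ->
  Rabs (rsum (fun n => vonMangoldt n / ln (INR n)) N - INR N / ln (INR N)) <=
    K * (INR N / ln (INR N) ^ 2).
Proof.
have [C [C0 HB]] := tauberian; have [K1 [K10 H1]] := sum_inv_log.
have [K2 [K20 H2]] := sum_inv_log_sqr.
(* [1 + ln n <= 3 * ln n] for [n >= 2] gives the boundary term [3 * C]; the increments of the
   density bring the factor 7. The term at [n = 1], where [ln 1 = 0], is zero on both sides. *)
exists (3 * C + 21 * C * K2 + K1); split; first by nra.
move=> [//|N] N1.
pose c n := weight 1 n.
have c1 : c 1%N = 0.
  by rewrite /c /weight vonMangoldt_eq0 // ln_1; ring.
have B n : (1 < n)%N -> Rabs (rsum c n) <= 3 * C * ln (INR n).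
  move=> n1; apply: Rle_trans (HB n (ltnW n1)) _.
  by have := ln_INR_ge_half n1; nra.
have lN := ln_INR_ge_half N1; have N0 : 0 < INR N.+1 by apply: INR_gt0.
have E : rsum (fun n => vonMangoldt n / ln (INR n)) N.+1 - rsum (fun n => / ln (INR n)) N.+1 =
    rsum (fun n => c n * log_density n) N.+1.
  rewrite -rsum_minus; apply: rsum_eq => -[//|[|n]] _; last by rewrite /c weight_density.
  by rewrite c1 vonMangoldt_eq0 // ln_1 Rinv_0 /Rdiv; ring.
have h1 : Rabs (rsum c N.+1 * log_density N.+1) <= 3 * C * (INR N.+1 / ln (INR N.+1) ^ 2).
  rewrite Rabs_mult; apply: Rle_trans (_ : 3 * C * ln (INR N.+1) * log_density N.+1 <= _).
    have d0 : 0 <= log_density N.+1 by apply: Rdiv_le_0_compat; [lra | apply: pow_lt; lra].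
    by rewrite (Rabs_pos_eq _ d0); apply: Rmult_le_compat_r => //; exact: B.
  by right; rewrite /log_density; field; lra.
have h2 : Rabs (rsum (fun n => rsum c n * (log_density n.+1 - log_density n)) N) <=
    21 * C * rsum inv_log_sqr N.
  apply: Rle_trans (rsum_abs _ _) _; rewrite -rsum_scal; apply: rsum_le => -[//|[|n]] _.
    by rewrite rsumS rsum0 c1 Rplus_0_l Rmult_0_l Rabs_R0 inv_log_sqr1; lra.
  have n1 : (1 < n.+2)%N by [].
  have l := ln_INR_ge_half n1.
  rewrite Rabs_mult.
  apply: Rle_trans (Rmult_le_compat _ _ _ _ (Rabs_pos _) (Rabs_pos _) (B _ n1) (log_density_step n1)) _.
  by right; rewrite /inv_log_sqr; field; lra.
have h3 : rsum inv_log_sqr N <= K2 * (INR N.+1 / ln (INR N.+1) ^ 2).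
  apply: Rle_trans (H2 N.+1 N1); apply: rsum_mono => // n; exact: inv_log_sqr_ge0.
have h4 := H1 _ N1.
rewrite abel_summation in E.
have h5 : 21 * C * rsum inv_log_sqr N <= 21 * C * (K2 * (INR N.+1 / ln (INR N.+1) ^ 2)).
  by apply: Rmult_le_compat_l; lra.
move: h1 h2 h4 E => /Rabs_le_between h1 /Rabs_le_between h2 /Rabs_le_between h4 E.
by apply/Rabs_le_between; lra.
Qed.

(** * From the von Mangoldt function to the primes *)

Lemma rsum_count (P : pred nat) N : rsum (fun n => INR (P n)) N = INR (count P (seq.iota 1 N)).
Proof.
elim: N => [|N IH]; first by rewrite rsum0.
by rewrite rsumS IH -[N.+1 in RHS]addn1 iotaD count_cat /= addn0 plus_INR add1n.
Qed.

Definition proper_prime_power (n : nat) : bool := (size (primes n) == 1)%N && ~~ prime n.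

(** Such a number is [p ^ k] with [k >= 2], so [p <= sqrt N] and [k <= log_2 N]; it occurs in the
    list of all [p ^ k] over this rectangle. The constant is [3 * 4], from [r + 1 <= 3 * sqrt N] and
    [t + 1 <= 4 * ln N]. *)
Lemma count_proper_prime_power N : (1 < N)%N ->
  INR (count proper_prime_power (seq.iota 1 N)) <= 12 * (sqrt (INR N) * ln (INR N)).
Proof.
move=> N1; have N2 : 2 <= INR N by exact: (INR_leq N1).
have lN := ln_INR_ge_half N1.
have s1 : 1 <= sqrt (INR N) by rewrite -[X in X <= _]sqrt_1; apply: sqrt_le_1_alt; lra.
have [r [hr1 hr2]] := @nat_ceil (sqrt (INR N)) ltac:(lra).
pose t := trunc_log 2 N.
have ht : INR t <= 2 * ln (INR N).
  have h : ln (INR (2 ^ t)) <= ln (INR N).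
    apply: ln_le; first by apply: INR_gt0; rewrite expn_gt0.
    by apply: INR_leq; apply: trunc_logP => //; exact: ltnW.
  have E : INR (2 ^ t) = 2 ^ t.
    by elim: (t) => [|k IH] //; rewrite expnS mult_INR IH.
  rewrite E ln_pow in h; last by lra.
  by have := ln_lt_2; have := pos_INR t; nra.
have h : (count proper_prime_power (seq.iota 1 N) <= r.+1 * t.+1)%N.
  rewrite -size_filter -[r.+1](size_iota 0%N) -[t.+1](size_iota 0%N).
  rewrite -(size_allpairs (fun p k => (p ^ k)%N)).
  apply: uniq_leq_size; first by rewrite filter_uniq // iota_uniq.
  move=> n; rewrite mem_filter mem_iota => /andP[/andP[/eqP s npn] /andP[n1 nN]].
  case E: (primes n) s => [|p [|]] // _; have [nE pp] := primes1_eq E.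
  have nN' : (n <= N)%N by rewrite -ltnS.
  have k2 : (1 < logn p n)%N.
    case K: (logn p n) nE => [|[|k]] // nE.
      by move: E; rewrite nE.
    by move: npn; rewrite nE expn1 pp.
  rewrite nE; apply: (allpairs_f (fun p k => (p ^ k)%N)); rewrite mem_iota /= add0n ltnS.
    apply/leP/INR_le; apply: Rle_trans hr1.
    rewrite -(sqrt_square (INR p)); last exact: pos_INR.
    apply: sqrt_le_1_alt; rewrite -mult_INR; apply: INR_leq; apply: leq_trans nN'.
    by rewrite [leqRHS]nE -[(p * p)%coq_nat]/(p * p)%N mulnn leq_exp2l // prime_gt1.
  apply: trunc_log_max => //; apply: leq_trans nN'.
  by rewrite [leqRHS]nE leq_exp2r ?prime_gt1 // ltnW.
apply: Rle_trans (INR_leq h) _; rewrite mult_INR !S_INR.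
have r0 := pos_INR r; have t0 := pos_INR t.
apply: Rle_trans (_ : (3 * sqrt (INR N)) * (4 * ln (INR N)) <= _); last by lra.
by apply: Rmult_le_compat; lra.
Qed.

Theorem prime_number_theorem_nat : exists K, 0 < K /\ forall N, (1 < N)%N ->
  Rabs (INR (count prime (seq.iota 1 N)) - INR N / ln (INR N)) <= K * (INR N / ln (INR N) ^ 2).
Proof.
have [K [K0 H]] := sum_vonMangoldt_div_ln; exists (K + 12 * 512); split; first by lra.
move=> N N1; have N2 : 2 <= INR N by exact: (INR_leq N1).
have lN := ln_INR_ge_half N1.
pose w n := vonMangoldt n / ln (INR n) - INR (prime n).
(* On primes [vonMangoldt n / ln n] is exactly 1, so only higher powers contribute. The constant 512
   used below comes from [ln N ^ 3 <= 8 ^ 3 * sqrt N]. *)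
have wb n : (0 < n <= N)%N -> 0 <= w n <= INR (proper_prime_power n).
  move=> /andP[n0 _]; rewrite /w /proper_prime_power.
  case pn: (prime n); first last.
    rewrite /= andbT Rminus_0_r; case s: (size (primes n) == 1)%N; last first.
      by rewrite vonMangoldt_eq0 ?s // /Rdiv Rmult_0_l /=; lra.
    have n1 : (1 < n)%N by case: n n0 s {pn} => [|[|n]].
    have l := ln_INR_ge_half n1; have v := vonMangoldt_le_ln n0; have v0 := vonMangoldt_ge0 n.
    split; first by apply: Rdiv_le_0_compat; lra.
    by apply: (Rmult_le_reg_r (ln (INR n))); [lra | rewrite /Rdiv Rmult_assoc Rinv_l /=; lra].
  rewrite andbF /=; have := vonMangoldt_prime_power pn (isT : (0 < 1)%N); rewrite expn1 => ->.
  have l := ln_INR_ge_half (prime_gt1 pn).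
  by rewrite /Rdiv Rinv_r; lra.
have w0 : 0 <= rsum w N by apply: rsum_ge0 => n /wb; lra.
have w1 : rsum w N <= 12 * (sqrt (INR N) * ln (INR N)).
  apply: Rle_trans (count_proper_prime_power N1); rewrite -rsum_count.
  by apply: rsum_le => n /wb; lra.
have E : rsum w N = rsum (fun n => vonMangoldt n / ln (INR n)) N - INR (count prime (seq.iota 1 N)).
  by rewrite -rsum_count -rsum_minus.
have w2 : sqrt (INR N) * ln (INR N) <= 512 * (INR N / ln (INR N) ^ 2).
  have := @pow_ln_le 3 N (/ 2) ltac:(lra) (ltnW N1).
  rewrite Rpower_sqrt ?[INR 4]INR_IZR_INZ [IZR _]/= ; last by lra.
  have -> : (4 / / 2) ^ 3 = 512 by field.
  have s := sqrt_sqrt (INR N) ltac:(lra); have s0 := sqrt_pos (INR N).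
  have l2 : 0 < ln (INR N) ^ 2 by apply: pow_lt; lra.
  move=> h; apply: (Rmult_le_reg_r (ln (INR N) ^ 2)) => //.
  have -> : 512 * (INR N / ln (INR N) ^ 2) * ln (INR N) ^ 2 = 512 * INR N by field; lra.
  have -> : sqrt (INR N) * ln (INR N) * ln (INR N) ^ 2 = sqrt (INR N) * ln (INR N) ^ 3 by ring.
  by nra.
have := H N N1 => /Rabs_le_between h; apply/Rabs_le_between; lra.
Qed.

(** * Transfer between models of the reals *)

(* ((k + 1) / k)^(k (k + 1)) lies between e^k and e^(k + 1). *)
Definition exp_le_nat (k n : nat) : bool :=
  (k.+1 ^ (k * k.+1) <= n * k ^ (k * k.+1))%N.

Lemma INR_expn m n : INR (m ^ n) = INR m ^ n.
Proof. by elim: n => [|n IH] //; rewrite expnS mult_INR IH. Qed.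

Lemma exp_pow x n : exp x ^ n = exp (INR n * x).
Proof.
elim: n => [|n IH]; first by rewrite Rmult_0_l exp_0.
by rewrite -tech_pow_Rmult IH -exp_plus S_INR; congr exp; ring.
Qed.

(** This is [/ (k + 1) <= ln (1 + / k) <= / k] multiplied by [k * (k + 1)]. *)
Lemma succ_pow_bounds k : (0 < k)%N ->
  exp (INR k) * INR k ^ (k * k.+1) <= INR k.+1 ^ (k * k.+1) <=
  exp (INR k.+1) * INR k ^ (k * k.+1).
Proof.
move=> k0; have k0' := INR_gt0 k0; have k1' : 0 < INR k.+1 by apply: INR_gt0.
have e1 := exp_ineq1_le (/ INR k); have e2 := exp_ineq1_le (- / INR k.+1).
have E1 : exp (INR k.+1) = exp (/ INR k) ^ (k * k.+1).
  by rewrite exp_pow mult_INR; congr exp; field; lra.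
have E2 : exp (INR k) = exp (/ INR k.+1) ^ (k * k.+1).
  by rewrite exp_pow mult_INR; congr exp; field; lra.
rewrite E1 E2 -!Rpow_mult_distr; split; apply: pow_incr; split.
- by apply: Rmult_le_pos; [left; exact: exp_pos | lra].
- have -> : INR k = (1 + - / INR k.+1) * INR k.+1 by rewrite S_INR; field; rewrite -S_INR; lra.
  have h : exp (/ INR k.+1) * exp (- / INR k.+1) = 1 by rewrite -exp_plus Rplus_opp_r exp_0.
  apply: Rle_trans (_ : exp (/ INR k.+1) * exp (- / INR k.+1) * INR k.+1 <= _); last by rewrite h; lra.
  rewrite Rmult_assoc; apply: Rmult_le_compat_l; first by left; exact: exp_pos.
  by apply: Rmult_le_compat_r; lra.
- by lra.
have -> : INR k.+1 = (1 + / INR k) * INR k by rewrite S_INR; field; lra.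
by apply: Rmult_le_compat_r; lra.
Qed.

Lemma exp_le_nat_ln k n : (0 < k)%N -> (0 < n)%N ->
  exp_le_nat k n -> ~~ exp_le_nat k.+1 n -> INR k <= ln (INR n) <= INR k + 2.
Proof.
move=> k0 n0 h1 h2; have n0' := INR_gt0 n0.
have [l1 _] := succ_pow_bounds k0; have [_ u1] := succ_pow_bounds (ltn0Sn k).
split.
  rewrite -[X in X <= _]ln_exp; apply: ln_le; first exact: exp_pos.
  have p : 0 < INR k ^ (k * k.+1) by apply: pow_lt; exact: INR_gt0.
  apply: (Rmult_le_reg_r _ _ _ p); apply: Rle_trans l1 _.
  by rewrite -!INR_expn -mult_INR; apply: INR_leq.
rewrite -[X in _ <= X]ln_exp; apply: ln_le => //.
have p : 0 < INR k.+1 ^ (k.+1 * k.+2) by apply: pow_lt; exact: INR_gt0.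
apply: (Rmult_le_reg_r _ _ _ p).
have -> : INR k + 2 = INR k.+2 by rewrite !S_INR; ring.
apply: Rle_trans u1; rewrite -!INR_expn -mult_INR; apply: INR_leq.
by move: h2; rewrite /exp_le_nat -ltnNge => /ltnW.
Qed.

(** Denominators are cleared by [k ^ 2], and the absolute value is split into two inequalities to
    avoid truncated subtraction. Replacing [ln n] by [k] costs at most [2 * n / k ^ 2], whence
    [K + 2]. *)
Theorem prime_count_nat : exists C, forall n k, (1 < n)%N -> (0 < k)%N ->
  exp_le_nat k n -> ~~ exp_le_nat k.+1 n ->
  (count prime (seq.iota 1 n) * k ^ 2 <= n * k + C * n)%N /\
  (n * k <= count prime (seq.iota 1 n) * k ^ 2 + C * n)%N.
Proof.
have [K [K0 H]] := prime_number_theorem_nat.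
have [C [hC _]] := @nat_ceil (K + 2) ltac:(lra).
exists C => n k n1 k0 h1 h2; have n0 := ltnW n1.
have [l1 l2] := exp_le_nat_ln k0 n0 h1 h2.
have k1 := INR_ge1 k0; have n1' := INR_ge1 n0.
have /Rabs_le_between := H n n1.
set l := ln (INR n) in l1 l2 *; set P := INR (count _ _).
have il : 0 < / l by apply: Rinv_0_lt_compat; lra.
have ik : / l <= / INR k by apply: Rinv_le_contravar; lra.
have h3 : INR n / l ^ 2 <= INR n / INR k ^ 2.
  by apply: Rmult_le_compat_l; [lra | apply: Rinv_le_contravar; [apply: pow_lt; lra | apply: pow_incr; lra]].
have h4 : 0 <= INR n / INR k - INR n / l <= 2 * (INR n / INR k ^ 2).
  split; first by rewrite /Rdiv; nra.
  have -> : INR n / INR k - INR n / l = (l - INR k) * (INR n / INR k * / l) by field; lra.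
  have -> : INR n / INR k ^ 2 = INR n / INR k * / INR k by field; lra.
  have p : 0 <= INR n / INR k by apply: Rdiv_le_0_compat; lra.
  apply: Rmult_le_compat; try lra; first by nra.
  exact: Rmult_le_compat_l.
have h5 : K * (INR n / l ^ 2) <= K * (INR n / INR k ^ 2) by apply: Rmult_le_compat_l; lra.
move=> [h6 h7].
have q : 0 < INR k ^ 2 by apply: pow_lt; lra.
have E1 : INR n / INR k * INR k ^ 2 = INR n * INR k by field; lra.
have E2 : INR n / INR k ^ 2 * INR k ^ 2 = INR n by field; lra.
have Cn : (K + 2) * INR n <= INR C * INR n by apply: Rmult_le_compat_r; lra.
have b1 : P <= INR n / INR k + (K + 2) * (INR n / INR k ^ 2) by lra.
have b2 : INR n / INR k <= P + (K + 2) * (INR n / INR k ^ 2) by lra.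
have b3 := Rmult_le_compat_r _ _ _ (Rlt_le _ _ q) b1.
have b4 := Rmult_le_compat_r _ _ _ (Rlt_le _ _ q) b2.
rewrite [X in _ <= X]Rmult_plus_distr_r Rmult_assoc E2 in b4.
rewrite [X in _ <= X]Rmult_plus_distr_r Rmult_assoc E2 E1 in b3.
rewrite E1 in b4.
move: (INR_expn k 2); move: (k ^ 2)%N => T ET; rewrite -ET in b3 b4.
by split; apply/leP/INR_le; rewrite plus_INR !mult_INR -/P; lra.
Qed.

End RealPNT.

(* Transfer to an arbitrary [realType] *)
Require Import Defs.
From mathcomp Require Import all_boot all_order all_algebra.
From mathcomp Require Import finmap.
From mathcomp Require Import all_classical all_reals all_analysis.
From mathcomp Require Import ring lra.
Import Order.TTheory GRing.Theory Num.Theory.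
Import numFieldNormedType.Exports.
Local Open Scope classical_set_scope.
Local Open Scope ring_scope.

Lemma prime_pi_count (R : realType) (x : R) :
  prime_pi x = count prime (seq.iota 1 (Num.trunc x)).
Proof.
rewrite /prime_pi; set s := [seq p <- seq.iota 1 (Num.trunc x) | prime p].
have -> : primes_le x = [set` seq_fset tt s].
  apply/seteqP; split => p.
    move=> [pp px]; change (is_true (p \in seq_fset tt s)).
    rewrite seq_fsetE mem_filter mem_iota add1n ltnS pp prime_gt0 //=.
    by rewrite truncn_ge_nat // (le_trans _ px).
  move=> ps; have {ps} : p \in seq_fset tt s by [].
  rewrite seq_fsetE mem_filter mem_iota add1n ltnS => /andP[pp /andP[p0 px]].
  by split=> //; rewrite -(prednK p0) -truncn_gt_nat prednK.
rewrite set_fsetK size_seq_fset undup_id ?size_filter //.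
by rewrite filter_uniq // iota_uniq.
Qed.

(** The same comparison as [RealPNT.succ_pow_bounds], for the exponential of the target model; it
    ties the integer test [exp_le_nat] to the logarithm there. *)
Lemma expR_pow_bounds (R : realType) (k : nat) : (0 < k)%N ->
  expR (k%:R : R) * k%:R ^+ (k * k.+1) <= (k.+1%:R : R) ^+ (k * k.+1) <=
    expR (k.+1%:R : R) * k%:R ^+ (k * k.+1).
Proof.
move=> k0; have k0' : 0 < k%:R :> R by rewrite ltr0n.
have k1' : 0 < k.+1%:R :> R by rewrite ltr0n.
have e1 := expR_ge1Dx ((k%:R)^-1 : R); have e2 := expR_ge1Dx (- (k.+1%:R)^-1 : R).
have -> : expR k.+1%:R = expR ((k%:R)^-1) ^+ (k * k.+1) :> R.
  by rewrite -expRM_natl natrM mulrAC mulfV ?mul1r // gt_eqF.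
have -> : expR k%:R = expR ((k.+1%:R)^-1) ^+ (k * k.+1) :> R.
  by rewrite -expRM_natl natrM -mulrA mulfV ?mulr1 // gt_eqF.
rewrite -!exprMn; apply/andP; split; rewrite lerXn2r ?nnegrE ?mulr_ge0 ?expR_ge0 ?ler0n //.
  have h : expR ((k.+1%:R)^-1) * expR (- (k.+1%:R)^-1) = 1 :> R by rewrite -expRD subrr expR0.
  apply: le_trans (_ : expR ((k.+1%:R)^-1) * (expR (- (k.+1%:R)^-1) * k.+1%:R) <= _).
    apply: ler_wpM2l; first exact: expR_ge0.
    apply: le_trans (ler_wpM2r _ e2); last by rewrite ler0n.
    by rewrite mulrDl mul1r mulNr mulVf ?gt_eqF // -natr1 addrK.
  by rewrite mulrA h mul1r.
apply: le_trans (ler_wpM2r _ e1); last by rewrite ler0n.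
by rewrite mulrDl mul1r mulVf ?gt_eqF // -natr1.
Qed.

Lemma exp_le_nat_expR (R : realType) (k n : nat) : (0 < k)%N ->
  RealPNT.exp_le_nat k n -> expR k%:R <= n%:R :> R.
Proof.
move=> k0 h; have /andP[l1 _] := expR_pow_bounds R k k0.
have p : 0 < k%:R ^+ (k * k.+1) :> R by rewrite exprn_gt0 // ltr0n.
rewrite -(ler_pM2r p); apply: le_trans l1 _.
by rewrite -!natrX -natrM ler_nat.
Qed.

Lemma exp_gt_nat_expR (R : realType) (k n : nat) : (0 < k)%N ->
  ~~ RealPNT.exp_le_nat k n -> n%:R <= expR k.+1%:R :> R.
Proof.
move=> k0 h; have /andP[_ u1] := expR_pow_bounds R k k0.
have p : 0 < k%:R ^+ (k * k.+1) :> R by rewrite exprn_gt0 // ltr0n.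
rewrite -(ler_pM2r p); apply: le_trans u1.
by rewrite -!natrX -natrM ler_nat; apply: ltnW; rewrite ltnNge.
Qed.

(** The level 1 passes the test since [2 ^ 2 <= n], and any level satisfies [k <= exp k <= n], so
    there is a largest one. [R] serves only to prove this bound. *)
Lemma exists_exp_level (R : realType) (n : nat) : (4 <= n)%N ->
  exists k, [/\ (0 < k)%N, RealPNT.exp_le_nat k n & ~~ RealPNT.exp_le_nat k.+1 n].
Proof.
move=> n4; have n0 : 0 < n%:R :> R by rewrite ltr0n (leq_trans _ n4).
have E1 : RealPNT.exp_le_nat 1 n by rewrite /RealPNT.exp_le_nat exp1n muln1.
have bound k : RealPNT.exp_le_nat k n -> (k <= n)%N.
  case: k => [//|k] h; rewrite -(ler_nat R); apply: le_trans (exp_le_nat_expR R k.+1 n isT h).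
  by apply: le_trans (expR_ge1Dx _); rewrite lerDr.
have [k Ek kmax] := ex_maxnP (ex_intro _ 1%N E1) bound.
exists k; split=> //; first exact: kmax.
by apply/negP => /kmax; rewrite ltnn.
Qed.

(** Here [N] is the integer part of [x], [l] its logarithm and [K] the integer level. As
    [l <= K + 3 <= 4 * K], passing from [/ K ^ 2] to [/ l ^ 2] costs 16; [c + 4] covers [c], the 3
    from [l - K] and the 1 from [x - N]. *)
Lemma count_bound_transfer (F : realFieldType) (K N x l c p : F) :
  1 <= K -> K <= l -> l <= K + 3 -> l < x -> 0 < N -> N <= x -> x < N + 1 -> 0 <= c ->
  p * K ^+ 2 <= N * K + c * N -> N * K <= p * K ^+ 2 + c * N ->
  `|p - x / l| <= 16 * (c + 4) * `|x / l ^+ 2|.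
Proof.
move=> K1 Kl lK lx N0 Nx xN c0 H1 H2.
have l0 : 0 < l by lra.
have x0 : 0 < x by lra.
have K0 : 0 < K by lra.
rewrite [X in _ <= _ * X]ger0_norm; last by rewrite divr_ge0 ?exprn_ge0 // ltW.
rewrite -exprVn; have il : l^-1 * l = 1 by rewrite mulVf ?gt_eqF.
have iK : K^-1 * K = 1 by rewrite mulVf ?gt_eqF.
have j0 : 0 < l^-1 by rewrite invr_gt0.
have i0 : 0 < K^-1 by rewrite invr_gt0.
(* The inverses become variables known only through [j * l = 1] and [i * K = 1], so that the final
   step is linear. *)
move: l^-1 K^-1 il iK j0 i0 => j i jl iK j0 i0.
have ji : j <= i by rewrite -[i]mulr1 -jl mulrCA -[leLHS]mulr1 ler_pM2l // -iK ler_pM2l.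
have il4 : i * l <= 4.
  have -> : 4 = i * (4 * K) by rewrite mulrCA iK mulr1.
  by rewrite ler_pM2l //; lra.
have i4 : i <= 4 * j.
  by rewrite -[leLHS](_ : i * l * j = i) ?ler_pM2r // -mulrA (mulrC l) jl mulr1.
have E1 : p = (p * K ^+ 2) * i ^+ 2 by rewrite -mulrA -exprMn (mulrC K) iK expr1n mulr1.
have i2 : 0 < i ^+ 2 by rewrite exprn_gt0.
have Ki2 : K * i ^+ 2 = i by rewrite expr2 mulrA (mulrC K) iK mul1r.
have U : p <= N * i + c * (N * i ^+ 2).
  rewrite E1; apply: le_trans (ler_wpM2r (ltW i2) H1) _.
  rewrite le_eqVlt; apply/orP; left; apply/eqP.
  by rewrite mulrDl -!mulrA Ki2.
have L : N * i <= p + c * (N * i ^+ 2).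
  have := ler_wpM2r (ltW i2) H2; by rewrite mulrDl -E1 -!mulrA Ki2.
have ii : i <= x * i ^+ 2.
  rewrite expr2 mulrA -[leLHS]mul1r ler_pM2r // -iK mulrC ler_pM2r //; lra.
have Ni : N * i <= x * i by rewrite ler_pM2r.
have Ni2 : c * (N * i ^+ 2) <= c * (x * i ^+ 2) by rewrite ler_wpM2l // ler_pM2r.
have xi : x * i <= N * i + i by rewrite -[X in _ + X]mul1r -mulrDl ler_pM2r // ltW.
have d : x * i - x * j <= 3 * (x * i ^+ 2).
  have -> : x * i - x * j = (l - K) * (x * i * j).
    transitivity (x * i * (j * l) - x * j * (i * K)); last by ring.
    by rewrite jl iK; ring.
  apply: le_trans (_ : 3 * (x * i * j) <= _); first by rewrite ler_pM2r ?mulr_gt0 //; lra.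
  apply: ler_wpM2l => //; rewrite expr2 mulrA; apply: ler_wpM2l ji.
  by rewrite mulr_ge0 // ltW.
have xj : x * j <= x * i by rewrite ler_pM2l.
have sq : x * i ^+ 2 <= 16 * (x * j ^+ 2).
  rewrite [leRHS]mulrCA; apply: ler_wpM2l; first exact: ltW.
  rewrite (_ : 16 * j ^+ 2 = (4 * j) ^+ 2); last by ring.
  by rewrite lerXn2r ?nnegrE //; [exact: ltW | rewrite mulr_ge0 // ltW].
have cq : c * (x * i ^+ 2) <= c * (16 * (x * j ^+ 2)) by rewrite ler_wpM2l.
have q0 : 0 <= x * j ^+ 2 by rewrite mulr_ge0 ?exprn_ge0 // ltW.
by rewrite ler_norml; apply/andP; split; lra.
Qed.

Theorem theorem7p2 (R : realType) :
  (fun x : R => (prime_pi x)%:R : R) =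
    (fun x : R => x / ln x) +O_ (pinfty_nbhs R) (fun x : R => x / ln x ^+ 2).
Proof.
have [C HC] := RealPNT.prime_count_nat.
apply/eqaddOP; apply/bigO_exP; exists (16 * (C%:R + 4)).
  by have := ler0n R C; lra.
(* Any [x] beyond 5 has integer part at least 4, as [exists_exp_level] asks. *)
exists 5; split => [|x x5]; first exact: num_real.
have x0 : 0 < x by lra.
change (`|(prime_pi x)%:R - x / ln x| <= 16 * (C%:R + 4) * `|x / ln x ^+ 2|).
rewrite prime_pi_count; set n := Num.trunc x.
have /andP[nx xn] : n%:R <= x < n.+1%:R by apply: truncn_itv; lra.
have n4 : (4 <= n)%N by rewrite /n truncn_ge_nat; lra.
have n0 : 0 < n%:R :> R by rewrite ltr0n (leq_trans _ n4).
have [k [k0 k1 k2]] := exists_exp_level R n n4.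
have [H1 H2] := HC n k (leq_trans (isT : (1 < 4)%N) n4) k0 k1 k2.
set P := count _ _ in H1 H2 *; set l := ln x.
have kl : k%:R <= l.
  rewrite -(expRK k%:R) ler_ln ?posrE ?expR_gt0 //.
  exact: le_trans (exp_le_nat_expR R k n k0 k1) nx.
(* The level gives [n <= exp (k + 2)]; the third unit pays for the fractional part, since
   [x < n + 1 <= 2 * n] and [2 <= exp 1]. *)
have lk : l <= k%:R + 3.
  have -> : k%:R + 3 = k.+2%:R + 1 :> R by rewrite -!natr1; ring.
  rewrite -(expRK (_ + 1)) ler_ln ?posrE ?expR_gt0 // expRD.
  have h1 := exp_gt_nat_expR R k.+1 n isT k2.
  have h2 := expR_ge1Dx (1 : R); have h3 := expR_gt0 (k.+2%:R : R).
  move: xn; rewrite -natr1 => xn.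
  have n1 : 1 <= n%:R :> R by rewrite ler1n (leq_trans _ n4).
  have := ler_wpM2l (ltW h3) h2; lra.
have lx : l < x by apply: ln_sublinear.
have kr : 1 <= k%:R :> R by rewrite ler1n.
rewrite -natr1 in xn.
apply: (count_bound_transfer _ k%:R n%:R _ _ C%:R) => //.
  by move: H1; rewrite -(ler_nat R) natrD (natrM _ P) natrX !natrM.
by move: H2; rewrite -(ler_nat R) natrD (natrM _ P) natrX !natrM.
Qed.
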